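(* Let $(M,\circ,e,E,\eta)$ be a Dubrovin--Frobenius manifold of dimension $n$ with non-empty caustic $K$, and suppose that for a point $p\in K$ the germ of $M$ at $p$ as an $F$-manifold is isomorphic to $I_2(m)\times(A_1)^{n-2}$ with $m\ge3$. Assume that the pullback of $\eta$ to $K$ is non-degenerate. Then the fundamental matrix solutions $Y_{\mathrm L}$ and $Y_\nu$, $\nu\in\mathbb Z$, of the family $\frac{dY}{dz}=\left(\frac1zV(u)-U(u)\right)Y$ parametrized by $u$ in a small domain $D\subset K$ (see context) have constant monodromy data: the monodromy matrix $e^{2\pi\mathrm i(R+S)}$ of $Y_{\mathrm L}$ at $z=0$, the exponent of formal monodromy $B$ at $z=\infty$, the Stokes matrices $\mathbb S_\nu$ ($\nu\in\mathbb Z$), and the central connection matrix $C$ defined by $Y_{\mathrm L}=Y_0C$ are all independent of $u\in D$.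
   Context: All objects are holomorphic; a metric is a holomorphic non-degenerate symmetric bilinear form on the tangent sheaf. An $F$-manifold $(M,\circ,e)$ is a complex manifold with a commutative, associative, $\mathcal O_M$-bilinear multiplication $\circ$ on $\mathcal T_M$ with global unit field $e$ such that $\mathcal L_{X\circ Y}(\circ)=X\circ\mathcal L_Y(\circ)+Y\circ\mathcal L_X(\circ)$ for all local vector fields. An Euler field is a global vector field $E$ with $\mathcal L_E(\circ)=\circ$. A point $p$ is semisimple if $T_pM$ has no non-zero nilpotents; the caustic $K$ is the set of non-semisimple points. A Dubrovin--Frobenius manifold $(M,\circ,e,E,\eta)$ is an $F$-manifold with Euler field $E$ and a metric $\eta$ such that $\eta(X\circ Y,Z)=\eta(X,Y\circ Z)$; $\nabla e=0$ ($\nabla$ the Levi-Civita connection of $\eta$); $\mathcal L_E\eta=(2-d)\eta$, $d$ constant; $\eta$ is flat. Put $\mu:=\frac{2-d}{2}\mathrm{Id}-\nabla E$. Local structure: that the germ at $p$ is $I_2(m)\times(A_1)^{n-2}$ means there are coordinates $(t,u_2,\dots,u_n)$ on a neighborhood $W$ of $p$, with $\pi_i:=\partial_{u_i}$, such that $\partial_t\circ\partial_t=t^{m-2}\pi_2$, $\partial_t\circ\pi_2=\partial_t$, $\pi_2\circ\pi_2=\pi_2$, $\partial_t\circ\pi_i=\pi_2\circ\pi_i=0$ for $i\ge3$, $\pi_i\circ\pi_j=\delta_{ij}\pi_i$ for $i,j\ge3$, chosen so that $E=\frac2mt\,\partial_t+\sum_{i\ge2}u_i\pi_i$. Then $K\cap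 W=\{t=0\}$ with coordinates $u=(u_2,\dots,u_n)$. Let $N$ be a unit normal field to $K$ and $f_i=\pi_i/\sqrt{\eta(\pi_i,\pi_i)}$, $i=2,\dots,n$; in the orthonormal frame $N=f_1,f_2,\dots,f_n$ of $TM|_K$, $E\circ$ has matrix $U=\mathrm{diag}(u_2,u_2,u_3,\dots,u_n)$ and $\mu$ has antisymmetric matrix $V$. Let $D\subset K\cap W$ be a sufficiently small simply connected domain on which $u_2,\dots,u_n$ are pairwise distinct. Flat connection: let $i:K\to M$, $j=\mathrm{id}\times i:\mathbb P^1\times K\to\mathbb P^1\times M$ and $\pi:\mathbb P^1\times M\to M$ the projection. On $\pi^*\mathcal T_M$ the deformed connection is $\bar\nabla_wv=\nabla_wv+z\,w\circ v$ ($w$ tangent to $M$), $\bar\nabla_{\partial_z}v=\partial_zv+E\circ v-\frac1z\mu v$; it is flat, with singularities at $z=0,\infty$. Its pullback $j^*\bar\nabla$ is a flat connection on $(\pi\circ j)^*\mathcal T_M$; in the frame $N,f_2,\dots,f_n$ its $\partial_z$-part gives the system $\frac{dY}{dz}=\left(\frac1zV-U\right)Y$. Solution at $z=0$: $Y_{\mathrm L}=T z^{\Delta}z^{R+S}$ is a Levelt fundamental solution, $T=T_0+\sum_{k\ge1}T_kz^k$ holomorphic near $z=0$ with $T_0$ invertible, $J=T_0^{-1}VT_0=\Delta+S$ the Jordan form of $V$, with $\Delta$ diagonal with integer entries and the eigenvalues of $S$ having real part in $[0,1)$, $R=\sum_{k\geq 1} R_k$ where $(R_k)^i_j\ne0$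 only if the eigenvalues $\mu_i,\mu_j$ of $\mu$ satisfy $\mu_i-\mu_j=k\in\mathbb N_{>0}$; it is chosen so that its columns are $j^*\bar\nabla$-flat. Formal solution at $z=\infty$: there is a formal gauge transformation $G=\mathrm{Id}+\sum_{k\ge1}G_k(u)z^{-k}$ (unique with $(G_k)^1_2=(G_k)^2_1=(G_k)^i_i=0$) such that $Y=G\tilde Y$ gives $\frac{d\tilde Y}{dz}=\left(-U+\sum_{k\ge1}B_kz^{-k}\right)\tilde Y$ with every $B_k$ block diagonal with one $2\times2$ block (indices $1,2$) and $n-2$ blocks of size 1. Writing $\tilde Y=e^{-Uz}\bar Y$, there is a formal block-diagonal transformation $\bar Y=H\hat Y$, $H=H_0(\mathrm{Id}+\sum_{k\ge1}H_kz^{-k})$, to $\frac{d\hat Y}{dz}=\frac Bz\hat Y$, where $B=H_0^{-1}B_1H_0=\mathrm{diag}(\mathrm iV^1_2,-\mathrm iV^1_2,0,\dots,0)$ is the exponent of formal monodromy. Here $H_0$ is the identity on the indices $3,\dots,n$ and its $2\times2$ block is an invertible matrix diagonalizing $\begin{pmatrix}0&V^1_2\\-V^1_2&0\end{pmatrix}$ and satisfying $dH_0=-\sum_{i=2}^n({}_2\omega_i)H_0\,du_i$, where ${}_2\omega_i$ is the upper left $2\times2$ block of the matrix $\omega_i$ given by $\nabla_{\pi_i}f_\beta=\sum_\alpha(\omega_i)^\alpha_\beta f_\alpha$ along $K$. The formal solution is $Y_F=GHz^Be^{-Uz}$. Solutions $Y_\nu$: a line $\ell$ through $0$ in the $z$-plane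 is admissible if $\mathrm{Re}(z(u_i-u_j))\ne0$ for $z\in\ell\setminus\{0\}$ whenever $u_i\ne u_j$. Let $\phi$ be the angle of a fixed line admissible for all $u\in D$; for small $\epsilon>0$ let $S_0=\{\arg z\in(\phi-\pi-\epsilon,\phi+\epsilon)\}$ and $S_\nu=e^{\mathrm i\nu\pi}S_0$ (on the universal cover of $\mathbb C\setminus\{0\}$). $Y_\nu$ is the fundamental solution, holomorphic in $(z,u)$, with $Y_\nu\sim Y_F$ as $z\to\infty$ in $S_\nu$, uniformly in $u\in D$ (that is, $Y_\nu e^{Uz}z^{-B}$ is asymptotic to the formal series $GH$). Stokes matrices are defined by $Y_{\nu+1}=Y_\nu\mathbb S_\nu$. *)

(* Defs.v *)
From mathcomp Require Import all_boot all_order all_algebra.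
From mathcomp Require Import all_classical all_reals all_analysis.
From mathcomp.real_closed Require Import complex.
Set Implicit Arguments.
Unset Strict Implicit.
Unset Printing Implicit Defensive.
Import Order.TTheory GRing.Theory Num.Theory.
Import numFieldNormedType.Exports.
Local Open Scope classical_set_scope.
Local Open Scope ring_scope.

(* R[i], sealed behind its numClosedFieldType structure so that the
   normed-module structures over a numClosedFieldType apply to it. *)
Definition Cx (R : realType) : numClosedFieldType := R[i]%C.

Definition toC {R : realType} (r : R) : Cx R := (r +i* 0)%C.
Definition ReC {R : realType} (z : Cx R) : R := complex.Re z.
Definition ImC {R : realType} (z : Cx R) : R := complex.Im z.

Definition cexp {R : realType} (z : Cx R) : Cx R :=
  Complex (expR (ReC z) * cos (ImC z)) (expR (ReC z) * sin (ImC z)).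

(* "Differentiable" is over the base field of the modules, here C. *)
Definition holomorphic {R : realType} {V W : normedModType (Cx R)}
  (O : set V) (f : V -> W) : Prop :=
  forall y, O y -> differentiable f y.

Section matrix_exponential.
Context {R : realType} {n : nat}.
Implicit Types A : 'M[Cx R]_n.+1.

Definition mexp A : 'M[Cx R]_n.+1 :=
  limn (series (fun k : nat => ((k`!)%:R : Cx R)^-1 *: A ^+ k)).

(* z ^ A on the universal cover of C \ {0}, the point x lying over z = cexp x *)
Definition mpow (x : Cx R) A : 'M[Cx R]_n.+1 := mexp (x *: A).

End matrix_exponential.

(* The values of cmap off cdom, and of cinv off the image of cdom, are junk. *)
Record chart (R : realType) (M : topologicalType) (n : nat) := Chart {
  cdom : set M ;
  cmap : M -> 'rV[Cx R]_n ;
  cinv : 'rV[Cx R]_n -> M }.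

Section manifold.
Context {R : realType} {M : topologicalType} {n : nat}.
Local Notation C := (Cx R).
Local Notation V := 'rV[C]_n.+1.
Implicit Types x : chart R M n.+1.

Definition cimg x : set V := cmap x @` cdom x.

Definition is_chart x : Prop :=
  [/\ open (cdom x), open (cimg x),
      {within cdom x, continuous (cmap x)},
      {within cimg x, continuous (cinv x)} &
      forall q, cdom x q -> cinv x (cmap x q) = q].

Definition transition x x' : V -> V := cmap x' \o cinv x.

Definition overlap x x' : set V := cmap x @` (cdom x `&` cdom x').

Definition compatible x x' : Prop :=
  holomorphic (overlap x x') (transition x x') /\
  holomorphic (overlap x' x) (transition x' x).

Definition maximal_atlas (A : set (chart R M n.+1)) : Prop :=
  [/\ forall x, A x -> is_chart x,
      forall q, exists2 x, A x & cdom x q,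
      forall x x', A x -> A x' -> compatible x x' &
      forall x, is_chart x -> (forall x', A x' -> compatible x x') -> A x].

Definition push x x' (y v : V) : V := 'D_v (transition x x') y.

End manifold.

(* Everything in this section takes place in one chart: a point y of C^n and
   tangent vectors there are row vectors of coordinates, a vector field is a
   function V -> V, a multiplication (resp. a metric) is y |-> (v, w) |-> v o w
   (resp. g(v, w)). *)
Section local_geometry.
Context {R : realType} {n : nat}.
Local Notation C := (Cx R).
Local Notation V := 'rV[C]_n.+1.
Implicit Types (X Y Z : V -> V) (mul : V -> V -> V -> V) (g : V -> V -> V -> C).

Definition bilinear_map (W : lmodType C) (b : V -> V -> W) : Prop :=
  (forall a u v w, b (a *: u + v) w = a *: b u w + b v w) /\
  (forall a u v w, b w (a *: u + v) = a *: b w u + b w v).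

Definition bracket X Y : V -> V :=
  fun y => 'D_(X y) Y y - 'D_(Y y) X y.

Definition fmul mul X Y : V -> V := fun y => mul y (X y) (Y y).

(* (L_X o)(Y, Z) *)
Definition lie_mul mul X Y Z : V -> V := fun y =>
  bracket X (fmul mul Y Z) y - fmul mul (bracket X Y) Z y
  - fmul mul Y (bracket X Z) y.

Definition gmet g X Y : V -> C := fun y => g y (X y) (Y y).

(* (L_X g)(Y, Z) *)
Definition lie_metric g X Y Z : V -> C := fun y =>
  'D_(X y) (gmet g Y Z : V -> C^o) y - gmet g (bracket X Y) Z y
  - gmet g Y (bracket X Z) y.

Definition coord_vec (i : 'I_n.+1) : V := delta_mx 0 i.

Definition gram g (y : V) : 'M[C]_n.+1 :=
  \matrix_(i, j) g y (coord_vec i) (coord_vec j).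

(* Gamma(v, w)^l = 1/2 sum_k (d_v g_wk + d_w g_vk - d_k g_vw) g^kl *)
Definition christoffel g (y v w : V) : V :=
  (2%:R^-1 *: \row_k ('D_v (fun y' => g y' w (coord_vec k) : C^o) y
                    + 'D_w (fun y' => g y' v (coord_vec k) : C^o) y
                    - 'D_(coord_vec k) (fun y' => g y' v w : C^o) y))
  *m invmx (gram g y).

(* nabla_v Y at y, for the Levi-Civita connection of g *)
Definition covd g (y v : V) Y : V := 'D_v Y y + christoffel g y v (Y y).

Definition nabla g X Y : V -> V := fun y => covd g y (X y) Y.

Definition local_fields (O O' : set V) : Prop := open O' /\ O' `<=` O.

Definition F_manifold_on (O : set V) mul (e : V -> V) : Prop :=
  [/\ forall y, O y -> bilinear_map (mul y),
      forall y v w, O y -> mul y v w = mul y w v,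
      forall y u v w, O y -> mul y u (mul y v w) = mul y (mul y u v) w,
      forall y v, O y -> mul y (e y) v = v &
      forall O', local_fields O O' ->
      forall X Y Z W, holomorphic O' X -> holomorphic O' Y ->
        holomorphic O' Z -> holomorphic O' W ->
      forall y, O' y ->
        lie_mul mul (fmul mul X Y) Z W y
        = mul y (X y) (lie_mul mul Y Z W y)
          + mul y (Y y) (lie_mul mul X Z W y)].

Definition euler_on (O : set V) mul (E : V -> V) : Prop :=
  forall O', local_fields O O' ->
  forall Z W, holomorphic O' Z -> holomorphic O' W ->
  forall y, O' y -> lie_mul mul E Z W y = fmul mul Z W y.

Definition metric_on (O : set V) g : Prop :=
  [/\ forall y, O y -> @bilinear_map C^o (g y),
      forall y v w, O y -> g y v w = g y w v &
      forall y v, O y -> (forall w, g y v w = 0) -> v = 0].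

Definition flat_on (O : set V) g : Prop :=
  forall O', local_fields O O' ->
  forall X Y Z, holomorphic O' X -> holomorphic O' Y -> holomorphic O' Z ->
  forall y, O' y ->
    nabla g X (nabla g Y Z) y - nabla g Y (nabla g X Z) y
    - nabla g (bracket X Y) Z y = 0.

Definition dubrovin_frobenius_on (O : set V) mul (e E : V -> V) g (d : C) :=
  [/\ F_manifold_on O mul e, euler_on O mul E, metric_on O g,
      (forall y u v w, O y -> g y (mul y u v) w = g y u (mul y v w)) &
      [/\ forall y v, O y -> covd g y v e = 0,
          forall O', local_fields O O' ->
            forall Y Z, holomorphic O' Y -> holomorphic O' Z ->
            forall y, O' y ->
              lie_metric g E Y Z y = (2%:R - d) * gmet g Y Z y &
          flat_on O g]].

Definition semisimple_algebra (m : V -> V -> V) : Prop :=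
  forall v, (exists k, iter k (m v) v = 0) -> v = 0.

(* mu = (2 - d) / 2 Id - nabla E on the tangent space at y *)
Definition mu_op g (E : V -> V) (d : C) (y v : V) : V :=
  ((2%:R - d) / 2%:R) *: v - covd g y v E.

End local_geometry.

(* The tensors are given by their components in every chart x of the atlas,
   as functions of the coordinates y in cimg x (junk elsewhere). *)
Record df_data (R : realType) (M : topologicalType) (n : nat) := DFData {
  df_atlas : set (chart R M n) ;
  df_mul : chart R M n ->
    'rV[Cx R]_n -> 'rV[Cx R]_n -> 'rV[Cx R]_n -> 'rV[Cx R]_n ;
  df_unit : chart R M n -> 'rV[Cx R]_n -> 'rV[Cx R]_n ;
  df_euler : chart R M n -> 'rV[Cx R]_n -> 'rV[Cx R]_n ;
  df_metric : chart R M n ->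
    'rV[Cx R]_n -> 'rV[Cx R]_n -> 'rV[Cx R]_n -> Cx R ;
  df_d : Cx R }.

Section dubrovin_frobenius.
Context {R : realType} {M : topologicalType} {n : nat}.
Local Notation C := (Cx R).
Local Notation V := 'rV[C]_n.+1.
Implicit Types F : df_data R M n.+1.

Definition holomorphic_tensors F : Prop := forall x, df_atlas F x ->
  [/\ holomorphic (cimg x) (df_unit F x),
      holomorphic (cimg x) (df_euler F x),
      forall v w, holomorphic (cimg x) (fun y => df_mul F x y v w) &
      forall v w, holomorphic (cimg x) (fun y => df_metric F x y v w : C^o)].

Definition tensorial F : Prop :=
  forall x x', df_atlas F x -> df_atlas F x' ->
  forall q, cdom x q -> cdom x' q ->
  let y := cmap x q in let y' := cmap x' q in let P := push x x' y in
  [/\ df_unit F x' y' = P (df_unit F x y),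
      df_euler F x' y' = P (df_euler F x y),
      forall v w, df_mul F x' y' (P v) (P w) = P (df_mul F x y v w) &
      forall v w, df_metric F x' y' (P v) (P w) = df_metric F x y v w].

Definition dubrovin_frobenius F : Prop :=
  [/\ hausdorff_space M /\ @second_countable M, maximal_atlas (df_atlas F),
      holomorphic_tensors F, tensorial F &
      forall x, df_atlas F x ->
        dubrovin_frobenius_on (cimg x) (df_mul F x) (df_unit F x)
          (df_euler F x) (df_metric F x) (df_d F)].

Definition semisimple_point F (q : M) : Prop :=
  forall x, df_atlas F x -> cdom x q ->
    semisimple_algebra (df_mul F x (cmap x q)).

Definition caustic F : set M := [set q | ~ semisimple_point F q].

(* The caustic is an analytic hypersurface which may have singularities; its
   tangent spaces are taken where it is a submanifold, i.e., in the charts in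
   which it is the hyperplane where the first coordinate vanishes. *)
Definition caustic_nondegenerate F : Prop :=
  forall x, df_atlas F x ->
  (forall q, cdom x q -> (caustic F q <-> cmap x q 0 0 = 0)) ->
  forall q, cdom x q -> caustic F q ->
  forall v : V, v 0 0 = 0 ->
    (forall w : V, w 0 0 = 0 -> df_metric F x (cmap x q) v w = 0) -> v = 0.

End dubrovin_frobenius.

(* From here on the dimension of M is n = k.+2 and the coordinates are
   (t, u_2, ..., u_n): index 0 is t, and u_i has index i - 1. A point of the
   caustic has coordinates u : 'rV_k.+1, in which u_i has index i - 2. *)
Section normal_form.
Context {R : realType} {M : topologicalType} {k : nat}.
Local Notation C := (Cx R).
Local Notation V := 'rV[C]_k.+2.
Local Notation U := 'rV[C]_k.+1.

Definition dt : V := delta_mx 0 ord0.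
Definition pi_ (i : 'I_k.+1) : V := delta_mx 0 (lift ord0 i).

(* the inclusion of {t = 0}, which is the part of the caustic in the chart *)
Definition emb (u : U) : V := \sum_(i < k.+1) u 0 i *: pi_ i.

Definition I2_A1_chart (F : df_data R M k.+2) (m : nat)
    (x : chart R M k.+2) : Prop :=
  df_atlas F x /\
  forall y, cimg x y ->
  let mul := df_mul F x y in
  [/\ mul dt dt = (y 0 0) ^+ (m - 2) *: pi_ ord0,
      mul dt (pi_ ord0) = dt,
      forall i, i != ord0 -> mul dt (pi_ i) = 0,
      forall i j, mul (pi_ i) (pi_ j) = if i == j then pi_ i else 0 &
      df_euler F x y = (2%:R / m%:R * y 0 0) *: dt
        + \sum_(i < k.+1) y 0 (lift ord0 i) *: pi_ i].

End normal_form.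

Section domains.
Context {R : realType} {n : nat}.
Local Notation C := (Cx R).
Implicit Types D : set 'rV[C]_n.

Definition path_connected_set D : Prop :=
  forall a b, D a -> D b -> exists c : R -> 'rV[C]_n,
    [/\ {within `[0, 1], continuous c}, c @` `[0, 1] `<=` D,
        c 0 = a & c 1 = b].

Definition loops_contractible D : Prop :=
  forall c : R -> 'rV[C]_n,
    {within `[0, 1], continuous c} -> c @` `[0, 1] `<=` D -> c 0 = c 1 ->
  exists h : R * R -> 'rV[C]_n,
    [/\ {within `[0, 1] `*` `[0, 1], continuous h},
        h @` (`[0, 1] `*` `[0, 1]) `<=` D,
        forall s, s \in `[0, 1] -> h (0, s) = c s,
        forall s, s \in `[0, 1] -> h (1, s) = c 0 &
        forall r, r \in `[0, 1] -> h (r, 0) = c 0 /\ h (r, 1) = c 0].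

Definition simply_connected_domain D : Prop :=
  [/\ open D, D !=set0, path_connected_set D & loops_contractible D].

Definition distinct_coordinates D : Prop :=
  forall u, D u -> forall i j, i != j -> u 0 i != u 0 j.

(* the line through 0 of angle phi *)
Definition admissible (phi : R) (u : 'rV[C]_n) : Prop :=
  forall i j, u 0 i != u 0 j -> forall r : R, r != 0 ->
    ReC (toC r * cexp ('i * toC phi) * (u 0 i - u 0 j)) != 0.

(* S_nu, as a subset of the universal cover with coordinate x = log z *)
Definition sector (phi eps : R) (nu : int) : set C :=
  [set x : C | phi - pi - eps + nu%:~R * pi < ImC x
               < phi + eps + nu%:~R * pi].

End domains.

Section frame.
Context {R : realType} {k : nat}.
Local Notation C := (Cx R).
Local Notation V := 'rV[C]_k.+2.
Local Notation U := 'rV[C]_k.+1.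
Local Notation mat := 'M[C]_k.+2.
Variables (mul : V -> V -> V -> V) (E : V -> V) (g : V -> V -> V -> C) (d : C).

(* Nf is the unit normal N, s i is the branch of sqrt (g (pi_i, pi_i)) *)
Definition normal_frame_data (D : set U) (Nf : U -> V)
    (s : 'I_k.+1 -> U -> C) : Prop :=
  [/\ holomorphic D Nf,
      forall u, D u -> g (emb u) (Nf u) (Nf u) = 1,
      forall u i, D u -> g (emb u) (Nf u) (pi_ i) = 0,
      forall i, holomorphic D (s i : U -> C^o) &
      forall u i, D u -> s i u ^+ 2 = g (emb u) (pi_ i) (pi_ i)].

Section given_frame.
Variables (Nf : U -> V) (s : 'I_k.+1 -> U -> C).

Definition frame (b : 'I_k.+2) (u : U) : V :=
  if unlift ord0 b is Some i then (s i u)^-1 *: pi_ i else Nf u.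

Definition frame_mx (u : U) : mat := \matrix_(b < k.+2) frame b u.

(* the matrix A with w_b = sum_a A a b *: frame a u *)
Definition in_frame (u : U) (w : 'I_k.+2 -> V) : mat :=
  \matrix_(a, b) (w b *m invmx (frame_mx u)) 0 a.

Definition Vmx (u : U) : mat :=
  in_frame u (fun b => mu_op g E d (emb u) (frame b u)).

Definition Umx (u : U) : mat :=
  diag_mx (\row_b (if unlift ord0 b is Some i then u 0 i else u 0 0)).

(* nabla_(pi_i) of a vector field v of M along the caustic *)
Definition covd_caustic (i : 'I_k.+1) (v : U -> V) (u : U) : V :=
  'D_(delta_mx 0 i) v u + christoffel g (emb u) (pi_ i) (v u).

Definition omega (i : 'I_k.+1) (u : U) : mat :=
  in_frame u (fun b => covd_caustic i (frame b) u).

Definition omega2 (i : 'I_k.+1) (u : U) : 'M[C]_2 :=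
  ulsubmx (omega i u : 'M[C]_(2 + k)).

(* dY/dz = (V / z - U) Y with x = log z, so that dY/dx = z dY/dz *)
Definition solves_system (D : set U) (Y : C -> U -> mat) : Prop :=
  forall u x, D u ->
    derive1 (fun x' : C => Y x' u) x
    = cexp x *: (((cexp x)^-1 *: Vmx u - Umx u) *m Y x u).

Definition fundamental_solution (D : set U) (Y : C -> U -> mat) : Prop :=
  [/\ holomorphic ([set: C^o] `*` D)
        (fun q : C^o * U => Y q.1 q.2 : 'M[C]_(k.+2, k.+2)),
      forall x u, D u -> Y x u \in unitmx &
      solves_system D Y].

(* the vector field represented by the b-th column of Y *)
Definition column_field (Y : C -> U -> mat) (b : 'I_k.+2) (x : C) (u : U) : V :=
  \sum_(a < k.+2) Y x u a b *: frame a u.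

(* flatness for the pullback of the deformed connection to the caustic *)
Definition flat_columns (D : set U) (Y : C -> U -> mat) : Prop :=
  forall b x u, D u ->
    let v := column_field Y b in
    (forall i, covd_caustic i (v x) u
               + cexp x *: mul (emb u) (pi_ i) (v x u) = 0) /\
    (cexp x)^-1 *: derive1 (fun x' : C => v x' u) x
    + mul (emb u) (E (emb u)) (v x u)
    - (cexp x)^-1 *: mu_op g E d (emb u) (v x u) = 0.

End given_frame.

End frame.

Section solutions.
Context {R : realType} {k : nat}.
Local Notation C := (Cx R).
Local Notation U := 'rV[C]_k.+1.
Local Notation mat := 'M[C]_k.+2.

Definition is_jordan (J : mat) : Prop :=
  forall i j : 'I_k.+2, i != j ->
    J i j = 0 \/ [/\ j = i.+1 :> nat, J i j = 1 & J i i = J j j].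

Definition levelt_form (D : set U) (Vm : U -> mat) (Y : C -> U -> mat)
    (T : C -> U -> mat) (Delta S : U -> mat) (Rk : nat -> U -> mat)
    (K : nat) : Prop :=
  forall u, D u ->
  let Rm := \sum_(1 <= h < K) Rk h u in
  let J := invmx (T 0 u) *m Vm u *m T 0 u in
  [/\ T 0 u \in unitmx /\
      \forall z \near (0 : C), differentiable (fun z' : C^o => T z' u) z /\
        forall x, cexp x = z ->
          Y x u = T z u *m mpow x (Delta u) *m mpow x (Rm + S u),
      is_jordan J /\ J = Delta u + S u,
      forall i j, if i == j then exists c : int, Delta u i j = c%:~R
                  else Delta u i j = 0,
      forall a, eigenvalue (S u) a -> 0 <= ReC a < 1 &
      forall h i j, (1 <= h < K)%N -> Rk h u i j != 0 -> J i i - J j j = h%:R].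

(* A sequence A of matrices stands for the formal series sum_j A_j z^-j. *)
Definition formal_mul (A B : nat -> mat) : nat -> mat :=
  fun j => \sum_(i < j.+1) A i *m B (j - i)%N.

Definition formal_deriv (A : nat -> mat) : nat -> mat :=
  fun j => if j is i.+1 then - (A i *+ i) else 0.

(* Y = P Y' transforms dY/dz = A Y into dY'/dz = A' Y' *)
Definition formal_gauge (A P A' : nat -> mat) : Prop :=
  forall j, formal_deriv P j + formal_mul P A' j = formal_mul A P j.

Definition block_diagonal (A : mat) : Prop :=
  forall i j : 'I_k.+2, i != j -> ~~ ((i < 2) && (j < 2))%N -> A i j = 0.

Definition extend2 (h : 'M[C]_2) : mat := block_mx h 0 0 (1%:M : 'M[C]_k).

Definition i1 : 'I_k.+2 := ord0.
Definition i2 : 'I_k.+2 := lift ord0 ord0.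

(* b = V^1_2; diag (ib, -ib) and diag (ib, -ib, 0, ..., 0) *)
Definition diag2 (b : C) : 'M[C]_2 :=
  diag_mx (\row_j (if j == ord0 then 'i * b else - ('i * b))).

Definition Bmx (Vm : mat) : mat :=
  block_mx (diag2 (Vm i1 i2)) 0 0 (0 : 'M[C]_k).

Definition antisym2 (b : C) : 'M[C]_2 :=
  \matrix_(i, j) (if i == j then 0 else if i == ord0 then b else - b).

Definition first_gauge (D : set U) (Vm Um : U -> mat)
    (G B : nat -> U -> mat) : Prop :=
  forall u, D u ->
  [/\ G 0 u = 1%:M,
      B 0 u = - Um u,
      forall j, (0 < j)%N -> block_diagonal (B j u),
      forall j, (0 < j)%N -> [/\ G j u i1 i2 = 0, G j u i2 i1 = 0 &
                               forall i, G j u i i = 0] &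
      formal_gauge
        (fun j => if j is 0 then - Um u else if j is 1 then Vm u else 0)
        (fun j => G j u) (fun j => B j u)].

(* H = H_0 (Id + sum_(j >= 1) H_j z^-j), with h0 the 2 x 2 block of H_0 *)
Definition H_series (h0 : U -> 'M[C]_2) (H : nat -> U -> mat) (u : U) :
    nat -> mat :=
  fun j => if j is 0 then extend2 (h0 u) else extend2 (h0 u) *m H j u.

Definition second_gauge (D : set U) (Vm : U -> mat)
    (om2 : 'I_k.+1 -> U -> 'M[C]_2) (B : nat -> U -> mat)
    (h0 : U -> 'M[C]_2) (H : nat -> U -> mat) : Prop :=
  holomorphic D (h0 : U -> 'M[C]_(2, 2)) /\
  forall u, D u ->
  [/\ h0 u \in unitmx,
      invmx (h0 u) *m antisym2 (Vm u i1 i2) *m h0 u = diag2 (Vm u i1 i2),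
      forall i, 'D_(delta_mx 0 i) h0 u = - (om2 i u *m h0 u),
      forall j, (0 < j)%N -> block_diagonal (H j u) &
      formal_gauge (fun j => if j is 0 then 0 else B j u) (H_series h0 H u)
        (fun j => if j is 1 then Bmx (Vm u) else 0)].

Definition asymptotic_on (D : set U) (S : set C) (Y : C -> U -> mat)
    (A : U -> nat -> mat) : Prop :=
  forall N : nat, exists c r : R, forall x u, S x -> D u ->
    toC r <= `|cexp x| ->
    `|Y x u - \sum_(j < N) (cexp x) ^- j *: A u j| <= toC c * `|cexp x| ^- N.

End solutions.

(* Main.v *)
Require Import Defs.
From mathcomp Require Import all_boot all_order all_algebra.
From mathcomp Require Import all_classical all_reals all_analysis.
From mathcomp.real_closed Require Import complex.
From mathcomp Require Import perm ring lra.
Set Implicit Arguments.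
Unset Strict Implicit.
Unset Printing Implicit Defensive.
Import Order.TTheory GRing.Theory Num.Theory.
Import numFieldNormedType.Exports.
Local Open Scope classical_set_scope.
Local Open Scope ring_scope.

(* All solutions satisfy the same system in z, so C_nu := Y_L^-1 Y_nu depends
   on u only, and everything reduces to the claim that C_nu is locally
   constant. Since the columns of Y_L are flat, d Y_L = -(omega + z dU) Y_L;
   the entries of omega outside the 2 x 2 block are determined by V, and those
   in the block are removed by the gauge H_0, so that Z := H_0^-1 Y_L satisfies
   dZ = ([dU, A] - z dU) Z, where A is the coefficient of z^-1 in the expansion
   of H_0^-1 G H. Put W(u) := C_nu(u)^-1 C_nu(u0). Gronwall's inequality bounds
   Z(u) Z(u0)^-1 by exp (const * |z| |u - u0|); letting z go to infinity along
   that one of two opposite rays of the sector on which e^(z (u_i - u_j)) decays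
   kills the entries of W(u) outside the blocks for u near u0. Then W
   commutes with U and dU, the derivative of X := Z C_nu(u0) e^(zU) is
   O(|z|^(-1 + |Re B|)), and comparing X at u and u0 gives
   W - 1 = O(|z|^(-1 + 2 |Re B|)) = 0. This uses |Re B| < 1/2, which holds
   because V^1_2 = (1 - 2/m) w / 2 with w^2 = -1. No expansion is ever
   differentiated in u. *)

(** * Complex numbers and the exponential *)

(** The asymptotics of [Y_nu] are uniform in [u] but say nothing about derivatives in [u], and along
    the caustic two eigenvalues of [U] coincide. Between different eigenvalues an exponential factor
    separates the entries of [W]. Inside the 2 x 2 block there is none: [z^B] enters on both sides
    and costs [|z|^(2 |Re B|)], against the gain [|z|^-1] that the first two terms of the expansion
    give. Hence the off-block entries are killed before [W - 1] is estimated, and [|Re B| = 1/2] is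
    the threshold of the argument. The sector has opening larger than pi, so it contains both halves
    of the admissible line, on which [Re (z (u_i - u_j))] has opposite signs.

    The number [1 - 2/m] is the difference between the weights 1 of [pi_2] and [2/m] of [dt] under
    [E]; [w^2 = -1] reflects that [dt] is isotropic on [t = 0]. So [i V^1_2] is real, and constant
    by continuity. The monodromy at 0 is constant for a simpler reason: [Y_L] at [x] and at
    [x + 2 pi i] satisfy the same linear system in [u]. *)

Section complex_numbers.
Context {R : realType}.
Local Notation C := (Cx R).
Implicit Types (z w : C) (a b : R).

(** The norm of [Cx R] takes its values in [Cx R]; estimates with [expR] and [lra] need a modulus in
    [R]. [normCE] is the bridge. *)
Definition cabs z : R := Num.sqrt (ReC z ^+ 2 + ImC z ^+ 2).

Lemma normCE z : `|z| = toC (cabs z).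
Proof. exact: normc_def. Qed.

Lemma ReCD z w : ReC (z + w) = ReC z + ReC w.
Proof. by case: z; case: w. Qed.
Lemma ImCD z w : ImC (z + w) = ImC z + ImC w.
Proof. by case: z; case: w. Qed.
Lemma ReCN z : ReC (- z) = - ReC z.
Proof. by case: z. Qed.
Lemma ImCN z : ImC (- z) = - ImC z.
Proof. by case: z. Qed.
Lemma ReCB z w : ReC (z - w) = ReC z - ReC w.
Proof. by rewrite ReCD ReCN. Qed.
Lemma ReCM z w : ReC (z * w) = ReC z * ReC w - ImC z * ImC w.
Proof. by case: z; case: w. Qed.
Lemma ImCM z w : ImC (z * w) = ReC z * ImC w + ImC z * ReC w.
Proof. by case: z; case: w. Qed.
Lemma ReCi : ReC ('i : C) = 0. Proof. by []. Qed.
Lemma ImCi : ImC ('i : C) = 1. Proof. by []. Qed.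
Lemma CxP z w : ReC z = ReC w -> ImC z = ImC w -> z = w.
Proof. by case: z => a b; case: w => c d /= -> ->. Qed.

Lemma CxE z : z = toC (ReC z) + 'i * toC (ImC z).
Proof.
by apply: CxP; rewrite ?(ReCD, ImCD, ReCM, ImCM, ReCi, ImCi) /=; ring.
Qed.

Lemma toC0 : toC 0 = 0 :> C. Proof. by []. Qed.
Lemma toC1 : toC 1 = 1 :> C. Proof. by []. Qed.
Lemma toCD a b : toC (a + b) = toC a + toC b :> C.
Proof. by apply: CxP; rewrite ?(ReCD, ImCD) //= addr0. Qed.
Lemma toCN a : toC (- a) = - toC a :> C.
Proof. by apply: CxP; rewrite ?(ReCN, ImCN) //= oppr0. Qed.
Lemma toCB a b : toC (a - b) = toC a - toC b :> C.
Proof. by rewrite toCD toCN. Qed.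
Lemma toCM a b : toC (a * b) = toC a * toC b :> C.
Proof. by apply: CxP; rewrite ?(ReCM, ImCM) /=; ring. Qed.
Lemma toCX a n : toC (a ^+ n) = toC a ^+ n :> C.
Proof. by elim: n => // n IH; rewrite !exprS toCM IH. Qed.
Lemma toC_inj : injective (@toC R). Proof. by move=> a b []. Qed.
Lemma toC_eq0 a : (toC a == 0 :> C) = (a == 0).
Proof. by rewrite -toC0 (inj_eq toC_inj). Qed.
Lemma toCV a : toC a^-1 = (toC a)^-1 :> C.
Proof.
have [->|a0] := eqVneq a 0; first by rewrite invr0 toC0 invr0.
by apply: (@mulfI _ (toC a)); rewrite ?toC_eq0// -toCM !divff ?toC_eq0.
Qed.
Lemma toC_nat n : toC n%:R = n%:R :> C.
Proof. by elim: n => // n IH; rewrite -addn1 !natrD toCD IH. Qed.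
Lemma ReC_sum (I : Type) (r : seq I) (P : pred I) (F : I -> C) :
  ReC (\sum_(i <- r | P i) F i) = \sum_(i <- r | P i) ReC (F i).
Proof. by apply: (big_morph _ ReCD). Qed.
Lemma ler_toC a b : (toC a <= toC b :> C) = (a <= b).
Proof. by rewrite /toC lecR. Qed.
Lemma ltr_toC a b : (toC a < toC b :> C) = (a < b).
Proof. by rewrite /toC ltcR. Qed.
Lemma ge0_toC z : 0 <= z -> z = toC (ReC z).
Proof. by move=> z0; rewrite {1}(CxE z) /ImC ger0_Im// toC0 mulr0 addr0. Qed.

Lemma cabs_ge0 z : 0 <= cabs z. Proof. exact: sqrtr_ge0. Qed.
Lemma cabsM z w : cabs (z * w) = cabs z * cabs w.
Proof. by apply: toC_inj; rewrite toCM -!normCE normrM. Qed.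
Lemma cabsN z : cabs (- z) = cabs z.
Proof. by apply: toC_inj; rewrite -!normCE normrN. Qed.
Lemma cabsD z w : cabs (z + w) <= cabs z + cabs w.
Proof. by rewrite -ler_toC toCD -!normCE ler_normD. Qed.
Lemma cabs_toC a : cabs (toC a) = `|a|.
Proof. by rewrite /cabs /= expr0n addr0 sqrtr_sqr. Qed.
Lemma cabs0 : cabs 0 = 0. Proof. by rewrite (cabs_toC 0) normr0. Qed.
Lemma cabs1 : cabs 1 = 1. Proof. by rewrite (cabs_toC 1) normr1. Qed.
Lemma cabsi : cabs 'i = 1.
Proof. by rewrite /cabs ReCi ImCi expr0n add0r expr1n sqrtr1. Qed.
Lemma cabs_eq0 z : (cabs z == 0) = (z == 0).
Proof. by rewrite -toC_eq0 -normCE normr_eq0. Qed.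
Lemma cabsV z : cabs z^-1 = (cabs z)^-1.
Proof. by apply: toC_inj; rewrite toCV -!normCE normfV. Qed.
Lemma cabsX z n : cabs (z ^+ n) = cabs z ^+ n.
Proof. by apply: toC_inj; rewrite toCX -!normCE normrX. Qed.
Lemma cabs_sum (I : Type) (r : seq I) (P : pred I) (F : I -> C) :
  cabs (\sum_(i <- r | P i) F i) <= \sum_(i <- r | P i) cabs (F i).
Proof.
elim/big_ind2 : _ => //=; first by rewrite cabs0.
by move=> a b c d ha hb; apply: le_trans (cabsD _ _) (lerD _ _).
Qed.
Lemma cabs_sqr z : cabs z ^+ 2 = ReC z ^+ 2 + ImC z ^+ 2.
Proof. by rewrite sqr_sqrtr// addr_ge0 ?sqr_ge0. Qed.
Lemma normr_ReC z : `|ReC z| <= cabs z.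
Proof. by rewrite -sqrtr_sqr ler_wsqrtr// lerDl sqr_ge0. Qed.
Lemma normr_ImC z : `|ImC z| <= cabs z.
Proof. by rewrite -sqrtr_sqr ler_wsqrtr// lerDr sqr_ge0. Qed.
Lemma cabs_ReIm z : cabs z <= `|ReC z| + `|ImC z|.
Proof.
rewrite {1}(CxE z); apply: le_trans (cabsD _ _) _.
by rewrite cabsM cabsi mul1r !cabs_toC.
Qed.

Lemma cexpD z w : cexp (z + w) = cexp z * cexp w.
Proof.
by apply: CxP; rewrite ?(ReCM, ImCM) /= ReCD ImCD expRD ?cosD ?sinD; ring.
Qed.
Lemma cexp0 : cexp 0 = 1 :> C.
Proof. by apply: CxP; rewrite /= expR0 ?cos0 ?sin0 ?mulr1 ?mulr0. Qed.
Lemma cabs_cexp z : cabs (cexp z) = expR (ReC z).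
Proof.
rewrite /cabs /= !exprMn -mulrDr cos2Dsin2 mulr1 sqrtr_sqr.
by rewrite ger0_norm ?expR_ge0.
Qed.
Lemma cexp_neq0 z : cexp z != 0.
Proof. by rewrite -cabs_eq0 cabs_cexp gt_eqF// expR_gt0. Qed.
Lemma cexpN z : cexp (- z) = (cexp z)^-1.
Proof.
by apply: (mulfI (cexp_neq0 z)); rewrite -cexpD subrr cexp0 divff// cexp_neq0.
Qed.
Lemma cexp_toC a : cexp (toC a) = toC (expR a).
Proof. by apply: CxP => /=; rewrite ?cos0 ?sin0 ?mulr1 ?mulr0. Qed.
Lemma cexp_ipi : cexp ('i * toC pi) = -1 :> C.
Proof.
have er : ReC ('i * toC pi : C) = 0 by rewrite ReCM ReCi ImCi /=; ring.
have ei : ImC ('i * toC pi : C) = pi by rewrite ImCM ReCi ImCi /=; ring.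
rewrite /cexp er ei expR0 cospi sinpi mul1r mulr0.
by apply: CxP; rewrite ?(ReCN, ImCN) //= oppr0.
Qed.

Lemma cexp_2ipi : cexp (2%:R * 'i * toC pi) = 1 :> C.
Proof.
have -> : 2%:R * 'i * toC pi = 'i * toC pi + 'i * toC pi :> C by ring.
by rewrite cexpD cexp_ipi mulrNN mulr1.
Qed.

Lemma cexp_2ipiz (c : int) : cexp (2%:R * 'i * toC pi * c%:~R) = 1 :> C.
Proof.
have H n : cexp (2%:R * 'i * toC pi * n%:R) = 1 :> C.
  elim: n => [|n IH]; first by rewrite mulr0 cexp0.
  by rewrite -(natr1 n) mulrDr cexpD IH mulr1 cexp_2ipi mul1r.
case: c => n; first exact: H.
by rewrite NegzE mulrNz mulrN cexpN H invr1.
Qed.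

Lemma mx_entry_norm m n (M : 'M[C]_(m, n)) i j : `|M i j| <= `|M|.
Proof.
rewrite [leRHS]/Num.Def.normr /= mx_normE.
rewrite -[leLHS]nngE num_le.
exact: (le_bigmax _ (fun k : 'I_m * 'I_n => `|M k.1 k.2|%:nng) (i, j)).
Qed.

End complex_numbers.

(** * Derivatives of matrix functions *)

Lemma is_derive_fsum (K : numFieldType) (V W : normedModType K) (I : finType)
    (F : I -> V -> W) (a v : V) (dF : I -> W) :
  (forall i, is_derive a v (F i) (dF i)) ->
  is_derive a v (fun y => \sum_i F i y) (\sum_i dF i).
Proof.
move=> h; rewrite (_ : (fun _ => _) = \sum_i F i); last first.
  by apply/funext => y; rewrite fct_sumE.
elim: (index_enum I) => [|i r IH].
  by rewrite !big_nil; exact: is_derive_cst.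
by rewrite !big_cons; exact: is_deriveD.
Qed.

Section directional_derivatives.
Context {R : realType} {V : normedModType (Cx R)}.
Local Notation C := (Cx R).
Implicit Types (f g : V -> C) (a u v : V).

Lemma is_derive_line f u v (h : C) l : is_derive (u + h *: v) v f l ->
  is_derive h 1 (fun h' : C => f (u + h' *: v)) l.
Proof.
move=> [df dl].
have E : (fun k : C => k^-1 *: ((f \o shift (u + h *: v)) (k *: v)
                                - f (u + h *: v)))
  = (fun k : C => k^-1 *: (((fun h' : C => f (u + h' *: v)) \o shift h) (k *: 1)
                                - f (u + h *: v))).
  apply/funext => k /=; congr (_ *: (f _ - _)).
  by rewrite [k *: 1]mulr1 scalerDl [LHS]addrC -addrA [h *: v + _]addrC.
by split; [rewrite /derivable -E | rewrite /derive -E].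
Qed.

(** Entrywise, so that the rules for rectangular products, inverses and blocks reduce to scalar
    rules. *)
Definition is_mderive {m n} (A : V -> 'M[C]_(m, n)) a v (dA : 'M[C]_(m, n)) :=
  forall i j, is_derive a v (fun y => A y i j : C) (dA i j).

Lemma is_mderive_derive m n (A : V -> 'M[C]_(m, n)) a v :
  derivable A a v -> is_mderive A a v ('D_v A a).
Proof.
move=> dA i j.
have Aij : (h^-1 *: ((A (h *: v + a) i j : C) - A a i j)) @[h --> 0^']
    --> ('D_v A a) i j.
  apply/cvgrPdist_le => /= e e0.
  move/cvgrPdist_le : dA => /(_ _ e0); apply: filterS => h /=.
  apply: le_trans; apply: le_trans (mx_entry_norm _ i j).
  by rewrite !mxE.
by split; [apply/cvg_ex; eexists; exact: Aij | apply: cvg_lim Aij].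
Qed.

Lemma is_mderive_diff m n (A : V -> 'M[C]_(m, n)) a v :
  differentiable A a -> is_mderive A a v ('D_v A a).
Proof. by move=> dA; apply/is_mderive_derive/diff_derivable. Qed.

Lemma is_mderive_cst m n (A : 'M[C]_(m, n)) a v : is_mderive (fun=> A) a v 0.
Proof. by move=> i j; rewrite mxE; apply: is_derive_cst. Qed.

Lemma is_derive_prodC (I : finType) (F : I -> V -> C) a v :
  (forall i, derivable (F i) a v) -> derivable (fun y => \prod_i F i y) a v.
Proof.
move=> h; rewrite (_ : (fun _ => _) = \prod_i F i); last first.
  by apply/funext => y; rewrite (big_morph (fun g : V -> C => g y) (id1 := 1) (op1 := *%R)).
elim: (index_enum I) => [|i r IH].
  by rewrite big_nil; exact: derivable_cst.
by rewrite big_cons; exact: (derivableM (h i) IH).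
Qed.

Lemma is_derive_mulC f g a v df dg :
  is_derive a v f df -> is_derive a v g dg ->
  is_derive a v (fun y => f y * g y) (df * g a + f a * dg).
Proof.
move=> hf hg.
apply: (@is_derive_eq _ _ _ (f * g) _ _ _ (f a *: dg + g a *: df)).
by rewrite addrC /GRing.scale /= (mulrC (g a)).
Qed.

Lemma is_mderiveM m n p (A : V -> 'M[C]_(m, n)) (B : V -> 'M[C]_(n, p))
    a v dA dB :
  is_mderive A a v dA -> is_mderive B a v dB ->
  is_mderive (fun y => A y *m B y) a v (dA *m B a + A a *m dB).
Proof.
move=> hA hB i j.
rewrite (_ : (fun _ => _) = fun y => \sum_k A y i k * B y k j); last first.
  by apply/funext => y; rewrite mxE.
rewrite !mxE -big_split /=; apply: is_derive_fsum => k.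
exact: is_derive_mulC.
Qed.

Lemma is_mderive_eq m n (A : V -> 'M[C]_(m, n)) a v dA dA' :
  is_mderive A a v dA -> dA = dA' -> is_mderive A a v dA'.
Proof. by move=> + <-. Qed.

Lemma is_mderive_unique m n (A : V -> 'M[C]_(m, n)) a v dA dA' :
  is_mderive A a v dA -> is_mderive A a v dA' -> dA = dA'.
Proof.
move=> h h'; apply/matrixP => i j.
by have [_ <-] := h i j; have [_ <-] := h' i j.
Qed.

Lemma derivable_det n (A : V -> 'M[C]_n) a v :
  (forall i j, derivable (fun y => A y i j : C) a v) ->
  derivable (fun y => \det (A y) : C) a v.
Proof.
move=> hA; rewrite /determinant.
suff : is_derive a v (fun y => \sum_(s : 'S_n) (-1) ^+ s * \prod_i A y i (s i))
  (\sum_(s : 'S_n)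
     'D_v (fun y => (-1) ^+ s * \prod_i A y i (s i) : C) a) by case.
apply: is_derive_fsum => s; apply: derivableP.
apply: (@derivableM _ _ (cst ((-1) ^+ s))); first exact: derivable_cst.
exact: is_derive_prodC.
Qed.

(** Cramer's formula gives derivability; the value then follows by differentiating
    [A y *m invmx (A y) = 1%:M]. Invertibility is asked near [a] because [invmx] returns a singular
    matrix unchanged. *)
Lemma is_mderive_inv n (A : V -> 'M[C]_n.+1) a v dA :
  (\forall y \near a, A y \in unitmx) -> is_mderive A a v dA ->
  is_mderive (fun y => invmx (A y)) a v (- (invmx (A a) *m dA *m invmx (A a))).
Proof.
move=> uA hA; have uAa := nbhs_singleton uA.
have dAij i j : derivable (fun y => A y i j : C) a v by case: (hA i j).
have dinv i j : derivable (fun y => invmx (A y) i j : C) a v.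
  pose B := (fun y => (\det (A y))^-1) * (fun y => cofactor (A y) j i : C).
  apply: (@near_eq_derivable _ _ _ B).
    by apply: filterS uA => y uAy; rewrite /B /invmx uAy !mxE.
  apply: derivableM.
    apply: derivableV; last exact: derivable_det.
    by rewrite -unitfE -unitmxE.
  rewrite /cofactor; apply: (@derivableM _ _ (cst ((-1) ^+ (j + i)))).
    exact: derivable_cst.
  apply: derivable_det => i' j'.
  rewrite (_ : (fun _ => _) = fun y => A y (lift j i') (lift i j')) //.
  by apply/funext => y; rewrite !mxE.
pose dI := \matrix_(i, j) 'D_v (fun y => invmx (A y) i j : C) a.
have hI : is_mderive (fun y => invmx (A y)) a v dI.
  by move=> i j; rewrite mxE; apply: derivableP.
apply: (is_mderive_eq (dA := dI)) => //.
have h1 : is_mderive (fun y => A y *m invmx (A y)) a v 0.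
  move=> i j; apply: near_eq_is_derive (is_mderive_cst 1%:M a v i j).
  by apply: filterS uA => y uAy; rewrite mulmxV.
have /eqP := is_mderive_unique (is_mderiveM hA hI) h1.
rewrite addrC addr_eq0 => /eqP /(congr1 (mulmx (invmx (A a)))).
by rewrite mulKmx// mulmxN mulmxA.
Qed.

End directional_derivatives.

(** * Mean value and Gronwall estimates along real segments *)

Section mean_value.
Context {R : realType} {V : normedModType (Cx R)}.
Local Notation C := (Cx R).
Implicit Types (f : V -> C) (u v : V).

(** The passage from complex to real calculus: on the real axis the real part of a holomorphic
    function is accessible to the real mean value theorem. *)
Lemma is_derive_ReC (f : C -> C) (t : R) l : is_derive (toC t) 1 f l ->
  is_derive t 1 (fun s : R => ReC (f (toC s))) (ReC l).
Proof.
move=> [df dl].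
have fc : (fun h : R => h^-1 *: (((fun s : R => ReC (f (toC s))) \o shift t)
     (h *: 1) - ReC (f (toC t)))) @ 0^' --> ReC l.
  apply/cvgrPdist_lt => e e0.
  have := df; rewrite -/(derivable _ _ _) => dfc.
  have /cvgrPdist_lt /(_ (toC e)) : (fun h : C => h^-1 *: ((f \o shift (toC t))
      (h *: 1) - f (toC t))) @ 0^' --> l by rewrite -dl.
  rewrite ltr_toC => /(_ e0) [d /= d0 dP].
  have d0' : 0 < ReC d by rewrite -ltr_toC -ge0_toC// ltW.
  exists (ReC d) => // h /= hd0 h0.
  have hd : `|h| < ReC d by rewrite -normrN -sub0r.
  have hb : ball_ Num.norm (0 : C) d (toC h).
    change (`|0 - toC h : C| < d).
    by rewrite sub0r normrN normCE cabs_toC (ge0_toC (ltW d0)) ltr_toC.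
  have h0' : toC h != 0 :> C by rewrite toC_eq0.
  have := dP (toC h) hb h0'.
  rewrite normCE ltr_toC; apply: le_lt_trans.
  apply: le_trans (normr_ReC _); rewrite ReCB.
  rewrite (_ : ReC ((toC h)^-1 *: _) = h^-1 *: (((fun s : R => ReC (f (toC s)))
    \o shift t) (h *: 1) - ReC (f (toC t)))) //.
  rewrite [LHS]/= /GRing.scale /= -toCV ReCM /= mul0r subr0 ReCB.
  by rewrite !mulr1 toCD.
by split; [apply/cvg_ex; eexists; exact: fc | apply: cvg_lim fc].
Qed.

Lemma is_derive_ReC_line f u v (t : R) l : is_derive (u + toC t *: v) v f l ->
  is_derive t 1 (fun s : R => ReC (f (u + toC s *: v))) (ReC l).
Proof. by move/is_derive_line/is_derive_ReC. Qed.

Lemma is_derive_ImC_line f u v (t : R) l : is_derive (u + toC t *: v) v f l ->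
  is_derive t 1 (fun s : R => ImC (f (u + toC s *: v))) (ImC l).
Proof.
move=> df; have ImE z : ImC z = ReC (- 'i * z :> C).
  by rewrite ReCM ReCN ImCN ReCi ImCi; ring.
rewrite ImE (_ : (fun _ => _)
  = fun s : R => ReC ((fun y => - 'i * f y) (u + toC s *: v))); last first.
  by apply/funext => s; rewrite ImE.
exact: is_derive_ReC_line.
Qed.

Lemma mean_value_bound f u v (df : R -> C) (M : R) :
  (forall t, 0 <= t <= 1 -> is_derive (u + toC t *: v) v f (df t)) ->
  (forall t, 0 <= t <= 1 -> cabs (df t) <= M) ->
  cabs (f (u + v) - f u) <= M.
Proof.
move=> hf hM; set w := f (u + v) - f u.
have [w0|w0] := eqVneq w 0.
  by rewrite w0 cabs0; apply: le_trans (hM 0 _); rewrite ?lexx ?ler01 ?cabs_ge0.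
(* The phase that turns the increment [w] into its modulus: the real part of [c * f] then carries
   the whole increment. *)
pose c := toC (cabs w) / w.
have c1 : cabs c = 1.
  by rewrite cabsM cabsV cabs_toC ger0_norm ?cabs_ge0// divff// cabs_eq0.
pose phi (s : R) := ReC ((fun y => c * f y) (u + toC s *: v)).
have hphi (t : R) : 0 <= t <= 1 -> is_derive t 1 phi (ReC (c * df t)).
  by move=> t01; have := hf t t01 => ?; exact: is_derive_ReC_line.
have [| |s s01] := @MVT_segment _ phi (fun t => ReC (c * df t)) 0 1 ler01.
- by move=> t; rewrite in_itv /= => /andP[t0 t1]; apply: hphi; rewrite !ltW.
- apply: derivable_within_continuous => t; rewrite in_itv /= => t01.
  by case: (hphi t t01).
rewrite /phi /= toC0 toC1 scale0r scale1r addr0 -ReCB -mulrBr -/w /c.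
rewrite divfK// subr0 mulr1 /= => ->.
rewrite in_itv /= in s01; apply: le_trans (hM s s01).
rewrite -[leRHS]mul1r -c1 -cabsM.
exact: le_trans (ler_norm _) (normr_ReC _).
Qed.

(** The squared Frobenius norm; unlike a sum of moduli it is differentiable along a path, as
    Gronwall's argument requires. *)
Definition energy m n (A : 'M[C]_(m, n)) : R := \sum_i \sum_j cabs (A i j) ^+ 2.

Lemma cabs_energy m n (A : 'M[C]_(m, n)) i j : cabs (A i j) ^+ 2 <= energy A.
Proof.
rewrite /energy (bigD1 i)//= (bigD1 j)//= -addrA lerDl addr_ge0//.
  by apply: sumr_ge0 => ? _; rewrite sqr_ge0.
by do 2 apply: sumr_ge0 => ? _; rewrite sqr_ge0.
Qed.

(** Along the segment the energy satisfies [q' <= c * q]. The constant [c = 2 m a] arises from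
    [2 x y <= x^2 + y^2], applied to each of the [m] summands of an entry of [A P]: the two squares
    sum to [m * a * q] each. *)
Lemma gronwall m n (P : V -> 'M[C]_(m, n)) u v (A : R -> 'M[C]_m) (a : R) :
  0 <= a ->
  (forall t, 0 <= t <= 1 ->
    is_mderive P (u + toC t *: v) v (A t *m P (u + toC t *: v))) ->
  (forall t, 0 <= t <= 1 -> forall i j, cabs (A t i j) <= a) ->
  energy (P (u + v)) <= expR (m%:R * a *+ 2) * energy (P u).
Proof.
move=> a0 hP hA; set c := m%:R * a *+ 2.
pose p (t : R) := P (u + toC t *: v).
pose re i j t := ReC (p t i j); pose im i j t := ImC (p t i j).
pose dp t := A t *m p t.
pose q t := energy (p t).
pose dq t := \sum_i \sum_j (ReC (dp t i j) * re i j t + ImC (dp t i j) * im i j t) *+ 2.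
have hq (t : R) : 0 <= t <= 1 -> is_derive t 1 q (dq t).
  move=> t01.
  rewrite (_ : q = fun t =>
      \sum_i \sum_j (re i j * re i j + im i j * im i j) t); last first.
    apply/funext => s; rewrite /q /energy; apply: eq_bigr => i _.
    by apply: eq_bigr => j _; rewrite cabs_sqr !expr2.
  refine (is_derive_fsum _) => i; refine (is_derive_fsum _) => j.
  have h1 : is_derive t 1 (re i j) (ReC (dp t i j)).
    exact: (is_derive_ReC_line (hP t t01 i j)).
  have h2 : is_derive t 1 (im i j) (ImC (dp t i j)).
    exact: (is_derive_ImC_line (hP t t01 i j)).
  refine (is_derive_eq (is_deriveD (is_deriveM h1 h1) (is_deriveM h2 h2)) _).
  by rewrite /GRing.scale /=; ring.
have dq_le (t : R) : 0 <= t <= 1 -> dq t <= c * q t.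
  move=> t01; rewrite /dq /q /energy.
  have e1 i j : (ReC (dp t i j) * re i j t + ImC (dp t i j) * im i j t) *+ 2
      <= \sum_k a * (cabs (p t i j) ^+ 2 + cabs (p t k j) ^+ 2).
    apply: (@le_trans _ _ (cabs (dp t i j) * cabs (p t i j) *+ 2)).
      rewrite lerMn2r /=; set x := dp t i j; rewrite /re /im; set y := p t i j.
      (* The real part of [x] times the conjugate of [y], hence at most [cabs x * cabs y]. *)
      have -> : ReC x * ReC y + ImC x * ImC y = ReC (x * toC (ReC y) - x * 'i * toC (ImC y)).
        by rewrite ReCB !ReCM ImCM ReCi ImCi /=; ring.
      rewrite -mulrA -mulrBr.
      apply: le_trans (ler_norm _) _; apply: le_trans (normr_ReC _) _.
      rewrite cabsM ler_wpM2l ?cabs_ge0// /cabs ler_wsqrtr//.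
      by rewrite ReCB ImCD ImCN !ReCM !ImCM ReCi ImCi /= lerD // !mul0r !mul1r
        ?subr0 ?mulr0 ?sub0r ?addr0 ?add0r ?sqrrN.
    apply: (@le_trans _ _ (\sum_k (a * cabs (p t k j)) * cabs (p t i j) *+ 2)).
      rewrite sumrMnl -mulr_suml lerMn2r /= ler_wpM2r ?cabs_ge0//.
      rewrite /dp mxE; apply: le_trans (cabs_sum _ _ _) _.
      by apply: ler_sum => k _; rewrite cabsM ler_wpM2r ?cabs_ge0// hA.
    apply: ler_sum => k _; rewrite -mulrA -mulrnAr ler_wpM2l//.
    set x := cabs _; set y := cabs _; rewrite -subr_ge0.
    by rewrite (_ : _ - _ = (x - y) ^+ 2) ?sqr_ge0//; ring.
  apply: (@le_trans _ _ (\sum_i \sum_j \sum_k a * (cabs (p t i j) ^+ 2 + cabs (p t k j) ^+ 2))).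
    by do 2 apply: ler_sum => ? _; exact: e1.
  have e2 : \sum_i \sum_j \sum_(k < m) a * (cabs (p t i j) ^+ 2) = m%:R * a * q t.
    rewrite /q /energy mulr_sumr; apply: eq_bigr => i _.
    rewrite mulr_sumr; apply: eq_bigr => j _.
    by rewrite sumr_const card_ord -[LHS]mulr_natl mulrA.
  have e3 : \sum_(i < m) \sum_j \sum_k a * (cabs (p t k j) ^+ 2) = m%:R * a * q t.
    rewrite sumr_const card_ord -[LHS]mulr_natl -mulrA; congr (_ * _).
    rewrite exchange_big /= mulr_sumr; apply: eq_bigr => k _.
    by rewrite mulr_sumr.
  under eq_bigr do under eq_bigr do under eq_bigr do rewrite mulrDr.
  under eq_bigr do under eq_bigr do rewrite big_split /=.
  under eq_bigr do rewrite big_split /=.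
  rewrite big_split /= e2 e3 -/(energy (p t)) -/(q t) /c.
  by rewrite -mulrDl mulr2n.
(* Integrating factor: the derivative of [psi] is non-positive by [dq_le]. *)
pose psi := (fun t => expR (- c * t)) * q.
have hpsi (t : R) : 0 <= t <= 1 ->
    is_derive t 1 psi (expR (- c * t) * (dq t - c * q t)).
  move=> t01; have hqt := hq t t01.
  have he : is_derive t 1 (fun t : R => expR (- c * t)) (expR (- c * t) * - c).
    have := @is_derive1_comp _ expR ( *%R (- c)) t (expR (- c * t)) (- c).
    move=> /(_ _ _); apply.
    have -> : *%R (- c) = (- c) \*: (id : R -> R) by [].
    by apply: is_derive_eq; rewrite /GRing.scale /= mulr1.
  by apply: is_derive_eq; rewrite /GRing.scale /=; ring.
pose dpsi t := expR (- c * t) * (dq t - c * q t).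
have dpsiP (t : R) : t \in `]0, 1[ -> is_derive t 1 psi (dpsi t).
  by rewrite in_itv /= => /andP[t0 t1]; apply: hpsi; rewrite !ltW.
have cpsi : {within `[0, 1], continuous psi}.
  apply: derivable_within_continuous => t; rewrite in_itv /= => t01.
  by case: (hpsi t t01).
have [s s01] := @MVT_segment R psi dpsi 0 1 ler01 dpsiP cpsi.
rewrite in_itv /= in s01.
rewrite subr0 mulr1 => e.
have : psi 1 <= psi 0.
  by rewrite -subr_le0 e pmulr_rle0 ?expR_gt0// subr_le0 dq_le.
have psi0 : psi 0 = energy (P u).
  rewrite [LHS](_ : _ = expR (- c * 0) * q 0)// mulr0 expR0 mul1r /q /p toC0.
  by rewrite scale0r addr0.
have psi1 : psi 1 = (expR c)^-1 * energy (P (u + v)).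
  rewrite [LHS](_ : _ = expR (- c * 1) * q 1)// mulr1 expRN /q /p toC1.
  by rewrite scale1r.
by rewrite psi0 psi1 ler_pdivrMl ?expR_gt0//.
Qed.

End mean_value.

(** * Locally constant functions *)

Section constancy.
Context {R : realType}.
Local Notation C := (Cx R).

(** Pulled back along a path, the indicator [g] of [f (c t) <> f a] is a continuous real function
    with values 0 and 1; the intermediate value theorem at 1/2 excludes a jump. *)
Lemma locally_constant_path_connected n (D : set 'rV[C]_n) (T : Type)
    (f : 'rV[C]_n -> T) :
  path_connected_set D ->
  (forall u, D u -> \forall u' \near u, f u' = f u) ->
  forall a b, D a -> D b -> f a = f b.
Proof.
move=> pD lf a b Da Db; have [c [cc cD ca cb]] := pD a b Da Db.
pose g (t : R) : R := if `[< f (c t) = f a >] then 0 else 1.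
apply: contrapT => fab.
have g0 : g 0 = 0 by rewrite /g ca; case: asboolP.
have g1 : g 1 = 1 by rewrite /g cb; case: asboolP => // e; case: fab.
have cg : {within `[0, 1], continuous g}.
  move=> t; apply: (@near_cst_continuous _ _ (g t)).
  have [t01|nt01] := pselect (`[0, 1]%classic t); last first.
    (* In the subspace topology a point outside the subspace is isolated, so continuity there is
       automatic. *)
    have out (A : set R) : ~ A t -> @nbhs_subspace R A t [set y | g y = g t].
      by move=> nAt; rewrite /nbhs_subspace memNset// => y ->.
    exact: out nt01.
  have Dt : D (c t) by apply: cD; exists t.
  have := cc t _ (lf _ Dt).
  apply: (@filterS _ (nbhs (t : subspace `[0, 1]%classic))) => y /= e.
  suff : g y = g t by [].
  by rewrite /g; have -> : f (c y) = f (c t) by exact: e.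
have [|t t01 gt] := @IVT R g 0 1 2%:R^-1 ler01 cg.
  by rewrite g0 g1 minEle maxEle ler01 invr_ge0 ler0n invf_le1 ?ltr0n// ler1n.
have := gt; rewrite /g; case: asboolP => _ /eqP.
  by rewrite eq_sym invr_eq0 pnatr_eq0.
by rewrite eq_sym invr_eq1 pnatr_eq1.
Qed.

Section zero_derivative.
Context {V : normedModType C}.

Lemma near_segment (N : set V) (u : V) : nbhs u N ->
  \forall u' \near u, forall t : R, 0 <= t <= 1 -> N (u + toC t *: (u' - u)).
Proof.
move=> /nbhs_ballP[e /= e0 eN].
apply/nbhs_ballP; exists e => //= u'; rewrite -ball_normE /= => he t /andP[t0 t1].
apply: eN; rewrite -ball_normE /= opprD addNKr normrN normrZ.
apply: le_lt_trans he; rewrite distrC.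
rewrite -[leRHS]mul1r ler_wpM2r// normCE cabs_toC ger0_norm// -toC1.
by rewrite ler_toC.
Qed.

Lemma is_mderive0_locally_constant m n (D : set V) (F : V -> 'M[C]_(m, n)) :
  open D -> (forall u v, D u -> is_mderive F u v 0) ->
  forall u, D u -> \forall u' \near u, F u' = F u.
Proof.
move=> oD dF u Du; apply: filterS (near_segment (open_nbhs_nbhs (conj oD Du))) => u' hu'.
apply/matrixP => i j; apply/eqP; rewrite -subr_eq0 -cabs_eq0.
apply/eqP/le_anti; rewrite cabs_ge0 andbT.
have -> : F u' i j - F u i j = (fun y => F y i j) (u + (u' - u)) - F u i j.
  by rewrite (addrC u) subrK.
refine (@mean_value_bound _ _ (fun y => F y i j) u (u' - u) (fun=> 0) 0 _ _) => t t01;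
  last by rewrite /= cabs0.
by have := dF _ (u' - u) (hu' t t01) i j; rewrite mxE.
Qed.

End zero_derivative.

Lemma is_mderive0_constant k m n (D : set 'rV[C]_k)
    (F : 'rV[C]_k -> 'M[C]_(m, n)) :
  open D -> path_connected_set D ->
  (forall u v, D u -> is_mderive F u v 0) ->
  forall u u', D u -> D u' -> F u = F u'.
Proof.
move=> oD pD dF; apply: locally_constant_path_connected => //.
exact: is_mderive0_locally_constant.
Qed.

Lemma is_derive_dir (f : C -> C) (x v l : C) :
  is_derive x 1 f l -> is_derive x v f (v * l).
Proof.
move=> [df <-]; have hd : differentiable f x by apply/derivable1_diffP.
split; first exact: diff_derivable.
rewrite !deriveE//; rewrite -[in LHS](mulr1 v).
exact: linearZ.
Qed.

Lemma is_mderive0_constantC m n (F : C -> 'M[C]_(m, n)) :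
  (forall x : C, is_mderive F x 1 0) -> forall x y, F x = F y.
Proof.
move=> dF x y; apply/matrixP => i j; apply/eqP; rewrite -subr_eq0 -cabs_eq0.
apply/eqP/le_anti; rewrite cabs_ge0 andbT.
have -> : F x i j - F y i j = (fun y => F y i j) (y + (x - y)) - F y i j.
  by rewrite (addrC y) subrK.
refine (@mean_value_bound _ _ (fun y => F y i j) y (x - y) (fun=> 0) 0 _ _) => t t01;
  last by rewrite /= cabs0.
by have /is_derive_dir := dF (y + toC t *: (x - y)) i j; rewrite mxE => /(_ (x - y)); rewrite mulr0.
Qed.

End constancy.

(** * The matrix exponential *)

Section complex_series.
Context {R : realType}.
Local Notation C := (Cx R).
Implicit Types (c : nat -> C) (a : R).

Lemma cvg_ReIm (u : nat -> C) (a b : R) :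
  (fun n => ReC (u n)) @ \oo --> a -> (fun n => ImC (u n)) @ \oo --> b ->
  u @ \oo --> toC a + 'i * toC b.
Proof.
move=> ha hb; apply/cvgrPdist_lt => e e0.
have er : 0 < ReC e / 2%:R by rewrite divr_gt0// -ltr_toC -ge0_toC// ltW.
move/cvgrPdist_lt : ha => /(_ _ er) ha; move/cvgrPdist_lt : hb => /(_ _ er) hb.
near=> n; rewrite normCE (ge0_toC (ltW e0)) ltr_toC.
apply: le_lt_trans (cabs_ReIm _) _; rewrite ReCB ImCD ImCN.
have -> : ReC (toC a + 'i * toC b) = a by rewrite ReCD ReCM ReCi /=; ring.
have -> : ImC (toC a + 'i * toC b) = b by rewrite ImCD ImCM ImCi /=; ring.
by rewrite [ltRHS]splitr ltrD//; near: n.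
Unshelve. all: by end_near. Qed.

Lemma cabs_lim_le (u : nat -> C) (l : C) (m : R) :
  u @ \oo --> l -> (forall n, cabs (u n) <= m) -> cabs l <= m.
Proof.
move=> /cvgrPdist_lt ul um; apply/ler_addgt0Pr => e e0.
have := ul (toC e); rewrite ltr_toC => /(_ e0) [N _ /(_ N (leqnn N))] /=.
rewrite normCE ltr_toC => h; rewrite -(subrK (u N) l).
by apply: le_trans (cabsD _ _) _; rewrite addrC lerD// ltW.
Qed.

Definition sums_to c (l : C) := (fun N => \sum_(k < N) c k) @ \oo --> l.

Lemma sums_to_unique c l l' : sums_to c l -> sums_to c l' -> l = l'.
Proof. by move=> h h'; exact: (cvg_unique _ h h'). Qed.

Lemma exp_partial_sum_le a N : 0 <= a -> \sum_(k < N) exp_coeff a k <= expR a.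
Proof.
move=> a0; have := @nondecreasing_cvgn_le _ (series (exp_coeff a)) _
  (is_cvg_series_exp_coeff a) N; rewrite /series /= big_mkord; apply.
apply/nondecreasing_seqP => n; rewrite /series /= big_nat_recr//= lerDl.
exact: exp_coeff_ge0.
Qed.

Lemma exp_dominated_sums c a : 0 <= a ->
  (forall k, cabs (c k) <= exp_coeff a k) -> {l | sums_to c l}.
Proof.
move=> a0 hc; apply: cid.
have real (r : nat -> R) : (forall k, `|r k| <= cabs (c k)) ->
    cvgn (series r).
  move=> hr; apply: normed_cvg.
  apply: (@series_le_cvg _ (fun k => `|r k|) (exp_coeff a)) => [k|k|k|].
  - exact: normr_ge0.
  - exact: exp_coeff_ge0.
  - exact: le_trans (hr k) (hc k).
  - exact: is_cvg_series_exp_coeff.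
have hre := real (fun k => ReC (c k)) (fun k => normr_ReC _).
have him := real (fun k => ImC (c k)) (fun k => normr_ImC _).
have reE : (fun N => ReC (\sum_(k < N) c k)) = series (fun k => ReC (c k)).
  by apply/funext => N; rewrite /series /= big_mkord ReC_sum.
have imE : (fun N => ImC (\sum_(k < N) c k)) = series (fun k => ImC (c k)).
  apply/funext => N; rewrite /series /= big_mkord.
  by rewrite (big_morph _ (@ImCD R) (erefl _)).
by eexists; apply: cvg_ReIm; [rewrite reE; exact: hre | rewrite imE; exact: him].
Qed.

Definition binomial_remainder (x h : C) k :=
  (x + h) ^+ k - x ^+ k - h * (k%:R * x ^+ k.-1).

Lemma binomial_remainderS x h k : binomial_remainder x h k.+1
  = (x + h) * binomial_remainder x h k + h ^+ 2 * (k%:R * x ^+ k.-1).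
Proof.
rewrite /binomial_remainder /= -(natr1 k) !exprS.
by case: k => [|k]; rewrite /= ?expr0 ?exprS; ring.
Qed.

(** Majorant argument: the recursion [binomial_remainderS] has positive coefficients, so for
    [cabs h <= 1] the second-order Taylor remainder of the [k]-th power is at most [cabs h ^+ 2]
    times the remainder at the real data [(cabs x, 1)], which is at most [(cabs x + 1) ^+ k]. *)
Lemma cabs_binomial_remainder x h k : cabs h <= 1 ->
  cabs (binomial_remainder x h k) <= cabs h ^+ 2 * (cabs x + 1) ^+ k.
Proof.
move=> h1; pose y := toC (cabs x) : C.
have rr n : exists2 r : R, binomial_remainder y 1 n = toC r &
    cabs (binomial_remainder x h n) <= cabs h ^+ 2 * r.
  elim: n => [|n [r er hr]].
    exists 0; rewrite /binomial_remainder /= ?expr0 ?mul0r ?mulr0 ?subrr ?subr0//.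
    by rewrite cabs0.
  exists ((cabs x + 1) * r + n%:R * cabs x ^+ n.-1).
    rewrite binomial_remainderS er /y toCD !toCM toCD toC_nat toCX toC1.
    by rewrite expr1n mul1r.
  rewrite binomial_remainderS; apply: le_trans (cabsD _ _) _.
  rewrite [leRHS]mulrDr lerD//.
    rewrite cabsM mulrCA ler_pM ?cabs_ge0//.
    by apply: le_trans (cabsD _ _) _; rewrite lerD2l.
  by rewrite !cabsM !cabsX -toC_nat cabs_toC ger0_norm.
have [r er hr] := rr k; apply: le_trans hr _; rewrite ler_wpM2l ?sqr_ge0//.
rewrite -ler_toC -er /binomial_remainder /y -toC1 -toCD -toC_nat -!toCX.
rewrite -!toCM -!toCB ler_toC mul1r -addrA gerDl -opprD oppr_le0.
by rewrite addr_ge0// ?mulr_ge0// ?exprn_ge0// cabs_ge0.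
Qed.

Lemma is_derive_power_series c a (f g : C -> C) : 0 <= a ->
  (forall k, cabs (c k) <= exp_coeff a k) ->
  (forall x, sums_to (fun k => c k * x ^+ k) (f x)) ->
  (forall x, sums_to (fun k => c k * (k%:R * x ^+ k.-1)) (g x)) ->
  forall x : C, is_derive x 1 f (g x).
Proof.
move=> a0 hc hf hg x.
(* Bounds the sum of [exp_coeff a k * (cabs x + 1) ^+ k], hence is the constant in the quadratic
   estimate [est]. *)
pose K := expR (a * (cabs x + 1)).
have K0 : 0 < K by exact: expR_gt0.
have x1 : 0 <= cabs x + 1 by rewrite addr_ge0// cabs_ge0.
have est h : cabs h <= 1 -> cabs (f (x + h) - f x - h * g x) <= cabs h ^+ 2 * K.
  move=> h1.
  have hs : (fun N => \sum_(k < N) c k * (x + h) ^+ k - \sum_(k < N) c k * x ^+ k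
      - h * \sum_(k < N) c k * (k%:R * x ^+ k.-1)) @ \oo
      --> f (x + h) - f x - h * g x.
    apply: cvgB; first by apply: cvgB; [exact: hf | exact: hf].
    by apply: cvgM; [exact: cvg_cst | exact: hg].
  apply: (cabs_lim_le hs) => N.
  rewrite mulr_sumr -!sumrB; apply: le_trans (cabs_sum _ _ _) _.
  have le1 : \sum_(k < N) exp_coeff (a * (cabs x + 1)) k <= K.
    by apply: exp_partial_sum_le; rewrite mulr_ge0.
  apply: le_trans (ler_wpM2l (sqr_ge0 (cabs h)) le1).
  rewrite mulr_sumr; apply: ler_sum => k _.
  rewrite (_ : _ - _ = c k * binomial_remainder x h k); last first.
    by rewrite /binomial_remainder; ring.
  rewrite cabsM /exp_coeff /= exprMn.
  rewrite (_ : cabs h ^+ 2 * _ = a ^+ k / k`!%:R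
      * (cabs h ^+ 2 * (cabs x + 1) ^+ k)); last by ring.
  by rewrite ler_pM ?cabs_ge0 ?cabs_binomial_remainder //; exact: (hc k).
have dq : (h^-1 *: ((f \o shift x) (h *: 1) - f x)) @[h --> 0^'] --> g x.
  apply/cvgrPdist_le => e e0.
  have er : 0 < ReC e by rewrite -ltr_toC -ge0_toC// ltW.
  pose d := Num.min 1 (ReC e / K).
  have d0 : 0 < d by rewrite lt_min ltr01 divr_gt0.
  exists (toC d) => /=; first by rewrite (ltr_toC 0).
  move=> h hd h0.
  have {}hd : cabs h < d.
    by rewrite -ltr_toC -normCE -normrN -sub0r.
  move: hd; rewrite lt_min => /andP[h1 hK].
  rewrite (ge0_toC (ltW e0)) normCE ler_toC /shift /= {2}/GRing.scale /= mulr1.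
  rewrite /GRing.scale /= (addrC h).
  have -> : g x - h^-1 * (f (x + h) - f x) =
     - (h^-1 * (f (x + h) - f x - h * g x)) by field.
  rewrite cabsN cabsM cabsV.
  have ch0 : 0 < cabs h by rewrite lt_neqAle cabs_ge0 andbT eq_sym cabs_eq0.
  rewrite ler_pdivrMl//; apply: le_trans (est h (ltW h1)) _.
  by rewrite expr2 -mulrA ler_pM2l// -ler_pdivlMr// ltW.
by split; [apply/cvg_ex; eexists; exact: dq | apply: cvg_lim dq].
Qed.

End complex_series.

Section matrix_exponential.
Context {R : realType}.
Local Notation C := (Cx R).

Lemma mx_norm_le m n (M : 'M[C]_(m, n)) (e : C) : 0 <= e ->
  (forall i j, `|M i j| <= e) -> `|M| <= e.
Proof.
move=> /nonnegP[{}e] he; rewrite [leLHS]/Num.Def.normr /= mx_normE num_le.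
apply/bigmax_leP; split=> [|ij _]; first by rewrite -num_le /=.
by rewrite -num_le /=; exact: he.
Qed.

Lemma mx_cvg m n (u : nat -> 'M[C]_(m, n)) (l : 'M[C]_(m, n)) :
  (forall i j, (fun N => u N i j : C) @ \oo --> l i j) -> u @ \oo --> l.
Proof.
move=> h; apply/cvgrPdist_le => e e0; near=> N.
apply: mx_norm_le => [|i j]; first exact: ltW.
rewrite !mxE; move: i j; near: N.
apply: filter_forall => i; apply: filter_forall => j.
exact: (cvgrPdist_le _ _).1 (h i j) e e0.
Unshelve. all: by end_near. Qed.

Lemma cabs_exprmx n (A : 'M[C]_n.+1) k i j :
  cabs ((A ^+ k) i j) <= (\sum_i \sum_j cabs (A i j)) ^+ k.
Proof.
elim: k i j => [|k IH] i j.
  by rewrite !expr0 mxE; case: eqP => _; rewrite ?cabs1 ?cabs0 ?ler01.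
rewrite !exprS mxE; apply: le_trans (cabs_sum _ _ _) _.
have a0 : 0 <= \sum_i \sum_j cabs (A i j).
  by do 2 apply: sumr_ge0 => ? _; exact: cabs_ge0.
apply: (@le_trans _ _ (\sum_l cabs (A i l) * (\sum_i \sum_j cabs (A i j)) ^+ k)).
  by apply: ler_sum => l _; rewrite cabsM ler_wpM2l ?cabs_ge0.
rewrite -mulr_suml ler_wpM2r ?exprn_ge0//.
rewrite [leRHS](bigD1 i)//= lerDl.
by do 2 apply: sumr_ge0 => ? _; exact: cabs_ge0.
Qed.

(** [mexp] is a [lim], meaningful only once convergence is known. The entries of [A ^+ k] are
    bounded by the [k]-th power of the sum of the moduli of [A], so a scalar exponential series
    dominates. *)
Lemma mexp_sums n (A : 'M[C]_n.+1) i j :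
  sums_to (fun k => (k`!%:R : C)^-1 * (A ^+ k) i j) (mexp A i j).
Proof.
pose a := \sum_i \sum_j cabs (A i j).
have a0 : 0 <= a by do 2 apply: sumr_ge0 => ? _; exact: cabs_ge0.
have dom p q k : cabs ((k`!%:R : C)^-1 * (A ^+ k) p q) <= exp_coeff a k.
  rewrite cabsM cabsV -toC_nat cabs_toC ger0_norm// /exp_coeff /= mulrC.
  by rewrite ler_wpM2r ?invr_ge0//; exact: cabs_exprmx.
pose l p q := exp_dominated_sums a0 (dom p q).
suff -> : mexp A = \matrix_(p, q) sval (l p q) by rewrite mxE; exact: svalP.
apply: cvg_lim; first exact: norm_hausdorff.
apply: mx_cvg => p q; rewrite mxE.
suff -> : (fun N => series (fun k => (k`!%:R : C)^-1 *: A ^+ k) N p q)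
  = fun N => \sum_(k < N) (k`!%:R : C)^-1 * (A ^+ k) p q
  by exact: (svalP (l p q)).
apply/funext => N; rewrite /series /= big_mkord summxE.
by apply: eq_bigr => k _; rewrite mxE.
Qed.

Arguments mexp_sums [n] A i j.

Lemma mpow_sums n (A : 'M[C]_n.+1) (x : C) i j :
  sums_to (fun k => (k`!%:R : C)^-1 * (A ^+ k) i j * x ^+ k) (mpow x A i j).
Proof.
have := @mexp_sums _ (x *: A) i j; congr (sums_to _ _); apply/funext => k.
by rewrite exprZn mxE mulrCA mulrC.
Qed.

Arguments mpow_sums [n] A x i j.

Lemma cvg_fsum (I : finType) (F : I -> nat -> C) (l : I -> C) :
  (forall i, F i @ \oo --> l i) ->
  (fun N => \sum_i F i N) @ \oo --> \sum_i l i.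
Proof.
move=> h; elim: (index_enum I) => [|i r IH].
  rewrite big_nil (_ : (fun _ => _) = fun=> 0); first exact: cvg_cst.
  by apply/funext => N; rewrite big_nil.
rewrite big_cons (_ : (fun _ => _) = fun N => F i N + \sum_(j <- r) F j N).
  by apply: cvgD; [exact: h | exact: IH].
by apply/funext => N; rewrite big_cons.
Qed.

Lemma mpow0 n (A : 'M[C]_n.+1) : mpow 0 A = 1%:M.
Proof.
apply/matrixP => i j; refine (sums_to_unique (mpow_sums A 0 i j) _).
apply/cvgrPdist_lt => e e0; exists 1%N => // -[//|N] _ /=.
rewrite big_ord_recl /= big1 => [|k _]; last by rewrite expr0n mulr0.
by rewrite addr0 !expr0 fact0 invr1 mulr1 mul1r subrr normr0.
Qed.

Lemma is_mderive_mpow n (A : 'M[C]_n.+1) (x : C) :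
  is_mderive (fun y : C => mpow y A) x 1 (A *m mpow x A).
Proof.
move=> i j; pose c k := (k`!%:R : C)^-1 * (A ^+ k) i j.
pose a := \sum_i \sum_j cabs (A i j).
have a0 : 0 <= a by do 2 apply: sumr_ge0 => ? _; exact: cabs_ge0.
have dom k : cabs (c k) <= exp_coeff a k.
  rewrite cabsM cabsV -toC_nat cabs_toC ger0_norm// /exp_coeff /= mulrC.
  by rewrite ler_wpM2r ?invr_ge0//; exact: cabs_exprmx.
apply: (is_derive_power_series (g := fun x => (A *m mpow x A) i j) a0 dom).
  by move=> y; exact: mpow_sums.
(* The differentiated series has no term at [k = 0]; shifting its index by one gives [A] times the
   series of [mpow y A]. *)
move=> y; rewrite /sums_to -cvg_shiftS mxE.
rewrite (_ : (fun _ => _) = fun N => \sum_l A i l *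
    \sum_(k < N) ((k`!%:R : C)^-1 * (A ^+ k) l j * y ^+ k)); last first.
  apply/funext => N /=; rewrite big_ord_recl /= mul0r mulr0 add0r.
  under [RHS]eq_bigr do rewrite mulr_sumr.
  rewrite exchange_big /=; apply: eq_bigr => k _.
  rewrite /c exprS mxE mulr_sumr mulr_suml; apply: eq_bigr => l _.
  rewrite /bump /= add1n factS natrM.
  have h1 : k.+1%:R != 0 :> C by rewrite pnatr_eq0.
  have h2 : k`!%:R != 0 :> C by rewrite pnatr_eq0 -lt0n fact_gt0.
  by move: (k.+1%:R) (k`!%:R) h1 h2 => p q h1 h2; field; rewrite h1 h2.
apply: cvg_fsum => l; apply: cvgM; first exact: cvg_cst.
exact: mpow_sums.
Qed.

Lemma is_mderive_line m n (A : C -> 'M[C]_(m, n)) (x y : C) (l : C) dA :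
  is_mderive A (x + l * y) 1 dA ->
  is_mderive (fun t : C => A (x + t * y)) l 1 (y *: dA).
Proof.
move=> hA i j; rewrite mxE.
have := is_derive_dir y (hA i j) => h.
exact: (@is_derive_line R C (fun t => A t i j) x y l _ h).
Qed.

(** From the differential equation instead of a Cauchy product: [mpow (- z) A *m mpow (z + w) A] has
    derivative zero in [z], because [A] commutes with its exponential. *)
Lemma mpowD n (A : 'M[C]_n.+1) x y : mpow (x + y) A = mpow x A *m mpow y A.
Proof.
have hN (z : C) :
    is_mderive (fun t : C => mpow (- t) A) z 1 (- (A *m mpow (- z) A)).
  have E : (fun t : C => mpow (- t) A) = fun t => mpow (0 + t * -1) A.
    by apply/funext => t; rewrite add0r mulrN1.
  rewrite E -[- (A *m _)]scaleN1r (_ : - z = 0 + z * -1); last by rewrite add0r mulrN1.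
  refine (@is_mderive_line _ _ (fun t : C => mpow t A) 0 (-1) z _ _).
  exact: is_mderive_mpow.
have hT (z w : C) :
    is_mderive (fun t : C => mpow (t + w) A) z 1 (A *m mpow (z + w) A).
  have E : (fun t : C => mpow (t + w) A) = fun t => mpow (w + t * 1) A.
    by apply/funext => t; rewrite mulr1 addrC.
  rewrite E -[A *m _]scale1r (_ : z + w = w + z * 1); last by rewrite mulr1 addrC.
  refine (@is_mderive_line _ _ (fun t : C => mpow t A) w 1 z _ _).
  exact: is_mderive_mpow.
have cm (z : C) : A *m mpow z A = mpow z A *m A.
  apply/matrixP => i j.
  pose c i j k := (k`!%:R : C)^-1 * (A ^+ k) i j * z ^+ k.
  refine (@sums_to_unique _ (fun k => \sum_l A i l * c l j k) _ _ _ _).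
    rewrite /sums_to mxE (_ : (fun N => _) = fun N =>
      \sum_l A i l * \sum_(k < N) c l j k); last first.
      apply/funext => N; rewrite exchange_big /=.
      by apply: eq_bigr => l _; rewrite mulr_sumr.
    apply: cvg_fsum => l; apply: cvgM; first exact: cvg_cst.
    exact: mpow_sums.
  rewrite /sums_to mxE (_ : (fun N => _) = fun N =>
      \sum_l (\sum_(k < N) c i l k) * A l j); last first.
    apply/funext => N.
    under [RHS]eq_bigr do rewrite mulr_suml.
    rewrite [RHS]exchange_big /=; apply: eq_bigr => k _.
    transitivity ((k`!%:R : C)^-1 * (A *m A ^+ k) i j * z ^+ k).
      rewrite mxE mulr_sumr mulr_suml.
      by apply: eq_bigr => l _; rewrite /c; ring.
    rewrite -[A *m _]exprS exprSr [(_ * A)%R]/(A ^+ k *m A) mxE mulr_sumr mulr_suml.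
    by apply: eq_bigr => l _; rewrite /c; ring.
  apply: cvg_fsum => l; apply: cvgM; last exact: cvg_cst.
  exact: mpow_sums.
have cst w (z : C) : mpow (- z) A *m mpow (z + w) A = mpow w A.
  rewrite -[RHS]mul1mx -(mpow0 A) -{1}oppr0 -{2}(add0r w).
  apply: (@is_mderive0_constantC _ _ _ (fun z : C => mpow (- z) A *m mpow (z + w) A)).
  move=> t; apply: is_mderive_eq (is_mderiveM (hN t) (hT t w)) _.
  move: (mpow (- t) A) (mpow (t + w) A) (cm (- t)) => P Q e.
  by rewrite e mulNmx (mulmxA P) addNr.
by rewrite -(cst (x + y) (- x)) opprK addKr.
Qed.

(** [cexp] is defined through [expR], [cos] and [sin], so its power series has to be identified: [f]
    is the 1 x 1 exponential, and [mpowD] splits it into the series of [expR] and those of [cos] and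
    [sin]. *)
Lemma mexp_diag n (d : 'rV[C]_n.+1) :
  mexp (diag_mx d) = diag_mx (\row_j cexp (d 0 j)).
Proof.
pose f (z : C) := mpow z (1%:M : 'M[C]_1) 0 0.
have fs z : sums_to (fun k => (k`!%:R : C)^-1 * z ^+ k) (f z).
  have := mpow_sums (1%:M : 'M[C]_1) z 0 0; congr (sums_to _ _).
  by apply/funext => k; rewrite (expr1n 'M[C]_1 k) mxE mulr1.
have fD z w : f (z + w) = f z * f w.
  by rewrite /f mpowD mxE big_ord_recl big_ord0 addr0.
have fcexp z : f z = cexp z.
  rewrite {1}(CxE z) fD; set a := ReC z; set b := ImC z.
  have -> : f (toC a) = toC (expR a).
    refine (sums_to_unique (fs _) _).
    rewrite /sums_to (_ : toC (expR a) = toC (expR a) + 'i * toC 0); last first.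
      by rewrite toC0 mulr0 addr0.
    apply: cvg_ReIm.
      rewrite (_ : (fun _ => _) = series (exp_coeff a)).
        exact: is_cvg_series_exp_coeff.
      apply/funext => N; rewrite ReC_sum seriesEord.
      apply: eq_bigr => k _; rewrite -toC_nat -toCV -toCX -toCM.
      by rewrite [LHS]/= mulrC.
    rewrite (_ : (fun _ => _) = fun=> 0); first exact: cvg_cst.
    apply/funext => N; rewrite (big_morph _ (@ImCD R) (erefl _)) big1// => k _.
    by rewrite -toC_nat -toCV -toCX -toCM.
  have -> : f ('i * toC b) = toC (cos b) + 'i * toC (sin b).
    refine (sums_to_unique (fs _) _).
    have iX k : ('i : C) ^+ k = (if odd k then 'i else 1) * toC ((-1) ^+ k./2).
      rewrite -{1}(odd_double_half k) exprD -muln2 mulnC exprM sqrCi.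
      rewrite toCX toCN toC1; congr (_ * _); case: (odd k) => //.
    have term k : (k`!%:R : C)^-1 * ('i * toC b) ^+ k
       = toC (cos_coeff b k) + 'i * toC (sin_coeff b k).
      rewrite exprMn iX -toC_nat -toCV -toCX /cos_coeff /sin_coeff /=.
      have [ok|ok] := boolP (odd k).
        rewrite /= !mul0r toC0 add0r mul1r.
        have -> : k.-1./2 = k./2 by case: k ok => //= k; rewrite uphalf_half => /negbTE ->.
        by rewrite !toCM; ring.
      by rewrite /= !mul0r toC0 mulr0 addr0 !toCM toC1; ring.
    apply: cvg_ReIm.
      rewrite (_ : (fun _ => _) = series (cos_coeff b)).
        by rewrite unlock; exact: is_cvg_series_cos_coeff.
      apply/funext => N; rewrite ReC_sum seriesEord.
      by apply: eq_bigr => k _; rewrite term ReCD ReCM ReCi ImCi /=; ring.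
    rewrite (_ : (fun _ => _) = series (sin_coeff b)).
      by rewrite unlock; exact: is_cvg_series_sin_coeff.
    apply/funext => N; rewrite seriesEord (big_morph _ (@ImCD R) (erefl _)).
    by apply: eq_bigr => k _; rewrite term ImCD ImCM ReCi ImCi /=; ring.
  by apply: CxP; rewrite ?(ReCM, ImCM, ReCD, ImCD) ?ReCi ?ImCi /=; ring.
have diagX k : diag_mx d ^+ k = diag_mx (\row_j d 0 j ^+ k).
  elim: k => [|k IH].
    by apply/matrixP => i j; rewrite expr0 !mxE; case: eqP => //=; rewrite expr0.
  rewrite exprS IH; apply/matrixP => i j.
  rewrite -mulmxE mul_diag_mx !mxE.
  by case: eqP => [->|_]; rewrite ?mulr1n ?exprS ?mulr0n ?mulr0.
apply/matrixP => i j; refine (sums_to_unique (mexp_sums _ i j) _).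
rewrite !mxE; case: eqP => [->|ne]; rewrite ?mulr1n ?mulr0n.
  rewrite -fcexp; have := fs (d 0 j); congr (sums_to _ _).
  by apply/funext => k; rewrite diagX !mxE eqxx mulr1n.
rewrite /sums_to (_ : (fun _ => _) = fun=> 0); first exact: cvg_cst.
apply/funext => N; rewrite big1// => k _; rewrite diagX !mxE.
by case: eqP ne => // _ _; rewrite mulr0n mulr0.
Qed.

Lemma mexp_scale_diag n (z : C) (d : 'rV[C]_n.+1) :
  mexp (z *: diag_mx d) = diag_mx (\row_j cexp (z * d 0 j)).
Proof.
rewrite -linearZ mexp_diag; congr diag_mx; apply/rowP => j.
by rewrite !mxE.
Qed.

End matrix_exponential.

(** * Flat families with a prescribed asymptotic behaviour *)

Section entry_sum_norm.
Context {R : realType}.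
Local Notation C := (Cx R).

(** A real-valued norm that is submultiplicative ([mabsM]), which the maximum norm on matrices is
    not. *)
Definition mabs m n (A : 'M[C]_(m, n)) : R := \sum_i \sum_j cabs (A i j).

Lemma mabs_ge0 m n (A : 'M[C]_(m, n)) : 0 <= mabs A.
Proof. by do 2 apply: sumr_ge0 => ? _; exact: cabs_ge0. Qed.

Lemma cabs_mabs m n (A : 'M[C]_(m, n)) i j : cabs (A i j) <= mabs A.
Proof.
rewrite /mabs (bigD1 i)//= (bigD1 j)//= -addrA lerDl addr_ge0//.
  by apply: sumr_ge0 => ? _; rewrite cabs_ge0.
by do 2 apply: sumr_ge0 => ? _; rewrite cabs_ge0.
Qed.

Lemma mabs_le m n (A : 'M[C]_(m, n)) (c : R) :
  (forall i j, cabs (A i j) <= c) -> mabs A <= m%:R * n%:R * c.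
Proof.
move=> h; apply: (@le_trans _ _ (\sum_(i < m) \sum_(j < n) c)).
  by do 2 apply: ler_sum => ? _; exact: h.
by rewrite !sumr_const !card_ord -mulrnA -[leLHS]mulr_natl natrM [n%:R * _]mulrC.
Qed.

Lemma mabsD m n (A B : 'M[C]_(m, n)) : mabs (A + B) <= mabs A + mabs B.
Proof.
rewrite /mabs -big_split /=; apply: ler_sum => i _.
by rewrite -big_split /=; apply: ler_sum => j _; rewrite mxE cabsD.
Qed.

Lemma mabsN m n (A : 'M[C]_(m, n)) : mabs (- A) = mabs A.
Proof. by do 2 apply: eq_bigr => ? _; rewrite mxE cabsN. Qed.

Lemma mabsB m n (A B : 'M[C]_(m, n)) : mabs (A - B) <= mabs A + mabs B.
Proof. by rewrite -(mabsN B) mabsD. Qed.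

Lemma mabsZ m n (c : C) (A : 'M[C]_(m, n)) : mabs (c *: A) = cabs c * mabs A.
Proof.
rewrite /mabs mulr_sumr; apply: eq_bigr => i _.
by rewrite mulr_sumr; apply: eq_bigr => j _; rewrite mxE cabsM.
Qed.

Lemma mabsM m n p (A : 'M[C]_(m, n)) (B : 'M[C]_(n, p)) :
  mabs (A *m B) <= mabs A * mabs B.
Proof.
rewrite /mabs mulr_suml; apply: ler_sum => i _.
apply: (@le_trans _ _ (\sum_j \sum_k cabs (A i k) * cabs (B k j))).
  apply: ler_sum => j _; rewrite mxE; apply: le_trans (cabs_sum _ _ _) _.
  by apply: ler_sum => k _; rewrite cabsM.
rewrite exchange_big /= mulr_suml; apply: ler_sum => k _.
rewrite -mulr_sumr ler_wpM2l ?cabs_ge0// [leRHS](bigD1 k)//= lerDl.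
by do 2 apply: sumr_ge0 => ? _; exact: cabs_ge0.
Qed.

Lemma mabs_diag n (d : 'rV[C]_n) : mabs (diag_mx d) = \sum_j cabs (d 0 j).
Proof.
apply: eq_bigr => i _; rewrite (bigD1 i)//= big1 ?addr0 => [|j ji].
  by rewrite mxE eqxx mulr1n.
by rewrite mxE eq_sym (negPf ji) mulr0n cabs0.
Qed.

Lemma mabs1 n : mabs (1%:M : 'M[C]_n) = n%:R.
Proof.
rewrite -diag_const_mx mabs_diag (eq_bigr (fun=> 1)) => [|j _].
  by rewrite sumr_const card_ord.
by rewrite mxE cabs1.
Qed.

Lemma near_mabs_lin (V : normedModType C) m n (u : V) (e : R)
    (L : V -> 'M[C]_(m, n)) (c : R) :
  (forall v i j, `|L v i j| <= toC c * `|v|) -> 0 < e ->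
  \forall u' \near u, mabs (L (u' - u)) <= e.
Proof.
move=> hL e0; pose M : R := m%:R * n%:R * `|c| + 1.
have M0 : 0 < M by rewrite ltr_wpDl// !mulr_ge0.
apply/nbhs_ballP; exists (toC (e / M)) => /=.
  by rewrite (ltr_toC 0) divr_gt0.
move=> u'; rewrite -ball_normE /= distrC => hu.
set v := u' - u in hu *.
have vE : `|v| = toC (ReC `|v|) by exact/ge0_toC/normr_ge0.
have hv0 : 0 <= ReC `|v| by rewrite -ler_toC -vE toC0.
have hv : ReC `|v| < e / M by rewrite -ltr_toC -vE.
apply: (@le_trans _ _ (m%:R * n%:R * (`|c| * ReC `|v|))).
  apply: mabs_le => i j; rewrite -ler_toC -normCE.
  apply: le_trans (hL v i j) _; rewrite toCM -vE ler_wpM2r//.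
  by rewrite ler_toC ler_norm.
rewrite mulrA; apply: (@le_trans _ _ (M * ReC `|v|)).
  by rewrite ler_wpM2r// lerDl.
by rewrite mulrC -ler_pdivlMr// ltW.
Qed.

End entry_sum_norm.

Section real_bounds.
Context {R : realType}.

Lemma exp_decay_le0 (t K g r0 : R) : 0 < g ->
  (forall r, r0 <= r -> t <= K * expR (- (g * r))) -> t <= 0.
Proof.
move=> g0 h; rewrite leNgt; apply/negP => t0.
(* At such an [r] one has [K <= t * (g * r) < t * expR (g * r)], against the assumed bound. *)
pose r := Num.max (Num.max r0 0) (`|K| / (t * g)).
have r1 : r0 <= r by rewrite !le_max lexx.
have rr : 0 <= r by rewrite !le_max lexx orbT.
have r2 : `|K| / (t * g) <= r by rewrite le_max lexx orbT.
have := h r r1; apply/negP; rewrite -ltNge expRN ltr_pdivrMr ?expR_gt0//.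
apply: (@le_lt_trans _ _ (t * (g * r))).
  apply: le_trans (ler_norm K) _; rewrite mulrA -ler_pdivrMl ?mulr_gt0//.
  by rewrite mulrC.
rewrite ltr_pM2l//; apply: lt_le_trans (expR_ge1Dx _).
by rewrite ltrDr.
Qed.

(** With [y] proportional to [|z|] this converts decay that is exponential in [|z|] into decay like
    [|z|^-2]. *)
Lemma expR_sqr_le (y : R) : 0 <= y -> y ^+ 2 <= 4%:R * expR y.
Proof.
move=> y0; have h : y / 2%:R <= expR (y / 2%:R).
  by apply: le_trans (expR_ge1Dx _); rewrite lerDr.
have -> : expR y = expR (y / 2%:R) ^+ 2 by rewrite -expRM_natl mulrC divfK.
have -> : y ^+ 2 = 4%:R * (y / 2%:R) ^+ 2 by field.
by rewrite ler_wpM2l// lerXn2r// nnegrE ?expR_ge0 ?divr_ge0.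
Qed.

End real_bounds.

Section exponential_derivatives.
Context {R : realType}.
Local Notation C := (Cx R).

Lemma is_derive_of_line (V : normedModType C) (f : V -> C) (u v : V) l :
  is_derive (0 : C) 1 (fun h : C => f (u + h *: v)) l -> is_derive u v f l.
Proof.
move=> [df dl].
have E : (fun k : C => k^-1 *: ((f \o shift u) (k *: v) - f u))
  = (fun k : C => k^-1 *: (((fun h' : C => f (u + h' *: v)) \o shift 0) (k *: 1)
                                - f (u + 0 *: v))).
  apply/funext => k /=; congr (_ *: (f _ - f _)).
    by rewrite [k *: 1]mulr1 addr0 addrC.
  by rewrite scale0r addr0.
by split; [rewrite /derivable E | rewrite /derive E].
Qed.

Lemma is_derive_cexp (x : C) : is_derive x 1 (cexp : C -> C) (cexp x).
Proof.
have E : (cexp : C -> C) = fun y : C => mpow y (1%:M : 'M[C]_1) 0 0.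
  apply/funext => y; rewrite /mpow -diag_const_mx mexp_scale_diag !mxE eqxx.
  by rewrite mulr1 mulr1n.
rewrite E; have := is_mderive_mpow (1%:M : 'M[C]_1) x 0 0.
by rewrite mul1mx.
Qed.

Lemma is_derive_cexp_coord q (z : C) (u v : 'rV[C]_q) j :
  is_derive u v (fun y => cexp (z * y 0 j)) (z * v 0 j * cexp (z * u 0 j)).
Proof.
apply: is_derive_of_line.
rewrite (_ : (fun _ => _) = fun h : C => cexp (z * u 0 j + h * (z * v 0 j))).
  have h1 := is_derive_cexp (z * u 0 j + 0 * (z * v 0 j)).
  have := @is_derive_line R C cexp (z * u 0 j) (z * v 0 j) 0 _
    (is_derive_dir (z * v 0 j) h1).
  by rewrite mul0r addr0.
by apply/funext => h; rewrite !mxE; congr cexp; ring.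
Qed.

End exponential_derivatives.

(** Absorption: in [M = Y1 M - (Y1 - 1) M] the last term is at most half of [mabs M]. So [M] is
    controlled by [P] and [Y0] with no estimate on the inverse of [Y1]. *)
Lemma near_identity_quotient_bound (R : realType) n (Y1 M P Y0 : 'M[Cx R]_n)
    (kappa : R) :
  Y1 *m M = P *m Y0 -> mabs (Y1 - 1%:M) <= 2%:R^-1 ->
  mabs (Y0 - 1%:M) <= 2%:R^-1 -> mabs P <= kappa ->
  mabs M <= 2%:R * (kappa * (n%:R + 2%:R^-1)).
Proof.
move=> YM h1 h0 hP.
have e1 : mabs M <= mabs (P *m Y0) + mabs (Y1 - 1%:M) * mabs M.
  rewrite {1}(_ : M = Y1 *m M - (Y1 - 1%:M) *m M); last first.
    by rewrite mulmxBl mul1mx opprB addrC subrK.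
  rewrite -YM; apply: (le_trans (mabsB _ _)); rewrite lerD2l.
  exact: mabsM.
have e2 : mabs (P *m Y0) <= kappa * (n%:R + 2%:R^-1).
  apply: (le_trans (mabsM _ _)); apply: ler_pM; [exact: mabs_ge0| exact: mabs_ge0| exact: hP|].
  rewrite -[Y0](subrK 1%:M) addrC.
  by apply: (le_trans (mabsD _ _)); rewrite mabs1 lerD2l.
have e3 := ler_wpM2r (mabs_ge0 M) h1.
clear -e1 e2 e3.
move: (mabs M) (mabs (P *m Y0)) (mabs (Y1 - _) * _) (kappa * _) e1 e2 e3.
by move=> a b c d; lra.
Qed.

(** Read with [Z G e^(zU) z^(-B)] as the normalized solution at each of two points: [Z1 Z0^-1]
    transports one to the other, and the same quotient is the conjugate of [G1^-1 G0] by
    exponentials and powers of [z]. *)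
Lemma quotient_identity (K : fieldType) n
    (Z1 Z0 G1 G0 D1 D1' D0 p p' : 'M[K]_n) :
  Z0 \in unitmx -> G1 \in unitmx -> D1 *m D1' = 1%:M -> p' *m p = 1%:M ->
  Z1 *m G1 *m D1 *m p' *m (p *m D1' *m (invmx G1 *m G0) *m D0 *m p')
  = Z1 *m invmx Z0 *m (Z0 *m G0 *m D0 *m p').
Proof.
move=> uZ uG DK pK; rewrite !mulmxA (mulmxKV uZ) -(mulmxA _ p') pK mulmx1.
by rewrite -(mulmxA _ D1) DK mulmx1 (mulmxK uG).
Qed.

(** The terms [[E, A]] and [- z [E, Y]] cancel to leading order because [A] is the coefficient of
    [z^-1] in [Y]. The right-hand side shows that what remains is of order [1/z]. *)
Lemma commutator_expansion (K : fieldType) n (E A Y : 'M[K]_n) (z : K) :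
  z != 0 ->
  (E *m A - A *m E - z *: E) *m Y + z *: (Y *m E)
  = (E *m A - A *m E) *m (Y - 1%:M)
    - z *: (E *m (Y - 1%:M - z^-1 *: A) - (Y - 1%:M - z^-1 *: A) *m E).
Proof.
move=> z0.
rewrite !(mulmxBl, mulmxBr) !mulmx1 !mul1mx -!scalemxAl -!scalemxAr.
rewrite !scalerBr !scalerA divff// !scale1r.
apply/matrixP => i j; rewrite !mxE.
set a := (\sum_j _); set b := (\sum_j _); move: a b => *; ring.
Qed.

Lemma mabs_commutator_le (R : realType) n (E A Y : 'M[Cx R]_n) (z : Cx R)
    (c s y e : R) : mabs A <= c -> mabs E <= s -> mabs (Y - 1%:M) <= y ->
  mabs (Y - 1%:M - z^-1 *: A) <= e ->
  mabs ((E *m A - A *m E) *m (Y - 1%:M)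
    - z *: (E *m (Y - 1%:M - z^-1 *: A) - (Y - 1%:M - z^-1 *: A) *m E))
  <= (s * c) *+ 2 * y + cabs z * ((s * e) *+ 2).
Proof.
move=> hA hE hY he.
have comm (P Q : 'M[Cx R]_n) p q : mabs P <= p -> mabs Q <= q ->
    mabs (P *m Q - Q *m P) <= (p * q) *+ 2.
  move=> hp hq; apply: (le_trans (mabsB _ _)); rewrite mulr2n lerD//.
    by apply: (le_trans (mabsM _ _)); apply: ler_pM; rewrite ?mabs_ge0.
  by apply: (le_trans (mabsM _ _)); rewrite mulrC; apply: ler_pM; rewrite ?mabs_ge0.
apply: (le_trans (mabsB _ _)); apply: lerD.
  apply: (le_trans (mabsM _ _)); apply: ler_pM; rewrite ?mabs_ge0//.
  exact: comm.
rewrite mabsZ; apply: ler_wpM2l; first exact: cabs_ge0.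
exact: comm.
Qed.

Lemma product_rule_identity (K : fieldType) n (A Z G0 D E Y Q : 'M[K]_n) (z : K) :
  Z *m G0 *m D = Y *m Q -> D *m E = E *m D -> Q *m E = E *m Q ->
  (A *m Z *m G0 + Z *m 0) *m D + Z *m G0 *m (z *: (E *m D))
  = (A *m Y + z *: (Y *m E)) *m Q.
Proof.
move=> hX hD hQ; rewrite mulmx0 addr0 -hD -scalemxAr (mulmxA _ D) hX.
by rewrite -!(mulmxA A) hX mulmxDl -scalemxAl -!mulmxA hQ.
Qed.

Lemma mulmx_commute (K : fieldType) n (A B E : 'M[K]_n) :
  A *m E = E *m A -> B *m E = E *m B -> A *m B *m E = E *m (A *m B).
Proof. by move=> hA hB; rewrite -mulmxA hB !mulmxA hA. Qed.

Lemma difference_identity (K : fieldType) n (Y1 Y0 p w : 'M[K]_n) :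
  p *m (w - 1%:M) = Y1 *m (p *m w) - Y0 *m p
    - (Y1 - 1%:M) *m (p *m w) + (Y0 - 1%:M) *m p.
Proof.
rewrite mulmxBr mulmx1 !mulmxBl !mul1mx.
set a := Y1 *m _; set e := Y0 *m p; set d := p *m w; move: a e d => a e d; apply/matrixP => i j.
rewrite !mxE; ring.
Qed.

(** * Constancy of a connection matrix, in abstract form *)

Section flat_asymptotics.
Context {R : realType} {n q : nat}.
Local Notation C := (Cx R).
Local Notation V := 'rV[C]_q.
Local Notation mat := 'M[C]_n.+1.
Variables (beta : 'I_n.+1 -> 'I_q) (b : 'I_n.+1 -> R) (b0 : R).

Definition block_scalar (v : V) : mat := diag_mx (\row_a v 0 (beta a)).
Definition block_exp (z : C) (u : V) : mat :=
  diag_mx (\row_a cexp (z * u 0 (beta a))).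
Definition diag_power (x : C) : mat := diag_mx (\row_a cexp (x * toC (b a))).
Local Notation Ed := block_scalar.
Local Notation powb := diag_power.

(* The point over z of argument t with |z| = exp r. *)
Definition ray (t r : R) : C := toC r + 'i * toC t.

Lemma ReC_ray t r : ReC (ray t r) = r.
Proof. by rewrite ReCD ReCM ReCi /=; ring. Qed.

Lemma cabs_cexp_ray t r : cabs (cexp (ray t r)) = expR r.
Proof. by rewrite cabs_cexp ReC_ray. Qed.

Lemma cexp_ray t r : cexp (ray t r) = toC (expR r) * cexp ('i * toC t).
Proof. by rewrite cexpD cexp_toC. Qed.

Lemma powbK x : powb (- x) *m powb x = 1%:M.
Proof.
apply/matrixP => i j; rewrite mul_diag_mx !mxE; case: eqP => [->|_].
  by rewrite !mulr1n -cexpD mulNr addNr cexp0.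
by rewrite !mulr0n mulr0.
Qed.

Lemma block_expK z u : block_exp z u *m block_exp (- z) u = 1%:M.
Proof.
apply/matrixP => i j; rewrite mul_diag_mx !mxE; case: eqP => [->|_].
  by rewrite !mulr1n -cexpD mulNr addrN cexp0.
by rewrite !mulr0n mulr0.
Qed.

Lemma mabs_powb t r : (forall a, `|b a| <= b0) -> 0 <= r ->
  mabs (powb (ray t r)) <= n.+1%:R * expR (b0 * r).
Proof.
move=> hb r0; rewrite mabs_diag.
apply: (@le_trans _ _ (\sum_(j < n.+1) expR (b0 * r))); last first.
  by rewrite sumr_const card_ord -[leLHS]mulr_natl.
apply: ler_sum => j _; rewrite mxE cabs_cexp ReCM ReC_ray mulr0 subr0 /=.
rewrite ler_expR mulrC ler_wpM2r//.
exact: le_trans (ler_norm _) (hb j).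
Qed.

Lemma is_mderive_block_exp z u v :
  is_mderive (block_exp z) u v (z *: (Ed v *m block_exp z u)).
Proof.
move=> i j; rewrite mxE mul_diag_mx !mxE.
have [<-|ne] := eqVneq i j.
  have E : (fun y => block_exp z y i i) = fun y : V => cexp (z * y 0 (beta i)).
    by apply/funext => y; rewrite !mxE eqxx mulr1n.
  by rewrite E mulr1n mulrA; exact: is_derive_cexp_coord.
have E : (fun y => block_exp z y i j) = fun=> 0.
  by apply/funext => y; rewrite !mxE (negPf ne) mulr0n.
by rewrite E mulr0n !mulr0; exact: is_derive_cst.
Qed.

Lemma near_mabs_Ed (u : V) (e : R) : 0 < e ->
  \forall u' \near u, mabs (Ed (u' - u)) <= e.
Proof.
apply: (@near_mabs_lin _ _ _ _ _ _ Ed 1) => v i j.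
rewrite toC1 mul1r !mxE; case: eqP => _; rewrite ?mulr1n ?mulr0n ?normr0//.
exact: mx_entry_norm.
Qed.

Lemma energy_le_mabs (m p : nat) (A : 'M[C]_(m, p)) : energy A <= mabs A ^+ 2.
Proof.
rewrite expr2 {1}/mabs mulr_suml; apply: ler_sum => i _.
rewrite mulr_suml; apply: ler_sum => j _; rewrite expr2.
by rewrite ler_wpM2l ?cabs_ge0// cabs_mabs.
Qed.

(** In the application [Z] is the gauged [Y_L], [G] is [C_nu], [A'] is the matrix [A] of the
    overview, [b] is the diagonal of [B], and [Ed v] is [dU] in the direction [v]. [Yh] is then
    [H_0^-1] times the normalized [Y_nu], hence close to 1; [r] is the logarithm of [|z|] and [Th]
    contains the arguments of the rays. One constant [c] serves for all bounds. *)
Variables (N : set V) (u0 : V) (Z : C -> V -> mat) (A' G : V -> mat).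
Variables (c r0 : R) (Th : set R).
Hypothesis hb : forall a, `|b a| <= b0.
Hypothesis hb0 : b0 *+ 2 < 1.
Hypothesis hN : nbhs u0 N.
Hypothesis uZ : forall x u, N u -> Z x u \in unitmx.
Hypothesis dZ : forall x u v, N u -> is_mderive (Z x) u v
  ((Ed v *m A' u - A' u *m Ed v - cexp x *: Ed v) *m Z x u).
Hypothesis hA : forall u, N u -> mabs (A' u) <= c.
Hypothesis uG : forall u, N u -> G u \in unitmx.
Local Notation W u := (invmx (G u) *m G u0).
Hypothesis hW : forall u, N u -> mabs (W u) <= c.
Local Notation Yh x u :=
  (Z x u *m G u *m block_exp (cexp x) u *m powb (- x)).
Hypothesis asym : forall t r u, Th t -> N u -> r0 <= r ->
  mabs (Yh (ray t r) u - 1%:M - (cexp (ray t r))^-1 *: A' u)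
    <= c * expR (- (r *+ 2)).
Hypothesis Th0 : Th !=set0.
Hypothesis hTh : forall a a', beta a != beta a' -> exists2 t, Th t &
  0 < ReC (cexp ('i * toC t) * (u0 0 (beta a') - u0 0 (beta a))).

Let Nu0 : N u0. Proof. exact: nbhs_singleton. Qed.
Let c0 : 0 <= c. Proof. exact: le_trans (mabs_ge0 _) (hA Nu0). Qed.
(** Beyond [r1] one has [4 c <= r <= expR r], which makes the bound [2 c / |z|] on [Yh - 1] at most
    1/2. *)
Let r1 := Num.max r0 (4%:R * c).

Let Yh_near1 t r u : Th t -> N u -> r1 <= r ->
  mabs (Yh (ray t r) u - 1%:M) <= c *+ 2 * expR (- r).
Proof.
rewrite ge_max => ht Nu /andP[rr0 rc].
have r_ge0 : 0 <= r by apply: le_trans rc; rewrite mulr_ge0.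
set Y := Yh _ u; set zi := (cexp (ray t r))^-1.
have -> : Y - 1%:M = (Y - 1%:M - zi *: A' u) + zi *: A' u by rewrite subrK.
apply: le_trans (mabsD _ _) _; rewrite mulrnAl mulr2n lerD//.
  apply: le_trans (asym ht Nu rr0) _; rewrite ler_wpM2l// ler_expR.
  by rewrite lerN2 mulr2n lerDl.
rewrite mabsZ /zi cabsV cabs_cexp_ray -expRN mulrC.
by rewrite ler_wpM2r ?expR_ge0// hA.
Qed.

Let Yh_half t r u : Th t -> N u -> r1 <= r ->
  mabs (Yh (ray t r) u - 1%:M) <= 2%:R^-1.
Proof.
move=> ht Nu hr; apply: le_trans (Yh_near1 ht Nu hr) _.
rewrite expRN ler_pdivrMr ?expR_gt0//.
have : 4%:R * c <= expR r.
  apply: le_trans (expR_ge1Dx r); apply: (@le_trans _ _ r); last by rewrite lerDr.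
  by move: hr; rewrite ge_max => /andP[].
by move=> h; lra.
Qed.

(** Gronwall on the segment from [u0] to [u1], where [[dU, A] - z dU] is at most
    [s * (c *+ 2 + expR r)]. Of the factor [n.+1 ^+ 3], one power is the square root of the energy
    bound at the identity and two come from summing over the entries. *)
Let transport_bound t r u1 (s := mabs (Ed (u1 - u0))) :
  (forall l : R, 0 <= l <= 1 -> N (u0 + toC l *: (u1 - u0))) ->
  mabs (Z (ray t r) u1 *m invmx (Z (ray t r) u0))
    <= n.+1%:R ^+ 3 * expR (n.+1%:R * (s * (c *+ 2 + expR r))).
Proof.
move=> seg; set x := ray t r; set a := s * _.
have s0 : 0 <= s by exact: mabs_ge0.
have a0 : 0 <= a by rewrite mulr_ge0// addr_ge0 ?expR_ge0// mulrn_wge0.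
pose P u := Z x u *m invmx (Z x u0).
pose v := u1 - u0; pose p (l : R) := u0 + toC l *: v.
pose Am l := Ed v *m A' (p l) - A' (p l) *m Ed v - cexp x *: Ed v.
have hP l : 0 <= l <= 1 -> is_mderive P (p l) v (Am l *m P (p l)).
  move=> hl; have := is_mderiveM (dZ x v (seg l hl)) (is_mderive_cst (invmx (Z x u0)) (p l) v).
  by rewrite mulmx0 addr0 -mulmxA.
have hAm l : 0 <= l <= 1 -> forall i j, cabs (Am l i j) <= a.
  move=> hl i j; apply: le_trans (cabs_mabs _ _ _) _.
  apply: le_trans (mabsB _ _) _; rewrite mabsZ cabs_cexp_ray /a mulrDr mulr2n.
  rewrite lerD//; last by rewrite mulrC.
  apply: le_trans (mabsB _ _) _; rewrite mulrDr lerD//.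
    by apply: le_trans (mabsM _ _) _; rewrite ler_wpM2l ?hA//; exact: seg.
  by apply: le_trans (mabsM _ _) _; rewrite mulrC ler_wpM2l ?hA//; exact: seg.
have := gronwall a0 hP hAm.
rewrite (_ : u0 + v = u1); last by rewrite /v addrC subrK.
have -> : P u0 = 1%:M by rewrite /P mulmxV ?uZ.
move=> hE.
have hPij i j : cabs (P u1 i j) <= n.+1%:R * expR (n.+1%:R * a).
  rewrite -(@ler_pXn2r _ 2)// ?nnegrE ?cabs_ge0 ?mulr_ge0 ?expR_ge0//.
  apply: le_trans (cabs_energy _ _ _) _; apply: le_trans hE _.
  have e2 (y : R) : expR y ^+ 2 = expR (y *+ 2) by rewrite -expRM_natl mulr_natl.
  rewrite exprMn mulrC e2 ler_wpM2r ?expR_ge0//.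
  by apply: le_trans (energy_le_mabs _) _; rewrite mabs1.
apply: le_trans (mabs_le hPij) _; rewrite !exprS expr0.
by rewrite le_eqVlt; apply/orP; left; apply/eqP; ring.
Qed.

(** The matrix [z^B e^(-z U(u1)) W e^(z U(u0)) z^(-B)] is bounded by the transport from [u0] to
    [u1], of size [e^(const * s * |z|)]. On the chosen ray its [(a, a')] entry carries the growing
    factor [e^(dlt * |z|)], which wins when [s] is small against [dlt]. *)
Let W_off_block a a' : beta a != beta a' ->
  \forall u1 \near u0, W u1 a a' = 0.
Proof.
move=> ne; have [t ht dlt0] := hTh ne; set dlt := ReC _ in dlt0.
(* Chosen so that [n.+2] copies of [s] fit into [dlt / 2]: [n.+1] of them from Gronwall's exponent,
   one from having [u1] and not [u0] in one of the exponentials. *)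
pose e := dlt / (2%:R * n.+3%:R).
have e0 : 0 < e by rewrite divr_gt0// mulr_gt0.
near=> u1.
have seg l : 0 <= l <= 1 -> N (u0 + toC l *: (u1 - u0)).
  by move: l; near: u1; exact: (near_segment hN).
have Nu1 : N u1.
  by have := seg 1; rewrite toC1 scale1r addrC subrK; apply; rewrite ler01 lexx.
pose s := mabs (Ed (u1 - u0)); have s0 : 0 <= s by exact: mabs_ge0.
have se : n.+2%:R * s <= dlt / 2%:R.
  apply: (@le_trans _ _ (n.+3%:R * e)).
    apply: ler_pM => //; first by rewrite ler_nat.
    by rewrite /s; near: u1; exact: near_mabs_Ed.
  have n3 : n.+3%:R != 0 :> R by rewrite pnatr_eq0.
  rewrite le_eqVlt; apply/orP; left; apply/eqP; rewrite /e.
  by move: (n.+3%:R) n3 => p p0; field.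
pose K1 : R := 2%:R * (n.+1%:R ^+ 3 * (n.+1%:R + 2%:R^-1)).
(* [expR (dlt * c)] absorbs the part of Gronwall's exponent that does not grow with [|z|];
   [16 / dlt ^+ 2] is [expR_sqr_le] at [dlt / 2 * |z|]. *)
pose K : R := K1 * expR (dlt * c) * (16%:R / dlt ^+ 2).
have K10 : 0 <= K1 by rewrite !mulr_ge0 ?addr_ge0.
suff bound r : r1 <= r -> cabs (W u1 a a') <= K * expR (- (1 * r)).
  apply/eqP; rewrite -cabs_eq0; apply/eqP/le_anti; rewrite cabs_ge0 andbT.
  exact: (exp_decay_le0 ltr01 bound).
move=> hr; have r_ge0 : 0 <= r.
  by apply: le_trans hr; rewrite le_max [X in _ || X]mulr_ge0// orbT.
set x := ray t r; set z := cexp x.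
pose M := powb x *m block_exp (- z) u1 *m W u1 *m block_exp z u0 *m powb (- x).
have Mle : mabs M <= K1 * expR (n.+1%:R * (s * (c *+ 2 + expR r))).
  have := near_identity_quotient_bound
    (quotient_identity (Z x u1) (G u0) (block_exp z u0) (uZ x Nu0) (uG Nu1)
       (block_expK z u1) (powbK x))
    (Yh_half ht Nu1 hr) (Yh_half ht Nu0 hr) (transport_bound t r seg).
  rewrite -/M => /le_trans; apply; rewrite /K1 le_eqVlt; apply/orP; left.
  by apply/eqP; rewrite -/s; move: (expR _) n.+1%:R => E1 N1; ring.
have ME : M a a' = cexp (x * toC (b a)) * cexp (- z * u1 0 (beta a)) * W u1 a a'
    * cexp (z * u0 0 (beta a')) * cexp (- x * toC (b a')).
  by rewrite /M mul_mx_diag mxE mul_mx_diag mxE -mulmxA mul_diag_mx mxE mul_diag_mx !mxE !mulrA.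
have := le_trans (cabs_mabs M a a') Mle.
rewrite ME !cabsM !cabs_cexp.
set p1 := ReC (x * _); set p2 := ReC (- z * _); set p3 := ReC (z * _).
set p4 := ReC (- x * _); set w := cabs (W u1 a a').
rewrite (_ : _ * _ * w * _ * _ = expR (p1 + p2 + p3 + p4) * w); last first.
  by rewrite !expRD; ring.
(* Conjugation by [z^B] costs at most one power of [|z|], since exponents differ by at most
   [2 b0 < 1]. *)
have hp14 : - r <= p1 + p4.
  rewrite /p1 /p4 !ReCM /x ReCN ReC_ray /= !mulr0 !subr0.
  rewrite -subr_ge0 (_ : _ - _ = r * (1 + (b a - b a'))); last by ring.
  apply: mulr_ge0 => //.
  have := hb a; have := hb a'; rewrite !ler_norml => /andP[_ h1] /andP[h2 _].
  by move: hb0 => hb0'; lra.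
have hp23 : expR r * (dlt - s) <= p2 + p3.
  rewrite /p2 /p3 -ReCD.
  have -> : - z * u1 0 (beta a) + z * u0 0 (beta a')
     = z * (u0 0 (beta a') - u0 0 (beta a)) - z * (u1 - u0) 0 (beta a).
    by rewrite !mxE; ring.
  rewrite ReCB mulrBr lerB//.
    by rewrite /z /x cexp_ray -mulrA [leRHS]ReCM /= mul0r subr0.
  apply: le_trans (ler_norm _) _; apply: le_trans (normr_ReC _) _.
  rewrite cabsM /z /x cabs_cexp_ray ler_wpM2l ?expR_ge0//.
  by have := cabs_mabs (Ed (u1 - u0)) a a; rewrite mxE eqxx mulr1n mxE.
have w0 : 0 <= w by exact: cabs_ge0.
set r' := expR r in hp23 *; have r'0 : 0 < r' by exact: expR_gt0.
move=> hw.
have {}hw : w <= K1 * expR (n.+1%:R * (s * (c *+ 2 + r')) - (p1 + p2 + p3 + p4)).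
  by rewrite expRB mulrA ler_pdivlMr ?expR_gt0// mulrC.
apply: le_trans hw _; rewrite /K mul1r -(mulrA K1) -(mulrA K1) -(mulrA (expR (dlt * c))) ler_wpM2l//.
(* The spare exponential is traded for [|z|^-2]: one power pays for [z^B], the other is the decay
   that is left. *)
have ey : expR (- (dlt / 2%:R * r')) <= 16%:R / dlt ^+ 2 * expR (- (r *+ 2)).
  have y0 : 0 < dlt / 2%:R * r' by rewrite mulr_gt0// divr_gt0.
  rewrite expRN (_ : expR (- (r *+ 2)) = (r' ^+ 2)^-1); last first.
    by rewrite expRN /r' -expRM_natl mulr_natl.
  have := expR_sqr_le (ltW y0); set E1 := expR _ => hE.
  have E10 : 0 < E1 by exact: expR_gt0.
  rewrite -(@ler_pM2r _ E1)// mulVf ?gt_eqF//.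
  rewrite -[leLHS](_ : 16%:R / dlt ^+ 2 / r' ^+ 2 *
     ((dlt / 2%:R * r') ^+ 2 / 4%:R) = 1).
    rewrite ler_wpM2l//.
      by rewrite divr_ge0// ?divr_ge0// ?sqr_ge0// ltW.
    by rewrite ler_pdivrMr// [E1 * _]mulrC.
  by field; rewrite !gt_eqF.
apply: (@le_trans _ _ (expR (dlt * c) * (expR r * expR (- (dlt / 2%:R * r'))))).
  rewrite -!expRD ler_expR.
  have h1 : n.+1%:R * s * c *+ 2 <= dlt * c.
    have : n.+1%:R * s <= dlt / 2%:R.
      by apply: le_trans se; rewrite ler_wpM2r// ler_nat.
    move=> /(ler_wpM2r c0); lra.
  have h2 : n.+2%:R * s * r' <= dlt / 2%:R * r' by rewrite ler_wpM2r// ltW.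
  have h3 : n.+2%:R = n.+1%:R + 1 :> R by rewrite -natr1.
  rewrite h3 in h2.
  set N1 := n.+1%:R in h1 h2 *.
  have -> : N1 * (s * (c *+ 2 + r')) = N1 * s * c *+ 2 + N1 * s * r' by ring.
  have h4 : (N1 + 1) * s * r' = N1 * s * r' + s * r' by ring.
  have h5 : r' * (dlt - s) = r' * dlt - s * r' by ring.
  have h6 : dlt / 2%:R * r' = (r' * dlt) / 2%:R by ring.
  rewrite h4 h6 in h2; rewrite h5 in hp23; rewrite h6; lra.
rewrite ler_wpM2l ?expR_ge0//.
apply: le_trans (ler_wpM2l (expR_ge0 r) ey) _.
rewrite mulrCA -expRD ler_wpM2l//; last first.
  by rewrite ler_expR; lra.
by rewrite divr_ge0// sqr_ge0.
Unshelve. all: by end_near. Qed.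

Lemma flat_asymptotics_constant : \forall u1 \near u0, G u1 = G u0.
Proof.
pose N1 := [set u | N u /\ forall a a', beta a != beta a' -> W u a a' = 0].
have hN1 : nbhs u0 N1.
  near=> u; split; first by near: u; exact: hN.
  move=> a a'; move: a'; move: a; near: u.
  apply: filter_forall => a; apply: filter_forall => a'.
  have [e|ne] := boolP (beta a == beta a'); first by apply: nearW => ? /negP.
  by apply: filterS (W_off_block ne) => u h _.
near=> u1.
have seg1 l : 0 <= l <= 1 -> N1 (u0 + toC l *: (u1 - u0)).
  by move: l; near: u1; exact: (near_segment hN1).
have [Nu1 _] : N1 u1.
  by have := seg1 1; rewrite toC1 scale1r addrC subrK; apply; rewrite ler01 lexx.
suff W1 : W u1 = 1%:M.
  by rewrite -[RHS](mulKVmx (uG Nu1)) W1 mulmx1.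
have [t ht] := Th0.
pose v := u1 - u0; pose s := mabs (Ed v).
have s0 : 0 <= s by exact: mabs_ge0.
(* The two summands are those of [mabs_commutator_le], with remainders of size [1/|z|] and
   [1/|z|^2]; the factor [|z|] in front of the second costs one of its powers. *)
pose K0 : R := (s * c) *+ 2 * (c *+ 2) + (s * c) *+ 2.
have K00 : 0 <= K0.
  by rewrite addr_ge0 ?mulrn_wge0 ?mulr_ge0 ?mulrn_wge0 ?mulr_ge0.
pose K1 : R := K0 * (n.+1%:R * c).
pose K : R := n.+1%:R * n.+1%:R * K1 + c *+ 2 * (n.+1%:R * c) + c *+ 2 * n.+1%:R.
(* One [b0] is the growth of [z^B] in the bound on [X], the other is lost when [z^B] is divided out
   of [z^B (W - 1)]. *)
pose g := 1 - b0 *+ 2; have g0 : 0 < g by rewrite subr_gt0.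
suff bound i j r : r1 <= r -> cabs ((W u1 - 1%:M) i j) <= K * expR (- (g * r)).
  apply/matrixP => i j; apply/eqP; rewrite -subr_eq0 -cabs_eq0.
  apply/eqP/le_anti; rewrite cabs_ge0 andbT.
  have E : (W u1 - 1%:M) i j = W u1 i j - (1%:M : mat) i j.
    by rewrite [LHS]mxE [X in _ + X]mxE.
  by rewrite -E; exact: exp_decay_le0 g0 (bound i j).
move=> hr; have r_ge0 : 0 <= r.
  by apply: le_trans hr; rewrite le_max [X in _ || X]mulr_ge0// orbT.
have r0r : r0 <= r by move: hr; rewrite ge_max => /andP[].
pose x := ray t r; pose z := cexp x.
have z0 : z != 0 by exact: cexp_neq0.
have zr : cabs z = expR r by exact: cabs_cexp_ray.
(* With [G u0] frozen, the equation of [Z] suffices to differentiate [X]. [XE] reads it as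
   [Yh z^B W], since a block-diagonal [W] passes through [e^(zU)]. *)
pose X u := Z x u *m G u0 *m block_exp z u.
have WE u y : N1 u -> W u *m block_exp y u = block_exp y u *m W u.
  move=> [_ hu]; apply/matrixP => a a'; rewrite mul_mx_diag mul_diag_mx !mxE.
  have [->|ne] := eqVneq (beta a) (beta a'); first by rewrite mulrC.
  by have := hu a a' ne; rewrite mxE => ->; rewrite mulr0 mul0r.
have WEd u y : N1 u -> W u *m Ed y = Ed y *m W u.
  move=> [_ hu]; apply/matrixP => a a'; rewrite mul_mx_diag mul_diag_mx !mxE.
  have [->|ne] := eqVneq (beta a) (beta a'); first by rewrite mulrC.
  by have := hu a a' ne; rewrite mxE => ->; rewrite mulr0 mul0r.
have XE u : N1 u -> X u = Yh x u *m (powb x *m W u).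
  move=> N1u; have [Nu _] := N1u; rewrite mulmxA -(mulmxA _ (powb (- x))) powbK.
  by rewrite mulmx1 -[RHS]mulmxA -WE// !mulmxA mulmxK ?uG.
have powbE y : powb x *m Ed y = Ed y *m powb x.
  by apply/matrixP => a a'; rewrite mul_mx_diag mul_diag_mx !mxE;
    case: eqP => [->|_]; rewrite ?mulr1n ?mulr0n ?mul0r ?mulr0// mulrC.
have expE y u : block_exp z u *m Ed y = Ed y *m block_exp z u.
  by apply/matrixP => a a'; rewrite mul_mx_diag mul_diag_mx !mxE;
    case: eqP => [->|_]; rewrite ?mulr1n ?mulr0n ?mul0r ?mulr0// mulrC.
pose L u := (Ed v *m A' u - A' u *m Ed v - z *: Ed v) *m Yh x u
            + z *: (Yh x u *m Ed v).
have dX u : N1 u -> is_mderive X u v (L u *m (powb x *m W u)).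
  move=> N1u; have [Nu _] := N1u.
  refine (is_mderive_eq (is_mderiveM
    (is_mderiveM (dZ x v Nu) (is_mderive_cst (G u0) u v))
    (is_mderive_block_exp z u v)) _).
  apply: product_rule_identity (XE u N1u) (expE v u) _.
  exact: mulmx_commute (powbE v) (WEd u v N1u).
have Lle u : N u -> mabs (L u) <= K0 * expR (- r).
  move=> Nu; rewrite /L commutator_expansion//.
  apply: (le_trans (mabs_commutator_le (hA Nu) (lexx s)
    (Yh_near1 ht Nu hr) (asym ht Nu r0r))).
  rewrite zr /K0 le_eqVlt; apply/orP; left; apply/eqP.
  have -> : expR (- (r *+ 2)) = expR (- r) * expR (- r).
    by rewrite -expRD mulr2n opprD.
  have e1 : expR r * expR (- r) = 1 by rewrite -expRD addrN expR0.
  by move: (expR r) (expR (- r)) e1 => p p' e1; ring: e1.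
have powle : mabs (powb x) <= n.+1%:R * expR (b0 * r) by exact: mabs_powb.
have Qle u : N u -> mabs (powb x *m W u) <= n.+1%:R * expR (b0 * r) * c.
  move=> Nu; apply: (le_trans (mabsM _ _)).
  by apply: ler_pM; rewrite ?mabs_ge0//; exact: hW.
pose E1 := expR (- r) * expR (b0 * r).
have E10 : 0 <= E1 by rewrite mulr_ge0 ?expR_ge0.
have dXle u : N u -> mabs (L u *m (powb x *m W u)) <= K1 * E1.
  move=> Nu; apply: (le_trans (mabsM _ _)).
  apply: (le_trans (ler_pM (mabs_ge0 _) (mabs_ge0 _) (Lle u Nu) (Qle u Nu))).
  by rewrite /K1 /E1 le_eqVlt; apply/orP; left; apply/eqP; ring.
have u1E : u0 + v = u1 by rewrite /v addrC subrK.
have Xle : mabs (X u1 - X u0) <= n.+1%:R * n.+1%:R * (K1 * E1).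
  apply: mabs_le => k l.
  rewrite (_ : (X u1 - X u0) k l = X u1 k l - X u0 k l); last by rewrite !mxE.
  rewrite -{1}u1E.
  refine (@mean_value_bound R V (fun y => X y k l) u0 v (fun p =>
    (L (u0 + toC p *: v) *m (powb x *m W (u0 + toC p *: v))) k l) _ _ _) => p hp.
    exact: dX (seg1 p hp) k l.
  by apply: (le_trans (cabs_mabs _ _ _)); apply: dXle; case: (seg1 p hp).
have N1u0 : N1 u0 by exact: nbhs_singleton.
have N1u1 : N1 u1.
  by have := seg1 1; rewrite toC1 scale1r -/v u1E; apply; rewrite ler01 lexx.
have Dle : mabs (powb x *m (W u1 - 1%:M)) <= K * E1.
  have W0 : W u0 = 1%:M by rewrite mulVmx ?uG.
  have -> : powb x *m (W u1 - 1%:M) = X u1 - X u0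
      - (Yh x u1 - 1%:M) *m (powb x *m W u1) + (Yh x u0 - 1%:M) *m powb x.
    rewrite (XE u1 N1u1) (XE u0 N1u0) W0 mulmx1.
    exact: difference_identity.
  apply: (le_trans (mabsD _ _)); rewrite /K !mulrDl; apply: lerD.
    apply: (le_trans (mabsB _ _)); apply: lerD.
      by rewrite -(mulrA (n.+1%:R * n.+1%:R)).
    apply: (le_trans (mabsM _ _)).
    apply: (le_trans (ler_pM (mabs_ge0 _) (mabs_ge0 _) (Yh_near1 ht Nu1 hr) (Qle u1 Nu1))).
    by rewrite /E1 le_eqVlt; apply/orP; left; apply/eqP; ring.
  apply: (le_trans (mabsM _ _)).
  apply: (le_trans (ler_pM (mabs_ge0 _) (mabs_ge0 _) (Yh_near1 ht Nu0 hr) powle)).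
  by rewrite /E1 le_eqVlt; apply/orP; left; apply/eqP; ring.
have := le_trans (cabs_mabs _ i j) Dle.
rewrite mul_diag_mx [X in cabs X]mxE cabsM mxE cabs_cexp.
move: (cabs _) (cabs_ge0 ((W u1 - 1%:M) i j)) => w w0 hw.
have K_ge0 : 0 <= K.
  by rewrite !addr_ge0// ?mulr_ge0// ?mulrn_wge0// mulr_ge0.
have hb' : expR (- (b0 * r)) <= expR (ReC (x * toC (b i))).
  rewrite ler_expR ReCM ReC_ray /= mulr0 subr0 -mulNr mulrC ler_wpM2l//.
  by have := hb i; rewrite ler_norml => /andP[].
have := le_trans (ler_wpM2r w0 hb') hw; rewrite expRN.
rewrite ler_pdivrMl ?expR_gt0// => /le_trans; apply.
rewrite mulrCA ler_wpM2l// /E1 -!expRD ler_expR /g.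
by rewrite le_eqVlt; apply/orP; left; apply/eqP; ring.
Unshelve. all: by end_near. Qed.

End flat_asymptotics.

(** * Geometry along the caustic *)

Section entrywise_derivatives.
Context {R : realType} {V : normedModType (Cx R)}.
Local Notation C := (Cx R).

Lemma is_mderive_is_derive m n (A : V -> 'M[C]_(m, n)) (a v : V) dA :
  is_mderive A a v dA -> is_derive a v A dA.
Proof.
move=> h.
have Acvg : (h^-1 *: ((A \o shift a) (h *: v) - A a)) @[h --> 0^'] --> dA.
  apply/cvgrPdist_le => e e0; near=> t.
  apply: mx_norm_le => [|i j]; first exact: ltW.
  rewrite !mxE; move: i j; near: t; apply: filter_forall => i; apply: filter_forall => j.
  have [dij eij] := h i j.
  have := dij; rewrite /derivable -/(derive _ _ _) => dij'.
  have : (t^-1 *: (((fun y => A y i j : C) \o shift a) (t *: v) - A a i j))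
     @[t --> 0^'] --> dA i j by rewrite -eij.
  by move/cvgrPdist_le => /(_ e e0).
by split; [apply/cvg_ex; eexists; exact: Acvg |
           apply: cvg_lim Acvg; exact: norm_hausdorff].
Unshelve. all: by end_near. Qed.

Lemma is_mderive_scale m n (f : V -> C) (B : V -> 'M[C]_(m, n)) (a v : V) df dB :
  is_derive a v f df -> is_mderive B a v dB ->
  is_mderive (fun y => f y *: B y) a v (df *: B a + f a *: dB).
Proof.
move=> hf hB i j; have E1 : (fun y => (f y *: B y) i j) = fun y => f y * B y i j.
  by apply/funext => y; rewrite mxE.
by rewrite E1 !mxE; exact: is_derive_mulC.
Qed.

End entrywise_derivatives.

Section linear_combinations.
Context {K : fieldType} {W W' : lmodType K} (f : W -> W').
Hypothesis f_lin : forall a u v, f (a *: u + v) = a *: f u + f v.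

Lemma lin0 : f 0 = 0.
Proof.
have := f_lin 1 0 0; rewrite !scale1r addr0 => /eqP.
by rewrite -{1}[f 0]addr0 (inj_eq (addrI _)) => /eqP.
Qed.

Lemma linZ a u : f (a *: u) = a *: f u.
Proof. by rewrite -[a *: u]addr0 f_lin lin0 addr0. Qed.

Lemma linD u v : f (u + v) = f u + f v.
Proof. by rewrite -{1}[u]scale1r f_lin scale1r. Qed.

Lemma lin_sum (I : Type) (r : seq I) (P : pred I) (c : I -> K) (v : I -> W) :
  f (\sum_(i <- r | P i) c i *: v i) = \sum_(i <- r | P i) c i *: f (v i).
Proof.
elim: r => [|i r IH]; first by rewrite !big_nil lin0.
by rewrite !big_cons; case: ifP; rewrite // linD linZ IH.
Qed.

End linear_combinations.

Section derivative_rules.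
Context {R : realType} {V : normedModType (Cx R)}.
Local Notation C := (Cx R).

Lemma derive_near_lin (f1 f2 f : V -> C^o) (y v : V) (a : C) :
  derivable f1 y v -> derivable f2 y v ->
  (\forall y' \near y, f y' = a * f1 y' + f2 y') ->
  'D_v f y = a * 'D_v f1 y + 'D_v f2 y.
Proof.
move=> h1 h2 hf.
have h := is_deriveD (is_deriveZ a (derivableP h1)) (derivableP h2).
have hf' : \forall y' \near y, (a \*: f1 + f2) y' = f y'.
  by apply: filterS hf => y' ->.
by have [_ ->] := near_eq_is_derive hf' h.
Qed.

Lemma derive_near0 (f : V -> C^o) (y v : V) :
  (\forall y' \near y, f y' = 0) -> 'D_v f y = 0.
Proof.
move=> hf; rewrite (near_eq_derive (g := cst 0) v) ?derive_cst//.
Qed.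

Lemma derive_dir_lin (W : normedModType C) (f : V -> W) y (a : C) (v w : V) :
  differentiable f y -> 'D_(a *: v + w) f y = a *: 'D_v f y + 'D_w f y.
Proof. by move=> h; rewrite !deriveE// linearP. Qed.

Lemma derive_lin (W : normedModType C) (f : V -> W) (y v : V) :
  (forall a u v, f (a *: u + v) = a *: f u + f v) -> 'D_v f y = f v.
Proof.
move=> hf; apply: cvg_lim; first exact: norm_hausdorff.
apply: cvg_near_cst; exists 1 => //= h _ h0.
by rewrite /= hf addrK scalerA mulVf// scale1r.
Qed.

End derivative_rules.

(** * Metric, connection and orthonormal frame in the normal form *)

Section chart_geometry.
Context {R : realType} {k : nat}.
Local Notation C := (Cx R).
Local Notation V := 'rV[C]_k.+2.
Local Notation U := 'rV[C]_k.+1.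
Local Notation mat := 'M[C]_k.+2.

(** Tells which [u_i] is the eigenvalue of [U] at index [a]: the normal (index 0) and [f_2] (index
    1) share [u_2], that is block [ord0]. *)
Definition blk (a : 'I_k.+2) : 'I_k.+1 :=
  if unlift ord0 a is Some i then i else ord0.

Lemma blk0 : blk ord0 = ord0. Proof. by rewrite /blk unlift_none. Qed.
Lemma blk_lift i : blk (lift ord0 i) = i. Proof. by rewrite /blk liftK. Qed.

Lemma blk_eq (a b : 'I_k.+2) : blk a = blk b ->
  a = b \/ (a < 2)%N /\ (b < 2)%N.
Proof.
rewrite /blk; case: (unliftP ord0 a) => [i ->|->]; case: (unliftP ord0 b) => [j ->|->].
- by move=> ->; left.
- by move=> ->; right.
- by move=> <-; right.
- by left.
Qed.

Lemma blk_neq (a b : 'I_k.+2) : blk a != blk b -> a != b /\ ~~ ((a < 2) && (b < 2))%N.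
Proof.
move=> ne; split; first by apply: contra ne => /eqP ->.
apply: contra ne => /andP[]; rewrite /blk.
have small (c : 'I_k.+2) i : c = lift ord0 i -> (c < 2)%N -> i = ord0.
  by move=> -> h; apply: val_inj; move: h; rewrite /= /bump /=; case: (val i).
case: (unliftP ord0 a) => [i ai|_] ha; case: (unliftP ord0 b) => [j bj|_] hb //.
- by rewrite (small _ _ ai ha) (small _ _ bj hb).
- by rewrite (small _ _ ai ha).
- by rewrite (small _ _ bj hb).
Qed.

(** The [j]-th summand of the tangent algebra; block [ord0] is the plane spanned by [dt] and
    [pi_ ord0]. *)
Definition inblk (j : 'I_k.+1) (v : V) := forall a, blk a != j -> v 0 a = 0.

Lemma pi_coord i : pi_ i = coord_vec (lift ord0 i) :> V. Proof. by []. Qed.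

Lemma inblk_coord a : inblk (blk a) (coord_vec a).
Proof.
move=> b hb; rewrite !mxE eqxx /=; case: eqP => [eb|] //.
by rewrite -eb eqxx in hb.
Qed.

Lemma inblkZ j c v : inblk j v -> inblk j (c *: v).
Proof. by move=> h a ha; rewrite mxE h// mulr0. Qed.

Lemma inblk_pi i : inblk i (pi_ i).
Proof. by have := @inblk_coord (lift ord0 i); rewrite blk_lift. Qed.

(** The unit field ([unit_e0]). Its coordinates are constant, so flatness of the unit becomes a
    condition on Christoffel symbols alone. *)
Definition e0 : V := \sum_i pi_ i.

Variables (mul : V -> V -> V -> V) (e E : V -> V) (g : V -> V -> V -> C).
Variables (d : C) (m : nat) (O : set V).
Hypothesis oO : open O.
Hypothesis hdf : dubrovin_frobenius_on O mul e E g d.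
Hypothesis hg : forall v w, holomorphic O (fun y => g y v w : C^o).
Hypothesis hI2 : forall y, O y ->
  [/\ mul y dt dt = (y 0 0) ^+ (m - 2) *: pi_ ord0,
      mul y dt (pi_ ord0) = dt,
      forall i, i != ord0 -> mul y dt (pi_ i) = 0,
      forall i j, mul y (pi_ i) (pi_ j) = if i == j then pi_ i else 0 &
      E y = (2%:R / m%:R * y 0 0) *: dt
        + \sum_(i < k.+1) y 0 (lift ord0 i) *: pi_ i].

Section at_point.
Variable y : V.
Hypothesis Oy : O y.

Lemma mul_linl w a u v : mul y (a *: u + v) w = a *: mul y u w + mul y v w.
Proof. by case: hdf => -[h _ _ _ _] _ _ _ _; case: (h y Oy). Qed.
Lemma mul_linr w a u v : mul y w (a *: u + v) = a *: mul y w u + mul y w v.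
Proof. by case: hdf => -[h _ _ _ _] _ _ _ _; case: (h y Oy). Qed.
Lemma mul_comm v w : mul y v w = mul y w v.
Proof. by case: hdf => -[_ h _ _ _] _ _ _ _; exact: h. Qed.
Lemma mul_unit v : mul y (e y) v = v.
Proof. by case: hdf => -[_ _ _ h _] _ _ _ _; exact: h. Qed.
Lemma met_linl w a u v : g y (a *: u + v) w = a * g y u w + g y v w.
Proof. by case: hdf => _ _ [h _ _] _ _; case: (h y Oy) => h1 _; exact: h1. Qed.
Lemma met_linr w a u v : g y w (a *: u + v) = a * g y w u + g y w v.
Proof. by case: hdf => _ _ [h _ _] _ _; case: (h y Oy) => _ h1; exact: h1. Qed.
Lemma met_sym v w : g y v w = g y w v.
Proof. by case: hdf => _ _ [_ h _] _ _; exact: h. Qed.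
Lemma met_nondeg v : (forall w, g y v w = 0) -> v = 0.
Proof. by case: hdf => _ _ [_ _ h] _ _; exact: h. Qed.
Lemma met_inv u v w : g y (mul y u v) w = g y u (mul y v w).
Proof. by case: hdf => _ _ _ h _; exact: h. Qed.

Lemma metZl c v w : g y (c *: v) w = c * g y v w.
Proof. exact: (@linZ C V C^o (g y ^~ w) (met_linl w) c v). Qed.
Lemma metZr c v w : g y v (c *: w) = c * g y v w.
Proof. exact: (@linZ C V C^o (g y v) (met_linr v) c w). Qed.
Lemma metDl u v w : g y (u + v) w = g y u w + g y v w.
Proof. exact: (@linD C V C^o (g y ^~ w) (met_linl w) u v). Qed.
Lemma met_suml (I : finType) (c : I -> C) (v : I -> V) w :
  g y (\sum_i c i *: v i) w = \sum_i c i * g y (v i) w.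
Proof. exact: (@lin_sum C V C^o (g y ^~ w) (met_linl w)). Qed.
Lemma met_sumr (I : finType) (c : I -> C) (v : I -> V) w :
  g y w (\sum_i c i *: v i) = \sum_i c i * g y w (v i).
Proof. exact: (@lin_sum C V C^o (g y w) (met_linr w)). Qed.

Lemma coord_sum (v : V) : v = \sum_a v 0 a *: coord_vec a.
Proof. by rewrite {1}[v]row_sum_delta. Qed.

Lemma mul_pi_coord i a :
  mul y (pi_ i) (coord_vec a) = if i == blk a then coord_vec a else 0.
Proof.
have [_ h1 h2 h3 _] := hI2 Oy; rewrite /blk.
case: (unliftP ord0 a) => [j ->|->].
  by rewrite -/(pi_ j) h3; case: eqP => [->|].
rewrite -/dt mul_comm; have [->|ne] := eqVneq i ord0; first exact: h1.
exact: h2.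
Qed.

Lemma mul_pi_inblk i j v : inblk j v ->
  mul y (pi_ i) v = if i == j then v else 0.
Proof.
move=> hv; rewrite {1}[v]coord_sum (lin_sum (mul_linr _)).
rewrite (eq_bigr (fun a => if i == j then v 0 a *: coord_vec a else 0)).
  by case: eqP => _; rewrite -?coord_sum// big1.
move=> a _; rewrite mul_pi_coord.
have [<-|ne] := eqVneq (blk a) j; first by case: eqP => _ //; rewrite scaler0.
by rewrite hv// !scale0r; case: eqP.
Qed.

Lemma mul_e0 v : mul y e0 v = v.
Proof.
rewrite /e0 -(eq_bigr _ (fun i _ => scale1r (pi_ i))).
rewrite (lin_sum (mul_linl v)) [RHS]coord_sum.
rewrite {1}[v]coord_sum.
transitivity (\sum_i \sum_a v 0 a *: mul y (pi_ i) (coord_vec a)).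
  by apply: eq_bigr => i _; rewrite scale1r (lin_sum (mul_linr _)).
rewrite exchange_big /=; apply: eq_bigr => a _.
rewrite (bigD1 (blk a))//= mul_pi_coord eqxx big1 ?addr0// => i ne.
by rewrite mul_pi_coord (negPf ne) scaler0.
Qed.

Lemma unit_e0 : e y = e0.
Proof. by rewrite -[LHS]mul_e0 mul_comm mul_unit. Qed.

Lemma met_pi i j v : inblk j v -> g y (pi_ i) v = if i == j then g y e0 v else 0.
Proof.
move=> hv; rewrite -{1}[pi_ i]mul_e0 met_inv (mul_pi_inblk i hv).
by case: eqP => // _; exact: (@lin0 C V C^o (g y e0) (met_linr e0)).
Qed.

(** The idempotent [pi_ i] fixes [v] and kills [w], and invariance of the metric moves it from one
    to the other. *)
Lemma met_offblk i j v w : inblk i v -> inblk j w -> i != j -> g y v w = 0.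
Proof.
move=> hv hw ne; have := mul_pi_inblk i hv; rewrite eqxx => <-.
rewrite mul_comm met_inv (mul_pi_inblk i hw) (negPf ne).
exact: (@lin0 C V C^o (g y v) (met_linr v)).
Qed.

(** By invariance the left side is [g (pi_2, dt o dt)]. Hence [dt] is isotropic on [t = 0] once
    [m >= 3], which is what fixes the unit normal in [Nf_unit0]. *)
Lemma met_dtdt : g y dt dt = (y 0 0) ^+ (m - 2) * g y (pi_ ord0) (pi_ ord0).
Proof.
have [h0 h1 _ h3 _] := hI2 Oy.
by rewrite -{1}h1 met_inv mul_comm -met_inv h0 metZl.
Qed.

End at_point.

Section derivatives_at_point.
Variable y : V.
Hypothesis Oy : O y.

Let nearO : \forall y' \near y, O y'. Proof. exact: open_nbhs_nbhs. Qed.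

Local Notation D v w q := ('D_v (fun y' => g y' w q : C^o) y).

Lemma met_derivable v w q : derivable (fun y' => g y' w q : C^o) y v.
Proof. by apply: diff_derivable; exact: hg. Qed.

Lemma Dmet_lin1 a u v w q : D (a *: u + v) w q = a * D u w q + D v w q.
Proof. by rewrite derive_dir_lin//; exact: hg. Qed.

Lemma Dmet_lin2 a v w1 w2 q : D v (a *: w1 + w2) q = a * D v w1 q + D v w2 q.
Proof.
apply: derive_near_lin; [exact: met_derivable | exact: met_derivable |].
by apply: filterS nearO => y' Oy'; exact: (met_linl Oy').
Qed.

Lemma Dmet_sym v w q : D v w q = D v q w.
Proof.
by apply: near_eq_derive; apply: filterS nearO => y' Oy'; exact: (met_sym Oy').
Qed.

Lemma Dmet_lin3 a v w q1 q2 : D v w (a *: q1 + q2) = a * D v w q1 + D v w q2.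
Proof. by rewrite 3!(Dmet_sym v w) Dmet_lin2. Qed.

Lemma gram_coord v b : (v *m gram g y) 0 b = g y v (coord_vec b).
Proof.
rewrite {2}[v]coord_sum (met_suml Oy) mxE; apply: eq_bigr => a _.
by rewrite mxE.
Qed.

Lemma gram_unit : gram g y \in unitmx.
Proof.
rewrite -row_free_unit -kermx_eq0; apply/eqP/row_matrixP => i.
rewrite row0; apply: (met_nondeg Oy) => w; rewrite {1}[w]coord_sum (met_sumr Oy) big1// => b _.
by rewrite -gram_coord -row_mul mulmx_ker row0 mxE mulr0.
Qed.

(** Koszul's formula for constant fields: pairing with [q] cancels the inverse Gram matrix, so later
    computations see derivatives of [g] alone. *)
Lemma christoffel_met v w q : g y (christoffel g y v w) q
  = 2%:R^-1 * (D v w q + D w v q - D q v w).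
Proof.
rewrite [q]coord_sum (met_sumr Oy).
rewrite (@lin_sum C V C^o (fun q => D v w q) (fun a => Dmet_lin3 a v w)).
rewrite (@lin_sum C V C^o (fun q => D w v q) (fun a => Dmet_lin3 a w v)).
rewrite (@lin_sum C V C^o (fun q => D q v w) (fun a u' v' => Dmet_lin1 a u' v' v w)).
rewrite -big_split /= -sumrB mulr_sumr; apply: eq_bigr => a _.
rewrite -gram_coord /christoffel (mulmxKV gram_unit) !mxE.
have h (p d1 d2 d3 : C) :
    p * (2%:R^-1 * (d1 + d2 - d3)) = 2%:R^-1 * (p * d1 + p * d2 - p * d3).
  by ring.
exact: h.
Qed.

Lemma derive_unit v : 'D_v e y = 0.
Proof.
rewrite (near_eq_derive (g := cst e0)) ?derive_cst//.
by apply: filterS nearO => y' Oy'; exact: (unit_e0 Oy').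
Qed.

Lemma christoffel_unit v : christoffel g y v e0 = 0.
Proof.
case: hdf => _ _ _ _ [h _ _]; have := h y v Oy.
by rewrite /covd derive_unit add0r (unit_e0 Oy).
Qed.

(** Closedness of the coidentity [g (e, .)]: since the unit is flat with constant coordinates,
    [D v e0 w + D e0 v w - D w v e0 = 0], and subtracting the same relation with [v] and [w]
    exchanged leaves twice the claim. *)
Lemma Dcoidentity_sym v w : D v e0 w = D w e0 v.
Proof.
have h v' w' : D v' e0 w' + D e0 v' w' - D w' v' e0 = 0.
  have := christoffel_met v' e0 w'; rewrite christoffel_unit.
  rewrite (@lin0 C V C^o (g y ^~ w') (met_linl Oy w')) => /esym /eqP.
  by rewrite mulf_eq0 invr_eq0 pnatr_eq0 /= => /eqP.
have h1 := h v w; have := h w v.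
rewrite (Dmet_sym v w e0) (Dmet_sym e0 w v) (Dmet_sym w v e0) in h1 *.
move: (D v e0 w) (D w e0 v) (D e0 v w) h1 => a b c h1 h2.
have : (a + c - b) - (b + c - a) = 0 by rewrite h1 h2 subrr.
have -> : (a + c - b) - (b + c - a) = 2%:R * (a - b) by ring.
by move/eqP; rewrite mulf_eq0 pnatr_eq0 /= subr_eq0 => /eqP.
Qed.

Lemma Dmet_offblk i j u v w : inblk i v -> inblk j w -> i != j -> D u v w = 0.
Proof.
move=> hv hw ne; apply: derive_near0; apply: filterS nearO => y' Oy'.
exact: (met_offblk Oy' hv hw ne).
Qed.

Lemma Dmet_pi i j u v : inblk j v ->
  D u (pi_ i) v = if i == j then D u e0 v else 0.
Proof.
move=> hv; case: eqP => [->|/eqP ne].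
  apply: near_eq_derive; apply: filterS nearO => y' Oy'.
  by rewrite (met_pi Oy' j hv) eqxx.
exact: (Dmet_offblk u (@inblk_pi i) hv ne).
Qed.

Lemma Dmet_emb (u : U) j w v : inblk j w -> D v (emb u) w = u 0 j * D v e0 w.
Proof.
move=> hw; rewrite /emb (@lin_sum C V C^o (fun q => D v q w)); last first.
  by move=> a p q; exact: Dmet_lin2.
rewrite (bigD1 j)//= (Dmet_pi j v hw) eqxx big1 ?addr0// => i ne.
by rewrite (Dmet_pi i v hw) (negPf ne) scaler0.
Qed.

(** Here and in [christoffel_emb_offblk] the result is a multiple of the same number [D v e0 w];
    eliminating it is what ties [omega] to [V]. *)
Lemma christoffel_pi_offblk i jv jw v w : inblk jv v -> inblk jw w -> jv != jw ->
  g y (christoffel g y (pi_ i) v) w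
  = 2%:R^-1 * (((i == jw)%:R - (i == jv)%:R) * D v e0 w).
Proof.
move=> hv hw ne; rewrite christoffel_met (Dmet_offblk _ hv hw ne) add0r.
rewrite (Dmet_pi i v hw) (Dmet_pi i w hv) (Dcoidentity_sym w v).
by congr (_ * _); do 2 case: eqP => _; rewrite ?subr0 ?sub0r ?subrr ?mul1r ?mulN1r ?mul0r.
Qed.

Lemma christoffel_emb_offblk (u : U) jv jw v w :
  inblk jv v -> inblk jw w -> jv != jw ->
  g y (christoffel g y v (emb u)) w
  = 2%:R^-1 * ((u 0 jw - u 0 jv) * D v e0 w).
Proof.
move=> hv hw ne; rewrite christoffel_met (Dmet_offblk _ hv hw ne) addr0.
rewrite (Dmet_emb u v hw) (Dmet_sym w v) (Dmet_emb u w hv) (Dcoidentity_sym w v).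
by rewrite mulrBl.
Qed.

Lemma christoffel_emb_blk (u : U) j v w : inblk j v -> inblk j w ->
  g y (christoffel g y v (emb u)) w = 2%:R^-1 * D (emb u) v w.
Proof.
move=> hv hw; rewrite christoffel_met.
rewrite (Dmet_emb u v hw) (Dmet_sym w v) (Dmet_emb u w hv) (Dcoidentity_sym w v).
by rewrite addrAC subrr add0r.
Qed.

(** The Euler field in the normal form is linear in the coordinates, so this one map is both the
    field and its derivative. *)
Definition euler_lin (v : V) : V := (2%:R / m%:R * v 0 0) *: dt
  + \sum_(i < k.+1) v 0 (lift ord0 i) *: pi_ i.

Lemma euler_lin_lin a u v :
  euler_lin (a *: u + v) = a *: euler_lin u + euler_lin v.
Proof.
rewrite /euler_lin !mxE scalerDr addrACA; congr (_ + _).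
  by rewrite scalerA -scalerDl; congr (_ *: _); ring.
rewrite scaler_sumr -big_split /=; apply: eq_bigr => i _.
by rewrite !mxE scalerDl scalerA.
Qed.

Lemma derive_euler v : 'D_v E y = euler_lin v.
Proof.
rewrite (near_eq_derive (g := euler_lin)); first exact: derive_lin euler_lin_lin.
by apply: filterS nearO => y' Oy'; have [_ _ _ _ ->] := hI2 Oy'.
Qed.

Lemma Dmet_euler v w : D (E y) v w
  = (2%:R - d) * g y v w - g y (euler_lin v) w - g y v (euler_lin w).
Proof.
case: hdf => _ _ _ _ [_ h _].
have := h O (conj oO (fun _ => id)) (cst v) (cst w)
  (fun _ _ => differentiable_cst _ _) (fun _ _ => differentiable_cst _ _) y Oy.
rewrite /lie_metric /gmet /bracket /= !derive_cst !derive_euler !sub0r.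
rewrite -(scaleN1r (euler_lin v)) -(scaleN1r (euler_lin w)) (metZl Oy) (metZr Oy) => <-.
have h1 (p q r : C) : p = p - -1 * q - -1 * r - q - r by ring.
exact: h1.
Qed.

Lemma euler_lin_dt : euler_lin dt = (2%:R / m%:R) *: dt.
Proof.
rewrite /euler_lin big1 ?addr0; first by rewrite !mxE eqxx mulr1.
by move=> i _; rewrite !mxE /= scale0r.
Qed.

Lemma euler_lin_pi i : euler_lin (pi_ i) = pi_ i.
Proof.
rewrite /euler_lin !mxE eqxx /= mulr0 scale0r add0r (bigD1 i)//=.
rewrite !mxE !eqxx scale1r big1 ?addr0// => j ne.
by rewrite !mxE eqxx /= (inj_eq lift_inj) (negPf ne) scale0r.
Qed.

Lemma inblk_euler_lin j v : inblk j v -> inblk j (euler_lin v).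
Proof.
move=> hv a ha; rewrite /euler_lin !mxE summxE.
rewrite [X in _ + X]big1 => [|i _].
  rewrite addr0; case: (unliftP ord0 a) => [b ab|ab].
    by rewrite ab eqxx /= mulr0.
  have v0 : v 0 0 = 0 by apply: hv; move: ha; rewrite ab.
  by rewrite v0 mulr0 mul0r.
rewrite !mxE eqxx /=; case: eqP => [ai|_]; last by rewrite mulr0.
by rewrite -ai hv// mul0r.
Qed.

Lemma met_ext p q : (forall w, g y p w = g y q w) -> p = q.
Proof.
move=> h; apply/eqP; rewrite -subr_eq0; apply/eqP; apply: (met_nondeg Oy) => w.
by rewrite (metDl Oy) h -(metDl Oy) subrr (@lin0 C V C^o (g y ^~ w) (met_linl Oy w)).
Qed.

Lemma christoffel_linr v a p q :
  christoffel g y v (a *: p + q) = a *: christoffel g y v p + christoffel g y v q.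
Proof.
apply: met_ext => w.
apply: etrans (christoffel_met v (a *: p + q) w) _; apply: esym.
apply: etrans (met_linl Oy w a (christoffel g y v p) (christoffel g y v q)) _.
apply: etrans (congr2 +%R (congr1 ( *%R a) (christoffel_met v p w))
  (christoffel_met v q w)) _.
rewrite Dmet_lin1 Dmet_lin2 Dmet_lin3.
have h (d1 d2 d3 d4 d5 d6 : C) :
   a * (2%:R^-1 * (d1 + d2 - d3)) + 2%:R^-1 * (d4 + d5 - d6)
   = 2%:R^-1 * (a * d1 + d4 + (a * d2 + d5) - (a * d3 + d6)) by ring.
exact: h.
Qed.

End derivatives_at_point.

Lemma emb00 (u : U) : emb u 0 0 = 0.
Proof. by rewrite /emb summxE big1// => i _; rewrite !mxE mulr0. Qed.

Lemma emb_lift (u : U) i : emb u 0 (lift ord0 i) = u 0 i.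
Proof.
rewrite /emb summxE (bigD1 i)//= big1 => [|j ne].
  by rewrite !mxE !eqxx mulr1 addr0.
by rewrite !mxE eqxx (inj_eq lift_inj) eq_sym (negPf ne) mulr0.
Qed.

Lemma emb_lin a (u v : U) : emb (a *: u + v) = a *: emb u + emb v.
Proof.
rewrite /emb scaler_sumr -big_split /=; apply: eq_bigr => i _.
by rewrite !mxE scalerDl scalerA.
Qed.

Lemma emb_delta i : emb (delta_mx 0 i : U) = pi_ i.
Proof.
rewrite /emb (bigD1 i)//= big1 ?addr0 => [|j ne]; rewrite !mxE eqxx.
  by rewrite eqxx scale1r.
by rewrite (negPf ne) scale0r.
Qed.

Lemma euler_emb u : O (emb u) -> E (emb u) = emb u.
Proof.
move=> Oy; have [_ _ _ _ ->] := hI2 Oy.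
rewrite emb00 mulr0 scale0r add0r; apply: eq_bigr => i _.
by rewrite emb_lift.
Qed.

Variables (D : set U) (Nf : U -> V) (s : 'I_k.+1 -> U -> C).
Hypothesis hm : (3 <= m)%N.
Hypothesis oD : open D.
Hypothesis hDW : forall u, D u -> O (emb u).
Hypothesis hNs : normal_frame_data g D Nf s.

Lemma frame0 : frame Nf s ord0 = Nf.
Proof. by apply/funext => u; rewrite /frame unlift_none. Qed.

Lemma frame_lift i : frame Nf s (lift ord0 i) = fun u => (s i u)^-1 *: pi_ i.
Proof. by apply/funext => u; rewrite /frame liftK. Qed.

Section frame_at_point.
Variable u : U.
Hypothesis Du : D u.
Let Oy : O (emb u). Proof. exact: hDW. Qed.
Local Notation y := (emb u).
Local Notation fr := (frame Nf s).

Lemma s_sqr i : s i u ^+ 2 = g y (pi_ i) (pi_ i).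
Proof. by case: hNs => _ _ _ _; apply. Qed.

Lemma Nf_unit : g y (Nf u) (Nf u) = 1.
Proof. by case: hNs => _ h _ _ _; apply: h. Qed.

Lemma Nf_normal i : g y (Nf u) (pi_ i) = 0.
Proof. by case: hNs => _ _ h _ _; apply: h. Qed.

(** In a one-dimensional block an isotropic [pi_ i] would lie in the radical of [g]. In block [ord0]
    there is also [dt] to pair with, and [s_neq0] argues through the unit normal. *)
Lemma s_neq0_pos i : i != ord0 -> s i u != 0.
Proof.
move=> i0; apply/eqP => si0.
have gii : g y (pi_ i) (pi_ i) = 0 by rewrite -s_sqr si0 expr0n.
have p0 : pi_ i = 0 :> V.
  apply: (met_nondeg Oy) => w; rewrite {1}[w]coord_sum (met_sumr Oy) big1// => a _.
  have [bi|ne] := eqVneq i (blk a); last first.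
    by rewrite (met_offblk Oy (@inblk_pi i) (@inblk_coord a) ne) mulr0.
  have ai : a = lift ord0 i.
    by move: bi i0; rewrite /blk; case: (unliftP ord0 a) => [j -> ->|_ -> /eqP].
  by rewrite ai -pi_coord gii mulr0.
have := congr1 (fun v : V => v 0 (lift ord0 i)) p0.
by rewrite !mxE !eqxx => /eqP; rewrite oner_eq0.
Qed.

Lemma inblk_Nf : inblk ord0 (Nf u).
Proof.
move=> a ha.
case: (unliftP ord0 a) ha => [i ->|->]; last by rewrite blk0 eqxx.
rewrite blk_lift => i0.
have := Nf_normal i; rewrite {1}[Nf u]coord_sum (met_suml Oy).
rewrite (bigD1 (lift ord0 i))//= -pi_coord -s_sqr big1 ?addr0 => [|b ne].
  by move/eqP; rewrite mulf_eq0 sqrf_eq0 (negPf (s_neq0_pos i0)) orbF => /eqP.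
have nb : blk b != i.
  case: (unliftP ord0 b) ne => [j ->|->] ne; last by rewrite blk0 eq_sym.
  by rewrite blk_lift; apply: contra ne => /eqP ->.
by rewrite (met_offblk Oy (@inblk_coord b) (@inblk_pi i) nb) mulr0.
Qed.

Local Notation al := (Nf u 0 ord0).
Local Notation be := (Nf u 0 (lift ord0 ord0)).

Lemma Nf_decomp : Nf u = al *: dt + be *: pi_ ord0.
Proof.
rewrite {1}[Nf u]coord_sum big_ord_recl big_ord_recl big1 ?addr0// => i _.
rewrite (inblk_Nf (a := lift ord0 (lift ord0 i))) ?scale0r//.
by rewrite blk_lift.
Qed.

Lemma Nf_normal0 : al * g y dt (pi_ ord0) + be * g y (pi_ ord0) (pi_ ord0) = 0.
Proof. by rewrite -[be * _](metZl Oy) -(met_linl Oy) -Nf_decomp Nf_normal. Qed.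

(** Since [dt] is isotropic, [1 = g (N, N) = 2 al be f + be^2 h] with [f = g (dt, pi_2)] and
    [h = g (pi_2, pi_2)], while [al f = - be h] because [N] is normal. *)
Lemma Nf_unit0 : be ^+ 2 * g y (pi_ ord0) (pi_ ord0) = -1.
Proof.
have dtdt : g y dt dt = 0.
  rewrite (met_dtdt Oy) emb00 expr0n; case: (m) hm => [|[|[|m']]] //= _.
  by rewrite mul0r.
have := Nf_unit; rewrite {1 2}Nf_decomp.
rewrite (met_linl Oy _ al dt) !(met_linr Oy _ al dt).
rewrite !(metZr Oy be) !(metZl Oy be).
rewrite dtdt (met_sym Oy (pi_ ord0) dt).
have := Nf_normal0.
move: (g y dt (pi_ ord0)) (g y (pi_ ord0) (pi_ ord0)) al be => f h a b h1 h2.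
have -> : b ^+ 2 * h = (a * f + b * h) * (2%:R * b)
  - (a * (a * 0 + b * f) + (a * (b * f) + b * (b * h))) by ring.
by rewrite h1 h2 mul0r sub0r.
Qed.

Lemma Nf_s_sqr : (be * s ord0 u) ^+ 2 = -1.
Proof. by rewrite exprMn s_sqr Nf_unit0. Qed.

Lemma s_neq0 i : s i u != 0.
Proof.
have [->|] := eqVneq i ord0; last exact: s_neq0_pos.
apply/eqP => s0; have := Nf_s_sqr; rewrite s0 mulr0 expr0n /= => /eqP.
by rewrite eq_sym oppr_eq0 oner_eq0.
Qed.

Lemma inblk_frame a : inblk (blk a) (fr a u).
Proof.
case: (unliftP ord0 a) => [i ->|->].
  by rewrite frame_lift blk_lift; apply: inblkZ; exact: inblk_pi.
by rewrite frame0 blk0; exact: inblk_Nf.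
Qed.

Lemma frame_orthonormal a b : g y (fr a u) (fr b u) = (a == b)%:R.
Proof.
case: (unliftP ord0 a) => [i ->|->]; case: (unliftP ord0 b) => [j ->|->].
- rewrite !frame_lift (metZl Oy) (metZr Oy) (inj_eq lift_inj).
  have [<-|ne] := eqVneq i j.
    by rewrite -s_sqr expr2 mulKf ?s_neq0// mulVf ?s_neq0.
  by rewrite (met_offblk Oy (@inblk_pi i) (@inblk_pi j) ne) !mulr0.
- by rewrite frame_lift frame0 (metZl Oy) (met_sym Oy) Nf_normal mulr0.
- by rewrite frame_lift frame0 (metZr Oy) Nf_normal mulr0.
- by rewrite frame0 Nf_unit eqxx.
Qed.

(** Orthonormality says that [Fm *m gram *m Fm^T] is the identity, so the inverse of the frame
    matrix is explicit and frame components become metric pairings. *)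
Lemma in_frame_met w a : (w *m invmx (frame_mx Nf s u)) 0 a = g y w (fr a u).
Proof.
set Fm := frame_mx Nf s u.
have rowF b : row b Fm = fr b u by apply/rowP => j; rewrite !mxE.
have FgF : Fm *m (gram g y *m Fm^T) = 1%:M.
  apply/matrixP => b c; rewrite mulmxA mxE [RHS]mxE -frame_orthonormal.
  rewrite [fr c u]coord_sum (met_sumr Oy); apply: eq_bigr => j _.
  rewrite -(gram_coord Oy) -(rowF b) -(rowF c) -row_mul mulrC.
  by congr (_ * _); rewrite !mxE.
have uF : Fm \in unitmx by case/mulmx1_unit: FgF.
have -> : invmx Fm = gram g y *m Fm^T by rewrite -[RHS](mulKmx uF) FgF mulmx1.
rewrite mulmxA mxE [fr a u]coord_sum (met_sumr Oy); apply: eq_bigr => j _.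
by rewrite (gram_coord Oy) mulrC; congr (_ * _); rewrite !mxE.
Qed.

End frame_at_point.

Section frame_forms.
Variable u : U.
Hypothesis Du : D u.
Let Oy : O (emb u). Proof. exact: hDW. Qed.
Local Notation y := (emb u).
Local Notation fr := (frame Nf s).
Local Notation al := (Nf u 0 ord0).
Local Notation be := (Nf u 0 (lift ord0 ord0)).
Local Notation dl i := (delta_mx 0 i : U).
Local Notation Dg v w q := ('D_v (fun y' => g y' w q : C^o) y).

Lemma Vmx_met a b :
  Vmx E g d Nf s u a b = g y (mu_op g E d y (fr b u)) (fr a u).
Proof. by rewrite mxE (in_frame_met Du). Qed.

Lemma omega_met i a b :
  omega g Nf s i u a b = g y (covd_caustic g i (fr b) u) (fr a u).
Proof. by rewrite mxE (in_frame_met Du). Qed.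

Lemma frame_differentiable b : differentiable (fr b) u.
Proof.
case: hNs => hN _ _ hs _.
case: (unliftP ord0 b) => [i ->|->]; last by rewrite frame0; exact: hN.
rewrite frame_lift; apply: differentiableZl; apply: differentiableV.
  exact: hs.
exact: s_neq0.
Qed.

Lemma derive_frame_inblk i b : inblk (blk b) ('D_(dl i) (fr b) u).
Proof.
move=> a ne; have [_ <-] := is_mderive_diff (dl i) (frame_differentiable b) 0 a.
apply: derive_near0; have := open_nbhs_nbhs (conj oD Du); apply: filterS.
by move=> u' Du'; exact: (inblk_frame Du' ne).
Qed.

Lemma covd_frame_offblk i a b : blk a != blk b ->
  g y (covd_caustic g i (fr b) u) (fr a u)
  = 2%:R^-1 * (((i == blk a)%:R - (i == blk b)%:R) * Dg (fr b u) e0 (fr a u)).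
Proof.
move=> ne; have ne' : blk b != blk a by rewrite eq_sym.
have hb := inblk_frame Du (a := b); have ha := inblk_frame Du (a := a).
rewrite (metDl Oy) (met_offblk Oy (@derive_frame_inblk i b) ha ne') add0r.
exact: (christoffel_pi_offblk Oy i hb ha ne').
Qed.

Lemma met_mu_op v w : g y (mu_op g E d y v) w
  = (2%:R - d) / 2%:R * g y v w - g y (euler_lin v) w
    - g y (christoffel g y v (emb u)) w.
Proof.
rewrite /mu_op /covd (derive_euler Oy) (euler_emb Oy).
rewrite -(scaleN1r (_ + christoffel _ _ _ _)).
rewrite (metDl Oy) (metZl Oy) (metZl Oy (-1)) (metDl Oy) mulN1r opprD.
by rewrite addrA.
Qed.

(** With [kap] the derivative of [g (e0, f_a)] along [f_b], the entry of [omega] is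
    [((i == blk a) - (i == blk b)) * kap / 2] and that of [V] is [- (u_a - u_b) * kap / 2]. *)
Lemma omega_offblk i a b : blk a != blk b ->
  (u 0 (blk a) - u 0 (blk b)) * omega g Nf s i u a b
  = ((i == blk b)%:R - (i == blk a)%:R) * Vmx E g d Nf s u a b.
Proof.
move=> ne; have ne' : blk b != blk a by rewrite eq_sym.
rewrite omega_met Vmx_met covd_frame_offblk// met_mu_op.
have hb := inblk_frame Du (a := b); have ha := inblk_frame Du (a := a).
rewrite (met_offblk Oy hb ha ne') (met_offblk Oy (inblk_euler_lin hb) ha ne').
rewrite (christoffel_emb_offblk Oy u hb ha ne').
move: (derive _ _ _) => kap; set p := (i == _)%:R; set q := (i == _)%:R.
by move: p q => p q; ring.
Qed.

Lemma derive_emb (f : V -> C^o) i : 'D_(dl i) (fun u' => f (emb u') : C^o) u = 'D_(pi_ i) f y.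
Proof.
rewrite /derive; congr (lim (_ @ 0^')); apply/funext => h /=.
by rewrite emb_lin emb_delta.
Qed.

Lemma derive_s i j : 2%:R * s j u * 'D_(dl i) (s j : U -> C^o) u
  = Dg (pi_ i) (pi_ j) (pi_ j).
Proof.
have hs : is_derive u (dl i) (s j : U -> C^o) ('D_(dl i) (s j : U -> C^o) u).
  by apply/derivableP/diff_derivable; case: hNs => _ _ _ h _; exact: h.
have [_ E1] := is_derive_mulC hs hs.
have E2 : 'D_(dl i) (fun u' => g (emb u') (pi_ j) (pi_ j) : C^o) u
    = 'D_(dl i) (fun u' => s j u' * s j u' : C^o) u.
  apply: near_eq_derive; have := open_nbhs_nbhs (conj oD Du).
  by apply: filterS => u' Du'; rewrite -expr2 (s_sqr Du').
apply: esym; apply: etrans (esym (derive_emb (fun y' => g y' (pi_ j) (pi_ j)) i)) _.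
apply: etrans E2 _; apply: etrans E1 _.
have h (p q : C) : p * q + q * p = 2%:R * q * p by ring.
exact: h.
Qed.

(** A frame vector of constant length is orthogonal to its covariant derivative: the derivative of
    [1 / s] cancels the Christoffel term. *)
Lemma omega_diag i j : omega g Nf s i u (lift ord0 j) (lift ord0 j) = 0.
Proof.
rewrite omega_met /covd_caustic; have sj := s_neq0 Du j.
set w := fr (lift ord0 j) u; have wE : w = (s j u)^-1 *: pi_ j.
  by rewrite /w frame_lift.
rewrite (metDl Oy) (christoffel_met Oy) addrK.
have -> : 'D_(dl i) (fr (lift ord0 j)) u
    = (- (s j u) ^- 2 * 'D_(dl i) (s j : U -> C^o) u) *: pi_ j.
  rewrite frame_lift.
  have hd : derivable (s j : U -> C^o) u (dl i).
    by apply: diff_derivable; case: hNs => _ _ _ h _; exact: h.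
  have eV : 'D_(dl i) (fun u' => (s j u')^-1 : C^o) u
    = - (s j u) ^- 2 * 'D_(dl i) (s j : U -> C^o) u := deriveV sj hd.
  rewrite -eV; have h := is_mderive_scale (derivableP (derivableV sj hd))
    (is_mderive_cst (pi_ j : V) u (dl i)).
  rewrite scaler0 addr0 in h.
  by have [_ ->] := is_mderive_is_derive h.
rewrite wE (metZl Oy) (metZr Oy) -(s_sqr Du).
have -> : Dg (pi_ i) ((s j u)^-1 *: pi_ j) ((s j u)^-1 *: pi_ j)
   = (s j u)^-1 * ((s j u)^-1 * Dg (pi_ i) (pi_ j) (pi_ j)).
  rewrite (@linZ C V C^o (fun q => Dg (pi_ i) q _)); last first.
    by move=> *; exact: (Dmet_lin2 Oy).
  rewrite (@linZ C V C^o (fun q => Dg (pi_ i) _ q))//.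
  by move=> *; exact: (Dmet_lin3 Oy).
rewrite -derive_s; move: (derive _ _ _) (s j u) sj => ds t t0.
by field.
Qed.

(** On [t = 0] the Euler field is [emb u], so [christoffel_emb_blk] turns the entry into the
    derivative along [E] of the metric on the constant vectors [f_2] and [N]. Homogeneity of [g]
    evaluates it, and the weights [2/m] of [dt] and 1 of [pi_2] combine by normality of [N]. *)
Lemma Vmx12 : Vmx E g d Nf s u (@i1 k) (@i2 k)
  = 2%:R^-1 * (1 - 2%:R / m%:R) * (be * s ord0 u).
Proof.
rewrite Vmx_met /i1 /i2 frame0 frame_lift met_mu_op.
set w := (s ord0 u)^-1 *: pi_ ord0.
have hw : inblk ord0 w by apply: inblkZ; exact: inblk_pi.
have gw : g y w (Nf u) = 0.
  by rewrite (metZl Oy) (met_sym Oy) (Nf_normal Du) mulr0.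
have ew : euler_lin w = w.
  by rewrite /w (linZ euler_lin_lin) euler_lin_pi.
rewrite ew gw mulr0 subr0 sub0r (christoffel_emb_blk Oy u hw (inblk_Nf Du)).
rewrite -{2}(euler_emb Oy) (Dmet_euler Oy) ew gw mulr0 subr0 sub0r.
have eN : euler_lin (Nf u) = (al * (2%:R / m%:R)) *: dt + be *: pi_ ord0.
  rewrite {1}(Nf_decomp Du) euler_lin_lin (linZ euler_lin_lin) euler_lin_dt.
  by rewrite euler_lin_pi scalerA.
rewrite eN (metZl Oy) (met_linr Oy _ _ dt) (metZr Oy be) (met_sym Oy _ dt).
have := Nf_normal0 Du; rewrite -(s_sqr Du); have := s_neq0 Du ord0.
move: (g y dt _) al be (s ord0 u) (2%:R / m%:R) => f a b t c t0 h.
have -> : a * c * f = - (c * (b * t ^+ 2)) + c * (a * f + b * t ^+ 2) by ring.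
by rewrite h mulr0 addr0; field.
Qed.

(** Leibniz's rule on the column field, paired with [f_c], separates the derivatives of the entries
    from [omega]; multiplication by [pi_ i] acts on the frame as [block_scalar blk (dl i)]. *)
Lemma flat_columns_derivative (Y : C -> U -> mat) x i :
  flat_columns mul E g d Nf s D Y -> differentiable (Y x) u ->
  is_mderive (Y x) u (dl i)
    (- ((omega g Nf s i u + cexp x *: block_scalar blk (dl i)) *m Y x u)).
Proof.
move=> hflat hY; have hdY := is_mderive_diff (dl i) hY.
move: ('D_(dl i) (Y x) u) hdY => dY hdY.
suff -> : - ((omega g Nf s i u + cexp x *: block_scalar blk (dl i)) *m Y x u) = dY by [].
apply/matrixP => c b; have [h _] := hflat b x u Du.
have {h} := h i; rewrite /covd_caustic.
have dv : is_derive u (dl i) (column_field Nf s Y b x)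
    (\sum_a (dY a b *: fr a u + Y x u a b *: 'D_(dl i) (fr a) u)).
  apply: is_derive_fsum => a; apply: is_mderive_is_derive.
  exact: is_mderive_scale (hdY a b) (is_mderive_diff (dl i) (frame_differentiable a)).
have [_ ->] := dv.
rewrite {1}/column_field (lin_sum (christoffel_linr Oy (pi_ i))).
rewrite {1}/column_field (lin_sum (mul_linr Oy (pi_ i))) => h.
have {}h : \sum_a dY a b *: fr a u
   + \sum_a Y x u a b *: covd_caustic g i (fr a) u
   + \sum_a (cexp x * Y x u a b) *: mul y (pi_ i) (fr a u) = 0.
  rewrite -[RHS]h scaler_sumr; congr (_ + _); last first.
    by apply: eq_bigr => a _; rewrite scalerA.
  rewrite big_split /= -addrA; congr (_ + _); rewrite -big_split /=.
  by apply: eq_bigr => a _; rewrite -scalerDr.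
have := congr1 (g y ^~ (fr c u)) h.
rewrite (@lin0 C V C^o (g y ^~ (fr c u)) (met_linl Oy (fr c u))).
rewrite !(metDl Oy) !(met_suml Oy) => {}h.
apply/eqP; rewrite mxE eq_sym -addr_eq0; apply/eqP; rewrite -[RHS]h mxE -addrA.
congr (_ + _).
  rewrite (bigD1 c)//= (frame_orthonormal Du) eqxx mulr1 big1 ?addr0// => a ne.
  by rewrite (frame_orthonormal Du) (negPf ne) mulr0.
rewrite -big_split /=; apply: eq_bigr => a _.
rewrite mxE mulrDl -omega_met mulrC; congr (_ + _).
rewrite (mul_pi_inblk Oy i (inblk_frame Du (a := a))) !mxE.
rewrite [in RHS](_ : (if _ then _ else _) = (i == blk a)%:R *: fr a u); last first.
  by case: eqP => _; rewrite ?scale1r ?scale0r.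
rewrite (metZl Oy) (frame_orthonormal Du) eqxx /= (eq_sym (blk c)).
have [->|ne] := eqVneq c a; first by rewrite /= mulr1n; ring.
by rewrite mulr0n !mulr0 mul0r.
Qed.

End frame_forms.
End chart_geometry.

(** * Isomonodromy *)

Section matrix_estimates.
Context {R : realType}.
Local Notation C := (Cx R).

(** Used in both variables: in [x] it makes a quotient of solutions a function of [u] alone, in [u]
    it makes the monodromy of [Y_L] constant. *)
Lemma is_mderive_quotient0 (V : normedModType C) n p (P : V -> 'M[C]_n.+1)
    (Q : V -> 'M[C]_(n.+1, p)) a v A :
  (\forall y \near a, P y \in unitmx) ->
  is_mderive P a v (A *m P a) -> is_mderive Q a v (A *m Q a) ->
  is_mderive (fun y => invmx (P y) *m Q y) a v 0.
Proof.
move=> uP hP hQ; have uPa := nbhs_singleton uP.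
refine (is_mderive_eq (is_mderiveM (is_mderive_inv uP hP) hQ) _).
by rewrite !mulmxA mulNmx mulmxK// addNr.
Qed.

Lemma is_mderive_block (V : normedModType C) m1 m2 n1 n2
    (A : V -> 'M[C]_(m1, n1)) (B : V -> 'M[C]_(m1, n2))
    (P : V -> 'M[C]_(m2, n1)) (Q : V -> 'M[C]_(m2, n2)) a v dA dB dP dQ :
  is_mderive A a v dA -> is_mderive B a v dB ->
  is_mderive P a v dP -> is_mderive Q a v dQ ->
  is_mderive (fun y => block_mx (A y) (B y) (P y) (Q y)) a v
    (block_mx dA dB dP dQ).
Proof.
move=> hA hB hP hQ i j.
case: (split_ordP i) => i' ->; case: (split_ordP j) => j' ->.
- rewrite block_mxEul (_ : (fun _ => _) = fun y => A y i' j'); first exact: hA.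
  by apply/funext => y; rewrite block_mxEul.
- rewrite block_mxEur (_ : (fun _ => _) = fun y => B y i' j'); first exact: hB.
  by apply/funext => y; rewrite block_mxEur.
- rewrite block_mxEdl (_ : (fun _ => _) = fun y => P y i' j'); first exact: hP.
  by apply/funext => y; rewrite block_mxEdl.
- rewrite block_mxEdr (_ : (fun _ => _) = fun y => Q y i' j'); first exact: hQ.
  by apply/funext => y; rewrite block_mxEdr.
Qed.

Lemma is_mderive_dir q m n (F : 'rV[C]_q -> 'M[C]_(m, n)) u
    (dF : 'I_q -> 'M[C]_(m, n)) :
  differentiable F u ->
  (forall i, is_mderive F u (delta_mx 0 i : 'rV[C]_q) (dF i)) ->
  forall v, is_mderive F u v (\sum_i v 0 i *: dF i).
Proof.
move=> hF hd v; refine (is_mderive_eq (is_mderive_diff v hF) _).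
rewrite {1}[v]row_sum_delta.
rewrite (@lin_sum C _ _ (fun w => 'D_w F u)); last first.
  by move=> *; exact: derive_dir_lin.
apply: eq_bigr => i _; congr (_ *: _).
exact: is_mderive_unique (is_mderive_diff _ hF) (hd i).
Qed.

(** The gauge by [H] removes the block part [Om2] and leaves the conjugate of [[E, G1]]. As [H] and
    [H1] commute with [E], this is [[E, A]] with [A = H^-1 (H H1 + G1 H)]. *)
Lemma gauge_identity (K : fieldType) n (H Om2 Om E G1 H1 Y : 'M[K]_n) (z : K) :
  H \in unitmx -> E *m H = H *m E -> E *m H1 = H1 *m E ->
  Om2 - Om = E *m G1 - G1 *m E ->
  - (invmx H *m (- (Om2 *m H)) *m invmx H) *m Y
    + invmx H *m (- (Om + z *: E) *m Y)
  = (E *m (invmx H *m (H *m H1 + G1 *m H))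
     - invmx H *m (H *m H1 + G1 *m H) *m E - z *: E) *m (invmx H *m Y).
Proof.
move=> uH hE hE1 hO; rewrite (mulNmx (Om + z *: E)).
have hEi : E *m invmx H = invmx H *m E.
  by rewrite -[LHS](mulKmx uH) (mulmxA H E) -hE (mulmxK uH).
have -> : E *m (invmx H *m (H *m H1 + G1 *m H))
     - invmx H *m (H *m H1 + G1 *m H) *m E - z *: E
     = invmx H *m (E *m G1 - G1 *m E - z *: E) *m H.
  rewrite mulmxDr (mulKmx uH) mulmxDr mulmxDl hE1 opprD addrACA subrr add0r.
  rewrite !(mulmxBr, mulmxBl) -scalemxAr -scalemxAl -(mulmxA _ E H) hE.
  by rewrite (mulmxA (invmx H) H) mulVmx// mul1mx !mulmxA hEi -!mulmxA hE.
rewrite -hO -(mulmxA _ H) (mulKVmx uH).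
have -> : invmx H *m (- (Om2 *m H)) *m invmx H = - (invmx H *m Om2).
  by rewrite mulmxN mulNmx (mulmxA _ Om2) (mulmxK uH).
by rewrite opprK mulmxN -(addrA Om2) -opprD mulmxBr mulmxBl !mulmxA.
Qed.

Lemma mabs_norm m n (A : 'M[C]_(m, n)) (c : R) :
  `|A| <= toC c -> mabs A <= m%:R * n%:R * c.
Proof.
move=> h; apply: mabs_le => i j; rewrite -ler_toC -normCE.
exact: le_trans (mx_entry_norm A i j) h.
Qed.

Lemma near_mabs_continuous (V : normedModType C) m n (F : V -> 'M[C]_(m, n)) u
    (e : R) : {for u, continuous F} -> 0 < e ->
  \forall u' \near u, mabs (F u' - F u) <= e.
Proof.
move=> cF e0; pose M : R := m%:R * n%:R + 1.
have M0 : 0 < M by rewrite ltr_wpDl// mulr_ge0.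
move/cvgrPdist_le : cF => /(_ (toC (e / M))); rewrite ltr_toC divr_gt0//.
move=> /(_ isT); apply: filterS => u'; rewrite distrC => /mabs_norm h.
apply: le_trans h _; rewrite mulrA ler_pdivrMr// mulrC.
by apply: ler_wpM2l; [exact: ltW | rewrite lerDl].
Qed.

Lemma near_mabs_bounded (V : normedModType C) m n (F : V -> 'M[C]_(m, n)) u :
  {for u, continuous F} ->
  \forall u' \near u, mabs (F u') <= mabs (F u) + 1.
Proof.
move=> cF; apply: filterS (near_mabs_continuous cF ltr01) => u' h.
by rewrite -[F u'](subrK (F u)) addrC; apply: le_trans (mabsD _ _) _; rewrite lerD2l.
Qed.

(** Near [u] the matrix [M = F(u)^-1 F(u')] is within 1/2 of the identity, and absorbing [(M - 1) X]
    bounds its inverse [X]. *)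
Lemma near_mabs_inv (V : normedModType C) n (F : V -> 'M[C]_n) u :
  {for u, continuous F} -> F u \in unitmx ->
  \forall u' \near u, F u' \in unitmx ->
    mabs (invmx (F u')) <= 2%:R * n%:R * mabs (invmx (F u)).
Proof.
move=> cF uF; set a := mabs (invmx (F u)).
have a0 : 0 <= a by exact: mabs_ge0.
have e0 : 0 < (2%:R * (a + 1))^-1 by rewrite invr_gt0 mulr_gt0// ltr_wpDl.
apply: filterS (near_mabs_continuous cF e0) => u' hu' uF'.
pose M := invmx (F u) *m F u'; pose X := invmx (F u') *m F u.
have MX : M *m X = 1%:M by rewrite /M /X mulmxA (mulmxK uF') (mulVmx uF).
have hM : mabs (M - 1%:M) <= 2%:R^-1.
  rewrite -(mulVmx uF) -mulmxBr; apply: (le_trans (mabsM _ _)).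
  apply: (@le_trans _ _ (a * (2%:R * (a + 1))^-1)).
    by rewrite ler_wpM2l.
  by rewrite ler_pdivrMr ?mulr_gt0 ?ltr_wpDl// mulKf// lerDl.
have hX : mabs X <= 2%:R * n%:R.
  have e1 : X = 1%:M - (M - 1%:M) *m X by rewrite mulmxBl MX mul1mx opprB addrC subrK.
  have h1 : mabs X <= n%:R + mabs (M - 1%:M) * mabs X.
    rewrite {1}e1; apply: (le_trans (mabsB _ _)); rewrite mabs1 lerD2l.
    exact: mabsM.
  have h2 := ler_wpM2r (mabs_ge0 X) hM; clear -h1 h2.
  by move: (mabs X) (mabs (M - 1%:M) * _) (n%:R) h1 h2 => p q r h1 h2; lra.
have -> : invmx (F u') = X *m invmx (F u) by rewrite /X (mulmxK uF).
by apply: (le_trans (mabsM _ _)); rewrite ler_wpM2r.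
Qed.

(** Turning the admissible line by [nu * pi] maps it to itself, so admissibility of [phi] applies in
    every sector. *)
Lemma cexp_ipi_int (nu : int) : let z : C := cexp ('i * toC (nu%:~R * pi)) in
  z = 1 \/ z = -1.
Proof.
move=> z; have : z ^+ 2 = 1.
  rewrite expr2 -cexpD -[RHS](cexp_2ipiz nu); congr cexp.
  rewrite toCM (_ : toC nu%:~R = nu%:~R); first by ring.
  clear z; case: nu => n; first exact: toC_nat.
  by rewrite NegzE !mulrNz toCN; congr (- _); exact: toC_nat.
by move/eqP; rewrite sqrf_eq1 => /orP[] /eqP; [left|right].
Qed.

End matrix_estimates.

Lemma factor_right (K : fieldType) n (a b T P1 P2 Q1 Q2 M : 'M[K]_n) :
  a = T *m P1 *m P2 -> P1 = Q1 -> P2 = Q2 *m M -> b = T *m Q1 *m Q2 -> a = b *m M.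
Proof. by move=> -> -> -> ->; rewrite mulmxA. Qed.

(** * Dependence of [Y_L] on [u], and its monodromy at zero *)

Section isomonodromy.
Context {R : realType} {k : nat}.
Local Notation C := (Cx R).
Local Notation U := 'rV[C]_k.+1.
Local Notation mat := 'M[C]_k.+2.
Variables (D : set U) (Vm : U -> mat).
Hypothesis oD : open D.
Hypothesis pD : path_connected_set D.

(** [fundamental_solution] with an arbitrary matrix function [Vm] in place of the geometric data. *)
Definition fundamental (Y : C -> U -> mat) : Prop :=
  [/\ holomorphic ([set: C^o] `*` D)
        (fun q : C^o * U => Y q.1 q.2 : 'M[C]_(k.+2, k.+2)),
      forall x u, D u -> Y x u \in unitmx &
      forall u x, D u -> derive1 (fun x' : C => Y x' u) x
        = cexp x *: (((cexp x)^-1 *: Vm u - Umx u) *m Y x u)].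

Lemma fundamental_diff_param Y x u : fundamental Y -> D u -> differentiable (Y x) u.
Proof.
move=> [hY _ _] Du; have hq := hY (x, u) (conj I Du).
have hp : differentiable (fun u' : U => (x : C^o, u')) u.
  exact: differentiable_pair.
exact: (differentiable_comp hp hq).
Qed.

Lemma fundamental_diff_time Y x u : fundamental Y -> D u ->
  differentiable (fun x' : C => Y x' u) x.
Proof.
move=> [hY _ _] Du; have hq := hY (x, u) (conj I Du).
have hp : differentiable (fun x' : C^o => (x', u)) x.
  exact: differentiable_pair.
exact: (differentiable_comp hp hq).
Qed.

Lemma fundamental_continuous Y x u : fundamental Y -> D u ->
  {for u, continuous (Y x)}.
Proof.
by move=> hY Du; apply: differentiable_continuous; exact: fundamental_diff_param.
Qed.

Lemma fundamental_near_unit Y x u : fundamental Y -> D u ->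
  \forall u' \near u, Y x u' \in unitmx.
Proof.
move=> [_ h _] Du; have := open_nbhs_nbhs (conj oD Du).
by apply: filterS => u' Du'; exact: h.
Qed.

Lemma fundamental_quotient Y1 Y2 x x' u : fundamental Y1 -> fundamental Y2 ->
  D u -> invmx (Y1 x u) *m Y2 x u = invmx (Y1 x' u) *m Y2 x' u.
Proof.
move=> h1 h2 Du; have [_ u1 _] := h1.
apply: (@is_mderive0_constantC _ _ _ (fun t => invmx (Y1 t u) *m Y2 t u)) => t.
pose A := cexp t *: ((cexp t)^-1 *: Vm u - Umx u).
have hd Y : fundamental Y -> is_mderive (fun t : C => Y t u) t 1 (A *m Y t u).
  move=> hY; have [_ _ hs] := hY.
  have := is_mderive_diff (1 : C) (fundamental_diff_time t hY Du).
  by rewrite -derive1E hs// scalemxAl.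
refine (is_mderive_quotient0 _ (hd _ h1) (hd _ h2)).
by apply: (@filterE _ (nbhs (t : C))) => t'; exact: u1.
Qed.

Definition connection_at (om : 'I_k.+1 -> U -> mat) (v : U) (u : U) : mat :=
  \sum_i v 0 i *: om i u.

Variable om : 'I_k.+1 -> U -> mat.
Variable YL : C -> U -> mat.
Hypothesis fYL : fundamental YL.
Hypothesis flatYL : forall x u i, D u ->
  is_mderive (YL x) u (delta_mx 0 i : U)
   (- ((om i u + cexp x *: block_scalar (@blk k) (delta_mx 0 i)) *m YL x u)).

Lemma block_scalar_sum (v : U) :
  block_scalar (@blk k) v = \sum_i v 0 i *: block_scalar (@blk k) (delta_mx 0 i).
Proof.
apply/matrixP => a b; rewrite !mxE summxE.
under eq_bigr do rewrite !mxE eqxx /=.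
rewrite (bigD1 (blk a))//= eqxx big1 => [|i ne].
  by rewrite addr0 mulrnAr mulr1.
by rewrite eq_sym (negPf ne) mul0rn mulr0.
Qed.

Lemma flat_derivative x u v : D u -> is_mderive (YL x) u v
  (- (connection_at om v u + cexp x *: block_scalar (@blk k) v) *m YL x u).
Proof.
move=> Du; have h := is_mderive_dir (fundamental_diff_param x fYL Du)
  (fun i => flatYL x i Du) v.
refine (is_mderive_eq h _).
rewrite block_scalar_sum scaler_sumr /connection_at -big_split /= mulNmx.
rewrite mulmx_suml -sumrN; apply: eq_bigr => i _.
by rewrite scalerN scalemxAl scalerDr !scalerA (mulrC (cexp x)).
Qed.

Lemma monodromy_constant x x' u u' : cexp x = cexp x' -> D u -> D u' ->
  invmx (YL x u) *m YL x' u = invmx (YL x u') *m YL x' u'.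
Proof.
move=> e Du Du'.
apply: (@is_mderive0_constant _ _ _ _ D (fun u => invmx (YL x u) *m YL x' u)) => //.
move=> w v Dw; refine (is_mderive_quotient0 _ (flat_derivative x v Dw) _).
  exact: fundamental_near_unit.
by rewrite e; exact: flat_derivative.
Qed.

(** One turn around [z = 0] leaves [T] unchanged, and also [z^Delta], as [Delta] is diagonal with
    integer entries. So [Y_L] acquires exactly the factor [e^(2 pi i (R + S))], and
    [monodromy_constant] applies. *)
Lemma levelt_monodromy (T : C -> U -> mat) (Delta S : U -> mat)
    (Rk : nat -> U -> mat) (K : nat) :
  levelt_form D Vm YL T Delta S Rk K ->
  forall u u', D u -> D u' ->
  mexp ((2%:R * 'i * toC pi) *: (\sum_(1 <= h < K) Rk h u + S u))
  = mexp ((2%:R * 'i * toC pi) *: (\sum_(1 <= h < K) Rk h u' + S u')).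
Proof.
move=> hL.
pose om1 := 2%:R * 'i * toC pi : C.
have near0 u : D u -> exists2 r : R, 0 < r & forall t : R, expR t < r ->
    invmx (YL (toC t) u) *m YL (toC t + om1) u
    = mexp (om1 *: (\sum_(1 <= h < K) Rk h u + S u)).
  move=> Du; have [[_ hT] _ hD _ _] := hL u Du.
  have /nbhs_ballP[r /= r0 hr] := hT.
  have rE := ge0_toC (ltW r0).
  exists (ReC r); first by rewrite -ltr_toC -rE.
  move=> t ht; have [_ hx] : differentiable (fun z' : C^o => T z' u) (cexp (toC t)) /\
      forall x, cexp x = cexp (toC t) -> YL x u
        = T (cexp (toC t)) u *m mpow x (Delta u) *m
          mpow x (\sum_(1 <= h < K) Rk h u + S u).
    apply: hr; rewrite -ball_normE /=; change (`|0 - cexp (toC t) : C| < r).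
    rewrite sub0r normrN normCE cabs_cexp rE ltr_toC.
    exact: ht.
  have e1 : cexp (toC t + om1) = cexp (toC t) by rewrite cexpD cexp_2ipi mulr1.
  have DE : mexp (om1 *: Delta u) = 1%:M.
    have -> : Delta u = diag_mx (\row_j Delta u j j).
      apply/matrixP => i j; rewrite !mxE.
      by have := hD i j; case: eqP => [->|]; rewrite ?mulr1n ?mulr0n.
    rewrite mexp_scale_diag; apply/matrixP => i j; rewrite !mxE.
    have := hD i i; rewrite eqxx => -[c ->].
    by rewrite cexp_2ipiz.
  have YE : YL (toC t + om1) u = YL (toC t) u *m
      mexp (om1 *: (\sum_(1 <= h < K) Rk h u + S u)).
    have m1 : mpow (toC t + om1) (Delta u) = mpow (toC t) (Delta u).
      by rewrite mpowD [mpow om1 _]DE mulmx1.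
    have m2 := mpowD (\sum_(1 <= h < K) Rk h u + S u) (toC t) om1.
    have h1 := hx (toC t + om1) e1; have h2 := hx (toC t) (erefl _).
    exact: factor_right h1 m1 m2 h2.
  have uY : YL (toC t) u \in unitmx by case: fYL => _ + _; apply.
  by rewrite YE (mulKmx uY).
move=> u u' Du Du'; have [r r0 hr] := near0 u Du; have [r' r'0 hr'] := near0 u' Du'.
(* The Levelt form holds in a disc whose radius depends on [u]; the point [z = q] lies in both
   discs. *)
pose q := Num.min r r' / 2%:R.
have q0 : 0 < q by rewrite divr_gt0// lt_min r0 r'0.
have qlt : q < Num.min r r' by rewrite ltr_pdivrMr// ltr_pMr ?ltr1n// lt_min r0 r'0.
have eq : expR (ln q) = q by rewrite lnK.
move: qlt; rewrite lt_min => /andP[q1 q2].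
rewrite -(hr (ln q)) ?eq// -(hr' (ln q)) ?eq//.
by apply: monodromy_constant; rewrite // cexpD cexp_2ipi mulr1.
Qed.

End isomonodromy.

(** * The gauge transformation by [H_0] and the asymptotics of the gauged solution *)

Section gauge.
Context {R : realType} {k : nat}.
Local Notation C := (Cx R).
Local Notation U := 'rV[C]_k.+1.
Local Notation mat := 'M[C]_k.+2.
Variables (D : set U) (Vm : U -> mat).
Hypothesis oD : open D.
Variable om : 'I_k.+1 -> U -> mat.
Variable YL : C -> U -> mat.
Hypothesis fYL : fundamental D Vm YL.
Hypothesis flatYL : forall x u i, D u ->
  is_mderive (YL x) u (delta_mx 0 i : U)
   (- ((om i u + cexp x *: block_scalar (@blk k) (delta_mx 0 i)) *m YL x u)).
Hypothesis om_offblk : forall u i a b, D u -> blk a != blk b ->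
  (u 0 (blk a) - u 0 (blk b)) * om i u a b
  = ((i == blk b)%:R - (i == blk a)%:R) * Vm u a b.
Hypothesis om_diag : forall u i j, D u -> om i u (lift ord0 j) (lift ord0 j) = 0.
Hypothesis hDu : distinct_coordinates D.
Variables (G Bk : nat -> U -> mat) (h0 : U -> 'M[C]_2) (H : nat -> U -> mat).
Hypothesis hG : first_gauge D Vm (@Umx R k) G Bk.
Hypothesis hH :
  second_gauge D Vm (fun i u => ulsubmx (om i u : 'M[C]_(2 + k))) Bk h0 H.

Local Notation Ed := (block_scalar (@blk k)).
Definition H0 (u : U) : mat := extend2 (h0 u).

Lemma Umx_block_scalar (u : U) : Umx u = Ed u :> mat.
Proof.
apply/matrixP => a b; rewrite !mxE /blk.
by case: (unliftP ord0 a) => [i ->|->]; rewrite ?(mul1r).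
Qed.

Lemma block_scalar_commute (A : mat) v :
  (forall a b, blk a != blk b -> A a b = 0) -> Ed v *m A = A *m Ed v.
Proof.
move=> h; apply/matrixP => a b; rewrite mul_diag_mx mul_mx_diag !mxE.
have [->|ne] := eqVneq (blk a) (blk b); first by rewrite mulrC.
by rewrite h// mulr0 mul0r.
Qed.

Lemma extend2_offblk (h : 'M[C]_2) (a b : 'I_k.+2) :
  blk a != blk b -> extend2 h a b = 0.
Proof.
move=> /blk_neq[]; rewrite /extend2.
case: (split_ordP (a : 'I_(2 + k))) => i ->; case: (split_ordP (b : 'I_(2 + k))) => j ->.
- by move=> _ /negP[].
- by move=> _ _; apply: etrans (@block_mxEur _ 2 k 2 k h 0 0 1%:M i j) _; rewrite mxE.
- by move=> _ _; apply: etrans (@block_mxEdl _ 2 k 2 k h 0 0 1%:M i j) _; rewrite mxE.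
- move=> ne _; apply: etrans (@block_mxEdr _ 2 k 2 k h 0 0 1%:M i j) _.
  by rewrite mxE; case: eqP => [e|_] //; rewrite e eqxx in ne.
Qed.

Lemma extend2M (h h' : 'M[C]_2) :
  extend2 h *m extend2 h' = extend2 (h *m h') :> mat.
Proof.
by rewrite /extend2 (@mulmx_block _ 2 k 2 k 2 k) !mulmx0 !mul0mx mulmx1 !addr0 add0r.
Qed.

Lemma H0K u : D u -> extend2 (invmx (h0 u)) *m H0 u = 1%:M.
Proof.
move=> Du; have [_ /(_ u Du)[uh _ _ _ _]] := hH.
by rewrite /H0 extend2M mulVmx// /extend2 -scalar_mx_block.
Qed.

Lemma H0_unit u : D u -> H0 u \in unitmx.
Proof. by move=> /H0K /mulmx1_unit []. Qed.

Lemma invmx_H0 u : D u -> invmx (H0 u) = extend2 (invmx (h0 u)).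
Proof.
by move=> Du; rewrite -[RHS](mulmxK (H0_unit Du)) (H0K Du) mul1mx.
Qed.

Definition connection2_at (v : U) (u : U) : mat :=
  block_mx (\sum_i v 0 i *: ulsubmx (om i u : 'M[C]_(2 + k))) 0 0 (0 : 'M[C]_k).

Lemma H0_derivative u v : D u -> is_mderive H0 u v (- (connection2_at v u *m H0 u)).
Proof.
move=> Du; have [hh /(_ u Du)[_ _ dh _ _]] := hH.
have hd i : is_mderive h0 u (delta_mx 0 i : U)
    (- (ulsubmx (om i u : 'M[C]_(2 + k)) *m h0 u)).
  by rewrite -dh; apply: is_mderive_diff; exact: hh.
have h1 := is_mderive_dir (hh u Du) hd v.
refine (is_mderive_eq (is_mderive_block h1 (is_mderive_cst 0 u v)
  (is_mderive_cst 0 u v) (is_mderive_cst 1%:M u v)) _).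
rewrite /connection2_at /H0 /extend2 (@mulmx_block _ 2 k 2 k 2 k).
rewrite !mulmx0 !mul0mx !addr0.
apply: etrans (esym (@opp_block_mx _ 2 k 2 k _ 0 0 0)); rewrite !oppr0.
congr block_mx; rewrite mulmx_suml -sumrN; apply: eq_bigr => i _.
by rewrite scalerN scalemxAl.
Qed.

(** The coefficient of [z^-1] in the first gauge equation is [B_1 - G_1 U = V - U G_1], and [B_1]
    vanishes off the blocks. *)
Lemma commutator_G1 u a b : D u -> blk a != blk b ->
  (u 0 (blk a) - u 0 (blk b)) * G 1 u a b = Vm u a b.
Proof.
move=> Du ne; have [g0 b0 hB _ /(_ 1)] := hG Du.
rewrite /formal_mul /formal_deriv !big_ord_recl !big_ord0 /= mulr0n oppr0 add0r !addr0.
rewrite g0 b0 mul1mx mulmx1 Umx_block_scalar mulmxN mulNmx.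
have PE : (G 1 u *m Ed u) a b = G 1 u a b * u 0 (blk b).
  by rewrite mul_mx_diag !mxE.
have QE : (Ed u *m G 1 u) a b = u 0 (blk a) * G 1 u a b.
  by rewrite mul_diag_mx !mxE.
move: (G 1 u *m Ed u) (Ed u *m G 1 u) PE QE => P Q PE QE /matrixP /(_ a b).
have [ne1 ne2] := blk_neq ne.
rewrite !mxE (hB 1 isT a b ne1 ne2) add0r PE QE => h.
by rewrite mulrBl -[RHS](addNKr (u 0 (blk a) * G 1 u a b)) -h [u 0 (blk b) * _]mulrC.
Qed.

(** Off the blocks, [om_offblk] and [commutator_G1] both involve [V], and eliminating it expresses
    [om] by [G_1]. Inside the 2 x 2 block the two connections agree; the other diagonal entries
    vanish by [om_diag]. *)
Lemma connection_difference u v : D u ->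
  connection2_at v u - connection_at om v u = Ed v *m G 1 u - G 1 u *m Ed v.
Proof.
move=> Du; apply/matrixP => a b.
have entryB (P Q : mat) : (P - Q) a b = P a b - Q a b by rewrite !mxE.
have RE : (Ed v *m G 1 u - G 1 u *m Ed v) a b
    = v 0 (blk a) * G 1 u a b - G 1 u a b * v 0 (blk b).
  by rewrite entryB mul_diag_mx mul_mx_diag !mxE.
rewrite RE entryB {RE}.
have [e|ne] := eqVneq (blk a) (blk b).
  rewrite e [_ * v _ _]mulrC subrr; apply/eqP; rewrite subr_eq0; apply/eqP.
  have [/andP[a2 b2]|n2] := boolP ((a < 2) && (b < 2))%N.
    have aE : a = lshift k (Ordinal a2) :> 'I_(2 + k) by apply: val_inj.
    have bE : b = lshift k (Ordinal b2) :> 'I_(2 + k) by apply: val_inj.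
    rewrite {1}aE {1}bE.
    apply: etrans (@block_mxEul _ 2 k 2 k _ 0 0 0 (Ordinal a2) (Ordinal b2)) _.
    by rewrite !summxE; apply: eq_bigr => i _; rewrite !mxE -aE -bE.
  have ab : a = b.
    by have [//|[h1 h2]] := blk_eq e; rewrite h1 h2 in n2.
  rewrite -ab; rewrite -ab andbb -leqNgt in n2.
  have [j aj] : exists j, a = lift ord0 j.
    case: (unliftP ord0 a) => [j ->|a0]; first by exists j.
    by rewrite a0 in n2.
  rewrite {3 4}aj summxE big1 => [|i _]; last by rewrite mxE om_diag// mulr0.
  rewrite /connection2_at; move: n2; case: (split_ordP (a : 'I_(2 + k))) => i ->.
    by rewrite leqNgt (ltn_ord i : (lshift k i < 2)%N).
  by move=> _; apply: etrans (@block_mxEdr _ 2 k 2 k _ 0 0 0 i i) _; rewrite mxE.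
have -> : connection2_at v u a b = 0.
  have [ne1 ne2] := blk_neq ne; move: ne1 ne2; rewrite /connection2_at.
  case: (split_ordP (a : 'I_(2 + k))) => i ->; case: (split_ordP (b : 'I_(2 + k))) => j ->.
  - by move=> _ /negP[].
  - by move=> _ _; apply: etrans (@block_mxEur _ 2 k 2 k _ 0 0 0 i j) _; rewrite mxE.
  - by move=> _ _; apply: etrans (@block_mxEdl _ 2 k 2 k _ 0 0 0 i j) _; rewrite mxE.
  - by move=> _ _; apply: etrans (@block_mxEdr _ 2 k 2 k _ 0 0 0 i j) _; rewrite mxE.
have uab : u 0 (blk a) - u 0 (blk b) != 0 by rewrite subr_eq0; exact: hDu Du _ _ ne.
have omE i : om i u a b = ((i == blk b)%:R - (i == blk a)%:R) * G 1 u a b.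
  apply: (mulfI uab); rewrite om_offblk// -(commutator_G1 Du ne).
  by rewrite mulrCA.
rewrite sub0r summxE.
under eq_bigr do rewrite mxE omE mulrA mulrBr.
rewrite -mulr_suml sumrB.
have sumE (c : 'I_k.+1) : \sum_i v 0 i * (i == c)%:R = v 0 c.
  rewrite (bigD1 c)//= eqxx mulr1 big1 ?addr0// => i ne'.
  by rewrite (negPf ne') mulr0.
by rewrite !sumE; ring.
Qed.

(** The coefficient of [z^-1] in [G H], whose constant term is [H0]. *)
Definition series1 (u : U) : mat := H0 u *m H 1 u + G 1 u *m H0 u.

Lemma gauged_derivative x u v : D u ->
  is_mderive (fun u' => invmx (H0 u') *m YL x u') u v
   ((Ed v *m (invmx (H0 u) *m series1 u) - invmx (H0 u) *m series1 u *m Ed v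
     - cexp x *: Ed v) *m (invmx (H0 u) *m YL x u)).
Proof.
move=> Du.
have uH : \forall u' \near u, H0 u' \in unitmx.
  have := open_nbhs_nbhs (conj oD Du).
  by apply: filterS => u' Du'; exact: H0_unit.
refine (is_mderive_eq (is_mderiveM (is_mderive_inv uH (H0_derivative v Du))
  (flat_derivative fYL flatYL x v Du)) _).
apply: gauge_identity.
- exact: H0_unit.
- by apply: block_scalar_commute => a b; exact: extend2_offblk.
- apply: block_scalar_commute => a b /blk_neq[n1 n2].
  have [_ /(_ u Du)[_ _ _ hb _]] := hH.
  exact: (hb 1 isT a b n1 n2).
- exact: connection_difference.
Qed.

Lemma mabs_extend2 (h : 'M[C]_2) : mabs (extend2 h : mat) = mabs h + k%:R.
Proof.
rewrite /mabs (@big_split_ord _ _ _ 2 k) /=; congr (_ + _).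
  apply: eq_bigr => i _; rewrite (@big_split_ord _ _ _ 2 k) /=.
  rewrite [X in _ + X]big1 ?addr0 => [|j _].
    apply: eq_bigr => j _; congr cabs; exact: (@block_mxEul _ 2 k 2 k).
  by rewrite [extend2 _ _ _](@block_mxEur _ 2 k 2 k h 0 0 1%:M i j) mxE cabs0.
rewrite -(@mabs1 R k); apply: eq_bigr => i _.
rewrite (@big_split_ord _ _ _ 2 k) /= [X in X + _]big1 ?add0r => [|j _].
  apply: eq_bigr => j _; congr cabs; exact: (@block_mxEdr _ 2 k 2 k).
by rewrite [extend2 _ _ _](@block_mxEdl _ 2 k 2 k h 0 0 1%:M i j) mxE cabs0.
Qed.

Variable b1 : R.
Hypothesis hb1 : `|b1| *+ 2 < 1.
Hypothesis Vm_block : forall u, D u -> 'i * Vm u (@i1 k) (@i2 k) = toC b1.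

Definition formal_exponent (a : 'I_k.+2) : R :=
  if val a is a'.+1 then (if a' is 0 then - b1 else 0) else b1.

Lemma formal_exponent_bound a : `|formal_exponent a| <= `|b1|.
Proof.
by rewrite /formal_exponent; case: (val a) => [|[|a']]; rewrite ?normrN ?normr0.
Qed.

Lemma Bmx_diag u : D u ->
  Bmx (Vm u) = diag_mx (\row_a toC (formal_exponent a)) :> mat.
Proof.
move=> Du; apply/matrixP => a b; rewrite /Bmx.
case: (split_ordP (a : 'I_(2 + k))) => i ->; case: (split_ordP (b : 'I_(2 + k))) => j ->.
- apply: etrans (@block_mxEul _ 2 k 2 k _ 0 0 0 i j) _.
  rewrite !mxE -[(_ == _) in RHS]/(i == j) Vm_block//; have [->|//] := eqVneq i j.
  by case: j => [[|[|j]] hj] //=; rewrite /formal_exponent /= ?toCN.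
- by apply: etrans (@block_mxEur _ 2 k 2 k _ 0 0 0 i j) _; rewrite !mxE [_ == _](@eq_lrshift 2 k).
- by apply: etrans (@block_mxEdl _ 2 k 2 k _ 0 0 0 i j) _; rewrite !mxE [_ == _](@eq_rlshift 2 k).
- apply: etrans (@block_mxEdr _ 2 k 2 k _ 0 0 0 i j) _; rewrite !mxE.
  by rewrite /formal_exponent /= toC0 mul0rn.
Qed.

Section normalized_solution.
Variables (phi eps : R) (nu : int) (Y : C -> U -> mat).
Hypothesis heps : 0 < eps.
Hypothesis hphi : forall u, D u -> admissible phi u.
Hypothesis fY : fundamental D Vm Y.
Hypothesis hYF : asymptotic_on D (sector phi eps nu)
  (fun xi u => Y xi u *m mexp (cexp xi *: Umx u) *m mpow (- xi) (Bmx (Vm u)))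
  (fun u => formal_mul (fun j => G j u) (H_series h0 H u)).

Definition quotient_at (u : U) : mat := invmx (YL 0 u) *m Y 0 u.

(** The two halves of the admissible line, turned by [nu * pi]; both arguments lie in the sector
    because it is enlarged by [eps] at either end. *)
Let th1 : R := phi + nu%:~R * pi.
Let Th : set R := [set th1; th1 - pi].

Let YF (x : C) (u : U) : mat :=
  Y x u *m mexp (cexp x *: Umx u) *m mpow (- x) (Bmx (Vm u)).

Lemma YF_gauged x u : D u ->
  invmx (H0 u) *m YL x u *m quotient_at u *m block_exp (@blk k) (cexp x) u
    *m diag_power formal_exponent (- x)
  = invmx (H0 u) *m YF x u.
Proof.
move=> Du; have [_ uYL _] := fYL.
(* [quotient_at] is read at [x = 0], but the quotient of two solutions has the same value at every
   [x]. *)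
rewrite /quotient_at (fundamental_quotient 0 x fYL fY Du).
have -> : block_exp (@blk k) (cexp x) u = mexp (cexp x *: Umx u).
  by rewrite Umx_block_scalar mexp_scale_diag; congr diag_mx; apply/rowP => j; rewrite !mxE.
have -> : diag_power formal_exponent (- x) = mpow (- x) (Bmx (Vm u)) :> mat.
  rewrite /mpow Bmx_diag// mexp_scale_diag; congr diag_mx.
  by apply/rowP => j; rewrite !mxE.
rewrite /YF -!(mulmxA (invmx (H0 u))); congr (_ *m _).
by rewrite -!mulmxA (mulKVmx (uYL x u Du)).
Qed.

Let sector_ray t r : Th t -> sector phi eps nu (ray t r).
Proof.
have pi0 := pi_gt0 R.
have imE s : ImC (ray s r : C) = s by rewrite ImCD ImCM ReCi ImCi /=; ring.
move=> ht; suff : phi - pi - eps + nu%:~R * pi < ImC (ray t r : C)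
  < phi + eps + nu%:~R * pi by [].
rewrite imE; move: heps pi0 ht; rewrite /Th /th1.
set q0 : R := nu%:~R * pi; move: q0 (pi : R) => q p h1 h2 [] ->; apply/andP; split; lra.
Qed.

Lemma asymptotic_expansion : exists c r : R, 0 <= c /\
  forall t s u, Th t -> r <= s -> D u ->
    mabs (YF (ray t s) u - H0 u) <= c * expR (- s) /\
    mabs (YF (ray t s) u - H0 u - (cexp (ray t s))^-1 *: series1 u)
      <= c * expR (- (s *+ 2)).
Proof.
have [c1 [r1 h1]] := hYF 1; have [c2 [r2 h2]] := hYF 2.
pose n2 : R := k.+2%:R * k.+2%:R.
have n20 : 0 <= n2 by rewrite mulr_ge0.
exists (n2 * (`|c1| + `|c2|)), (Num.max r1 r2); split.
  by rewrite mulr_ge0// addr_ge0.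
move=> t s u ht; rewrite ge_max => /andP[hr1 hr2] Du.
have big r : r <= s -> toC r <= `|cexp (ray t s)|.
  move=> hr; rewrite normCE cabs_cexp_ray ler_toC.
  apply: le_trans hr _; apply: le_trans (expR_ge1Dx s).
  by rewrite lerDr.
have [g0 _ _ _ _] := hG Du.
have A0 : formal_mul (fun j => G j u) (H_series h0 H u) 0 = H0 u.
  by rewrite /formal_mul big_ord1 /= g0 mul1mx.
have A1 : formal_mul (fun j => G j u) (H_series h0 H u) 1 = series1 u.
  by rewrite /formal_mul !big_ord_recl big_ord0 /= g0 mul1mx addr0.
have pw N : `|cexp (ray t s)| ^- N = toC (expR (- (s *+ N))).
  rewrite normCE cabs_cexp_ray -toCX -toCV; congr toC.
  by rewrite expRN -expRM_natl mulr_natl.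
have bnd N c (M : mat) : `|c| <= `|c1| + `|c2| ->
    `|M| <= toC c * `|cexp (ray t s)| ^- N ->
    mabs M <= n2 * (`|c1| + `|c2|) * expR (- (s *+ N)).
  move=> hc; rewrite pw -toCM => /mabs_norm h; apply: (le_trans h).
  rewrite -[leRHS]mulrA; apply: ler_wpM2l; first exact: n20.
  by rewrite ler_wpM2r ?expR_ge0// (le_trans (ler_norm _) hc).
split.
  have := h1 _ _ (sector_ray s ht) Du (big _ hr1).
  rewrite big_ord1 expr0 invr1 scale1r A0 => /(bnd 1 c1); apply.
  by rewrite lerDl.
have := h2 _ _ (sector_ray s ht) Du (big _ hr2).
rewrite !big_ord_recl big_ord0 addr0 /= expr0 invr1 scale1r A0 expr1.
rewrite [formal_mul _ _ _]A1 (opprD (H0 u)) addrA => /(bnd 2 c2); apply.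
by rewrite lerDr.
Qed.

Lemma quotient_inv u u' : D u ->
  invmx (quotient_at u) *m quotient_at u'
  = invmx (Y 0 u) *m YL 0 u *m quotient_at u'.
Proof.
move=> Du; have [_ uYL _] := fYL; have [_ uY _] := fY; congr (_ *m _).
have e : quotient_at u *m (invmx (Y 0 u) *m YL 0 u) = 1%:M.
  rewrite /quotient_at -mulmxA (mulKVmx (uY 0 u Du)).
  exact: mulVmx (uYL 0 u Du).
have [uq _] := mulmx1_unit e.
by rewrite -[RHS](mulKmx uq) e mulmx1.
Qed.

Lemma quotient_locally_constant u0 : D u0 ->
  \forall u \near u0, quotient_at u = quotient_at u0.
Proof.
move=> Du0; have [c [r [c0 hc]]] := asymptotic_expansion.
have [_ uYL _] := fYL; have [_ uY _] := fY; have [hh hH'] := hH.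
have Th1 : Th th1 by left.
(* A uniform bound on [series1] comes from the asymptotics themselves: at one fixed [z] it is [z]
   times the difference of the remainders after one and after two terms. *)
pose s0 := r; pose CA : R := expR s0 * (c * expR (- s0) + c * expR (- (s0 *+ 2))).
have hCA u : D u -> mabs (series1 u) <= CA.
  move=> Du; have [e1 e2] := hc th1 s0 u Th1 (lexx _) Du.
  have -> : series1 u = cexp (ray th1 s0) *: ((YF (ray th1 s0) u - H0 u)
      - (YF (ray th1 s0) u - H0 u - (cexp (ray th1 s0))^-1 *: series1 u)).
    by rewrite opprB addrC subrK scalerA divff ?cexp_neq0// scale1r.
  rewrite mabsZ cabs_cexp_ray ler_wpM2l ?expR_ge0//.
  by apply: (le_trans (mabsB _ _)); apply: lerD.
have CA0 : 0 <= CA.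
  by rewrite mulr_ge0 ?expR_ge0// addr_ge0// mulr_ge0 ?expR_ge0.
(* [Mi] and [Mw] bound [invmx (H0 u)] and the matrix [W] near [u0]; their leading factors, twice the
   matrix size, come from [near_mabs_inv]. *)
pose Mi : R := 2%:R * 2%:R * mabs (invmx (h0 u0)) + k%:R.
pose Mw : R := 2%:R * k.+2%:R * mabs (invmx (Y 0 u0)) * (mabs (YL 0 u0) + 1)
  * mabs (quotient_at u0).
have Mi0 : 0 <= Mi by rewrite addr_ge0// !mulr_ge0// mabs_ge0.
pose c' : R := Mi * CA + Mw + Mi * c.
have Mw0 : 0 <= Mw.
  by rewrite !mulr_ge0 ?mabs_ge0// addr_ge0// mabs_ge0.
pose N := [set u | [/\ D u, mabs (invmx (H0 u)) <= Mi &
  mabs (invmx (quotient_at u) *m quotient_at u0) <= Mw]].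
have hN : nbhs u0 N.
  have [uh0 _ _ _ _] := hH' u0 Du0.
  have ch0 : {for u0, continuous h0}.
    by apply: differentiable_continuous; exact: hh.
  have n1 := near_mabs_inv ch0 uh0.
  have n2 := near_mabs_inv (fundamental_continuous (x := 0) fY Du0) (uY 0 u0 Du0).
  have n3 := near_mabs_bounded (fundamental_continuous (x := 0) fYL Du0).
  have n4 := open_nbhs_nbhs (conj oD Du0).
  apply: filterS (filterI (filterI n1 n2) (filterI n3 n4)) => u [[k1 k2] [k3 Du]].
  split => //.
    have [uh _ _ _ _] := hH' u Du.
    by rewrite invmx_H0// mabs_extend2 lerD2r; exact: k1.
  rewrite quotient_inv//; apply: (le_trans (mabsM _ _)).
  rewrite ler_wpM2r ?mabs_ge0//; apply: (le_trans (mabsM _ _)).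
  by apply: ler_pM; rewrite ?mabs_ge0//; apply: k2; exact: uY.
have ler3 (p q w : R) : 0 <= p -> 0 <= q -> 0 <= w ->
  [/\ p <= p + q + w, q <= p + q + w & w <= p + q + w].
  by move=> *; split; lra.
have [l1 l2 l3] := ler3 _ _ _ (mulr_ge0 Mi0 CA0) Mw0 (mulr_ge0 Mi0 c0).
apply: (@flat_asymptotics_constant R k.+1 k.+1 (@blk k) formal_exponent `|b1| N u0
  (fun x u => invmx (H0 u) *m YL x u) (fun u => invmx (H0 u) *m series1 u)
  quotient_at c' r Th).
- exact: formal_exponent_bound.
- exact: hb1.
- exact: hN.
- move=> x u [Du _ _]; rewrite unitmx_mul unitmx_inv H0_unit//=.
  exact: uYL.
- by move=> x u v [Du _ _]; exact: gauged_derivative.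
- move=> u [Du h1 _]; apply: le_trans l1; apply: (le_trans (mabsM _ _)).
  by apply: ler_pM; rewrite ?mabs_ge0// hCA.
- move=> u [Du _ _]; rewrite /quotient_at unitmx_mul unitmx_inv.
  by apply/andP; split; [exact: uYL | exact: uY].
- by move=> u [_ _ h]; apply: le_trans h l2.
- move=> t s u ht [Du h1 _] hs; rewrite YF_gauged//.
  have [_ e2] := hc t s u ht hs Du.
  have -> : invmx (H0 u) *m YF (ray t s) u - 1%:M
      - (cexp (ray t s))^-1 *: (invmx (H0 u) *m series1 u)
      = invmx (H0 u) *m (YF (ray t s) u - H0 u
          - (cexp (ray t s))^-1 *: series1 u).
    by rewrite !mulmxBr (mulVmx (H0_unit Du)) -scalemxAr.
  apply: (le_trans (mabsM _ _)).
  apply: (le_trans (ler_pM (mabs_ge0 _) (mabs_ge0 _) h1 e2)).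
  by rewrite mulrA ler_wpM2r ?expR_ge0.
- by exists th1.
- move=> a a' ne.
  pose w := ReC (cexp ('i * toC th1) * (u0 0 (blk a') - u0 0 (blk a))).
  have cE : cexp ('i * toC th1) = cexp ('i * toC phi) * cexp ('i * toC (nu%:~R * pi)) :> C.
    by rewrite -cexpD -mulrDr -toCD.
  have ne' : u0 0 (blk a') != u0 0 (blk a).
    by apply: hDu => //; rewrite eq_sym.
  have w0 : w != 0.
    have := hphi Du0 ne' (oner_neq0 R); rewrite toC1 mul1r.
    rewrite /w cE; have [->|->] := cexp_ipi_int (R := R) nu; first by rewrite mulr1.
    by rewrite mulrN1 mulNr ReCN oppr_eq0.
  (* Admissibility gives [w <> 0], and reversing the ray changes its sign. *)
  have [wp|wn] := ltP 0 w; first by exists th1.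
  exists (th1 - pi); first by right.
  have -> : cexp ('i * toC (th1 - pi)) = - cexp ('i * toC th1) :> C.
    rewrite toCB mulrBr cexpD cexpN.
    by rewrite cexp_ipi invrN1 mulrN1.
  by rewrite mulNr ReCN oppr_gt0 lt_neqAle w0 wn.
Qed.

End normalized_solution.

End gauge.

(** Distinct square roots of [-1] have distance 2, so by continuity the sign cannot change
    locally. *)
Lemma sqrN1_constant (R : realType) n (D : set 'rV[Cx R]_n) (w : 'rV[Cx R]_n -> Cx R) :
  path_connected_set D -> open D ->
  (forall u, D u -> {for u, continuous w}) -> (forall u, D u -> w u ^+ 2 = -1) ->
  forall u u', D u -> D u' -> w u = w u'.
Proof.
move=> pD oD cw w2; apply: locally_constant_path_connected => // u Du.
have := cw u Du => /cvgrPdist_lt /(_ 1 ltr01).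
have := open_nbhs_nbhs (conj oD Du); apply: filterS2 => u' Du' h.
have /eqP := etrans (w2 u' Du') (esym (w2 u Du)).
rewrite eqf_sqr => /orP[/eqP//|/eqP e].
have n1 : `|w u| = 1.
  by apply/eqP; rewrite -(@pexpr_eq1 _ _ 2)// -normrX w2// normrN1.
by move: h; rewrite e opprK -mulr2n normrMn n1 ltrn1.
Qed.

(** [V^1_2 = h w] with [h = (1 - 2/m) / 2], and [w] is [i] or [- i] throughout [D]; so [b] is [- h]
    or [h], and [2 h = 1 - 2/m < 1]. *)
Lemma Vmx12_real_constant (R : realType) k mul e E g d m
  (W : set 'rV[Cx R]_k.+2) (D : set 'rV[Cx R]_k.+1) Nf s :
  open W -> dubrovin_frobenius_on W mul e E g d ->
  (forall v w, holomorphic W (fun y => g y v w : (Cx R)^o)) ->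
  (forall y, W y ->
   [/\ mul y dt dt = (y 0 0) ^+ (m - 2) *: pi_ ord0,
      mul y dt (pi_ ord0) = dt,
      forall i, i != ord0 -> mul y dt (pi_ i) = 0,
      forall i j, mul y (pi_ i) (pi_ j) = if i == j then pi_ i else 0 &
      E y = (2%:R / m%:R * y 0 0) *: dt
        + \sum_(i < k.+1) y 0 (lift ord0 i) *: pi_ i]) ->
  (3 <= m)%N -> open D -> D !=set0 -> path_connected_set D ->
  (forall u, D u -> W (emb u)) -> normal_frame_data g D Nf s ->
  exists b : R, `|b| *+ 2 < 1 /\
    forall u, D u -> 'i * Vmx E g d Nf s u (@i1 k) (@i2 k) = toC b.
Proof.
move=> oW hdf hg hI2 hm oD [u0 Du0] pD hDW hNs.
pose w u := Nf u 0 (lift ord0 ord0) * s ord0 u.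
have w2 u : D u -> w u ^+ 2 = -1.
  by move=> Du; exact: (Nf_s_sqr hdf hI2 hm hDW hNs Du).
have cw u : D u -> {for u, continuous w}.
  move=> Du; have [hN _ _ hs _] := hNs.
  have cN := differentiable_continuous (hN u Du).
  have cs := differentiable_continuous (hs ord0 u Du).
  apply: (@cvgM _ _ (nbhs u) _ (fun u => Nf u 0 (lift ord0 ord0)) (s ord0)).
    refine (@continuous_comp _ _ _ Nf
      (fun A : 'rV[Cx R]_k.+2 => A 0 (lift ord0 ord0)) u cN _).
    exact: coord_continuous.
  exact: cs.
have wE u : D u -> w u = w u0 by move=> Du; exact: (sqrN1_constant pD oD cw w2).
pose h : R := 2%:R^-1 * (1 - 2%:R / m%:R).
have m0 : 0 < m%:R :> R by rewrite ltr0n (ltn_trans _ hm).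
have h0 : 0 <= h.
  rewrite mulr_ge0 ?invr_ge0// subr_ge0 ler_pdivrMr// mul1r ler_nat.
  exact: ltnW.
have h1 : h *+ 2 < 1.
  by rewrite -mulr_natl mulVKf ?pnatr_eq0// ltrBlDr ltrDl divr_gt0.
have hE : toC h = 2%:R^-1 * (1 - 2%:R / m%:R) :> Cx R.
  by rewrite toCM toCB toCM !toCV !toC_nat toC1.
have [b [hb bE]] : exists b : R, `|b| *+ 2 < 1 /\ 'i * (toC h * w u0) = toC b.
  have /eqP := etrans (w2 u0 Du0) (esym (sqrCi (Cx R))).
  rewrite eqf_sqr => /orP[] /eqP ->.
    by exists (- h); rewrite normrN ger0_norm// toCN mulrCA -expr2 sqrCi mulrN1.
  exists h; rewrite ger0_norm//; split => //.
  by rewrite !mulrN mulrCA -expr2 sqrCi mulrN1 opprK.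
exists b; split => // u Du.
rewrite (Vmx12 oW hdf hg hI2 hm hDW hNs Du) -hE.
by rewrite -bE -(wE u Du).
Qed.

Theorem theorem6p6 (R : realType) (M : topologicalType) (k : nat)
  (F : df_data R M k.+2) (hF : dubrovin_frobenius F)
  (p : M) (hp : caustic F p)
  (m : nat) (hm : (3 <= m)%N)
  (x : chart R M k.+2) (hpx : cdom x p) (hx : I2_A1_chart F m x)
  (hK : caustic_nondegenerate F)
  (D : set 'rV[Cx R]_k.+1) (hD : simply_connected_domain D)
  (hDW : forall u, D u -> cimg x (emb u))
  (hDu : distinct_coordinates D)
  (Nf : 'rV[Cx R]_k.+1 -> 'rV[Cx R]_k.+2)
  (s : 'I_k.+1 -> 'rV[Cx R]_k.+1 -> Cx R)
  (hNs : normal_frame_data (df_metric F x) D Nf s) :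
  let V := Vmx (df_euler F x) (df_metric F x) (df_d F) Nf s in
  let B := fun u => Bmx (V u) in
  forall
    (YL T : Cx R -> 'rV[Cx R]_k.+1 -> 'M[Cx R]_k.+2)
    (Delta S : 'rV[Cx R]_k.+1 -> 'M[Cx R]_k.+2)
    (Rk : nat -> 'rV[Cx R]_k.+1 -> 'M[Cx R]_k.+2) (K : nat)
    (hYL : fundamental_solution (df_euler F x) (df_metric F x) (df_d F)
             Nf s D YL)
    (hLevelt : levelt_form D V YL T Delta S Rk K)
    (hflat : flat_columns (df_mul F x) (df_euler F x) (df_metric F x) (df_d F)
               Nf s D YL)
    (G Bk : nat -> 'rV[Cx R]_k.+1 -> 'M[Cx R]_k.+2)
    (hG : first_gauge D V (@Umx R k) G Bk)
    (h0 : 'rV[Cx R]_k.+1 -> 'M[Cx R]_2)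
    (H : nat -> 'rV[Cx R]_k.+1 -> 'M[Cx R]_k.+2)
    (hH : second_gauge D V (omega2 (df_metric F x) Nf s) Bk h0 H)
    (phi eps : R) (hphi : forall u, D u -> admissible phi u) (heps : 0 < eps)
    (Y : int -> Cx R -> 'rV[Cx R]_k.+1 -> 'M[Cx R]_k.+2)
    (hY : forall nu, fundamental_solution (df_euler F x) (df_metric F x)
                       (df_d F) Nf s D (Y nu))
    (hYF : forall nu, asymptotic_on D (sector phi eps nu)
       (fun xi u => Y nu xi u *m mexp (cexp xi *: Umx u) *m mpow (- xi) (B u))
       (fun u => formal_mul (fun j => G j u) (H_series h0 H u))),
  [/\ exists M0, forall u, D u ->
        mexp ((2%:R * 'i * toC pi) *: (\sum_(1 <= h < K) Rk h u + S u)) = M0,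
      exists B0, forall u, D u -> B u = B0,
      forall nu, exists St, forall u, D u ->
        forall xi, Y (nu + 1) xi u = Y nu xi u *m St &
      exists C0, forall u, D u -> forall xi, YL xi u = Y 0 xi u *m C0].
Proof.
move=> V B YL T Delta S Rk K hYL hLevelt hflat G Bk hG h0 H hH phi eps hphi heps
  Y hY hYF.
have [oD [u0 Du0] pD _] := hD.
have [_ [hatlas _ _ _] hhol _ hdfs] := hF.
have [ax hI2] := hx.
have [_ oW _ _ _] := hatlas x ax.
have [_ _ _ hg] := hhol x ax.
have hdf := hdfs x ax.
have [b [hb Vb]] : exists b : R, `|b| *+ 2 < 1 /\
    forall u, D u -> 'i * V u (@i1 k) (@i2 k) = toC b.
  apply: (Vmx12_real_constant oW hdf hg hI2 hm oD _ pD hDW hNs).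
  by exists u0.
have fYL : fundamental D V YL by have [? ? ?] := hYL; split.
have fY nu : fundamental D V (Y nu) by have [? ? ?] := hY nu; split.
have flatYL xi u i (Du : D u) :=
  flat_columns_derivative oW hdf hg hI2 hm hDW hNs Du i hflat
    (fundamental_diff_param xi fYL Du).
have offblk u i a a' (Du : D u) (ne : blk a != blk a') :=
  omega_offblk oW hdf hg hI2 hm oD hDW hNs Du i ne.
have diag u i j (Du : D u) :=
  omega_diag oW hdf hg hI2 hm oD hDW hNs Du i j.
have quotE nu u : D u -> quotient_at YL (Y nu) u = quotient_at YL (Y nu) u0.
  move=> Du; apply: (locally_constant_path_connected pD _ Du Du0) => u1 Du1.
  exact: (quotient_locally_constant oD fYL flatYL offblk diag hDu hG hH hb Vb
    heps hphi (fY nu) (hYF nu) Du1).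
(* Every [Y nu] is now [Y_L] times a matrix independent of [xi] and of [u]; Stokes and connection
   matrices are quotients of these. *)
have YE nu xi u : D u -> Y nu xi u = YL xi u *m quotient_at YL (Y nu) u0.
  move=> Du; rewrite -(quotE nu u Du) /quotient_at.
  have [_ uYL _] := fYL.
  by rewrite (fundamental_quotient 0 xi fYL (fY nu) Du) (mulKVmx (uYL xi u Du)).
have uq nu : quotient_at YL (Y nu) u0 \in unitmx.
  have [_ uYL _] := fYL; have [_ uY _] := fY nu.
  rewrite /quotient_at unitmx_mul unitmx_inv.
  by apply/andP; split; [exact: uYL | exact: uY].
have YLE nu xi u : D u -> YL xi u = Y nu xi u *m invmx (quotient_at YL (Y nu) u0).
  by move=> Du; rewrite (YE nu xi u Du) (mulmxK (uq nu)).
split.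
- exists (mexp ((2%:R * 'i * toC pi) *: (\sum_(1 <= h < K) Rk h u0 + S u0))).
  move=> u Du; exact: (levelt_monodromy oD pD fYL flatYL hLevelt Du Du0).
- exists (B u0) => u Du.
  have i0 : 'i != 0 :> Cx R by exact: neq0Ci.
  by rewrite /B /Bmx (mulfI i0 (etrans (Vb u Du) (esym (Vb u0 Du0)))).
- move=> nu; exists (invmx (quotient_at YL (Y nu) u0) *m quotient_at YL (Y (nu + 1)) u0).
  move=> u Du xi; rewrite (YE (nu + 1) xi u Du) (YLE nu xi u Du).
  exact: esym (mulmxA _ _ _).
- by exists (invmx (quotient_at YL (Y 0) u0)) => u Du xi; exact: YLE.
Qed.
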